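(* Let $G$ be a connected, non-compact, real semisimple Lie group and $m\in\mathbb{R}$. Denote by $\Sigma_m$ the connected component containing $(e,0)$ of the subset $\{\,(e,X)\in\Sigma \ :\ |(DP_m)_{(e,X)}|\neq 0\,\}$ of $\Sigma$ (the points of $\Sigma$ at which the differential of $P_m:G\times\mathfrak{g}\to G^{\mathbb{C}}$ is non-singular). Then the maximal adapted complexification $\Omega_m$ satisfies $\Omega_m=L\cdot\Sigma_m$.
   Context: Let $\mathfrak{g}=\mathfrak{k}\oplus\mathfrak{p}$ be the Cartan decomposition of the Lie algebra of $G$ with respect to a maximal compact subalgebra $\mathfrak{k}$, and let $K$ be the connected subgroup of $G$ generated by $\mathfrak{k}$. Write $X=X_{\mathfrak{k}}+X_{\mathfrak{p}}$ for $X\in\mathfrak{g}$. Let $\mathfrak{a}^+$ be the closure of a Weyl chamber in a maximal abelian subalgebra $\mathfrak{a}$ of $\mathfrak{p}$, and $$\Sigma:=\{\,(e,X)\in G\times\mathfrak{g}\ :\ X_{\mathfrak{p}}\in\mathfrak{a}^+\,\}.$$ $L:=G\times K$ acts on $TG\cong G\times\mathfrak{g}$ (identification by left translations) by $(g,k)\cdot(g',X)=(gg'k^{-1},\mathrm{Ad}_kX)$. $G^{\mathbb{C}},K^{\mathbb{C}}$ denote universal complexifications and $$P_m:G\times\mathfrak{g}\to G^{\mathbb{C}},\qquad P_m(g,X)=g\exp_{G^{\mathbb{C}}}\!\big(i(-mX_{\mathfrak{k}}+X_{\mathfrak{p}})\big)\exp_{K^{\mathbb{C}}}\!\big(i(1+m)X_{\mathfrak{k}}\big).$$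 $\Omega_m\subset TG$ is the maximal complexification adapted to the left-invariant connection $\nabla_m$ given on left-invariant fields by $\nabla_{m\,X}Y=\tfrac12([X,Y]+(1+m)([X_{\mathfrak{k}},Y_{\mathfrak{p}}]+[Y_{\mathfrak{k}},X_{\mathfrak{p}}]))$ (for $m\neq0$, the Levi-Civita connection of the left-invariant metric $\nu_m$ with $\nu_m|_{\mathfrak g}(X,Y)=-mB(X_{\mathfrak{k}},Y_{\mathfrak{k}})+B(X_{\mathfrak{p}},Y_{\mathfrak{p}})$, $B$ the Killing form). Here a domain $\Omega\subset TG$ containing the zero section, with a real-analytic complex structure, is an adapted complexification if for every $\nabla_m$-geodesic $\gamma$ the map $x+iy\mapsto y\gamma'(x)$ is holomorphic where it takes values in $\Omega$; maximal means containing every other adapted complexification. $\Omega_m$ is the connected component of $\{|DP_m|\neq0\}$ in $G\times\mathfrak{g}$ containing $G\times\{0\}$. *)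

(* Defs.v *)
From HB Require Import structures.
From mathcomp Require Import all_boot all_order all_algebra.
From mathcomp Require Import all_classical all_reals all_analysis.

Set Implicit Arguments.
Unset Strict Implicit.
Unset Printing Implicit Defensive.
Import Order.TTheory GRing.Theory Num.Theory numFieldNormedType.Exports.
Local Open Scope classical_set_scope.
Local Open Scope ring_scope.

Section Calculus.
Context {R : realType}.
Implicit Types E F : normedModType R.

Definition multilinear (k : nat) E F (p : ('I_k -> E) -> F) :=
  forall (v : 'I_k -> E) (i : 'I_k), linear (fun x : E => p (dfwith v i x)).

(* [f (a + x)] is, for small [x], the sum of a normally convergent series of
   homogeneous polynomials, the k-th one being given by a k-linear map. *)
Definition analytic_at E F (f : E -> F) (a : E) :=
  exists (p : forall k, ('I_k -> E) -> F) (c : nat -> R) (r : R),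
    [/\ 0 < r,
        forall k, multilinear (p k),
        forall k v, `|p k v| <= c k * \prod_i `|v i|,
        cvgn (series (fun k => c k * r ^+ k))
      & forall x, `|x| < r ->
          series (fun k => p k (fun=> x)) @ \oo --> f (a + x)].

(* C^d is modelled on the real space R^d * R^d, (x, y) standing for x + iy;
   [mulI] is multiplication by i.  Likewise R * R stands for C. *)
Definition mulI E (z : E * E) : E * E := (- z.2, z.1).

Definition cvec (d : nat) : normedModType R := ('rV[R]_d * 'rV[R]_d)%type.

(* [JE] and [JF] are the multiplications by i of the source and the target. *)
Definition holomorphic_at E F (JE : E -> E) (JF : F -> F) (f : E -> F) (a : E) :=
  \forall x \near a,
    differentiable f x /\ forall v, 'd f x (JE v) = JF ('d f x v).

Definition cholomorphic_at (d e : nat) (f : cvec d -> cvec e) (a : cvec d) :=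
  holomorphic_at (@mulI 'rV[R]_d) (@mulI 'rV[R]_e) f a.

End Calculus.

(* An atlas with a distinguished chart at each point: [phi x] is the chart at
   [x], with domain [dom x] and inverse [psi x].  It identifies the tangent
   space at [x] with the model space [E]. *)
Record atlas (T E : Type) := Atlas {
  dom : T -> set T;
  phi : T -> T -> E;
  psi : T -> E -> T }.

Section Manifolds.
Context {R : realType}.

(* [reg] is the regularity (analytic, holomorphic) of the transition maps. *)
Definition is_manifold (T : topologicalType) (E : normedModType R)
    (reg : (E -> E) -> E -> Prop) (M : set T) (A : atlas T E) :=
  [/\ forall x, M x ->
        [/\ open (dom A x), dom A x `<=` M, dom A x x & open (phi A x @` dom A x)],
      forall x y, M x -> dom A x y -> psi A x (phi A x y) = y,
      forall x, M x -> {within dom A x, continuous (phi A x)},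
      forall x, M x -> {within phi A x @` dom A x, continuous (psi A x)}
    & forall x y z, M x -> M y -> dom A x z -> dom A y z ->
        reg (phi A y \o psi A x) (phi A x z)].

Definition regular_map (T U : topologicalType) (E F : normedModType R)
    (reg : (E -> F) -> E -> Prop) (A : atlas T E) (B : atlas U F)
    (M : set T) (f : T -> U) :=
  forall x, M x -> {for x, continuous f} /\
    reg (phi B (f x) \o f \o psi A x) (phi A x x).

Definition tdiff (T U : Type) (E F : normedModType R)
    (A : atlas T E) (B : atlas U F) (f : T -> U) (x : T) : E -> F :=
  'd (phi B (f x) \o f \o psi A x) (phi A x x).

Definition prod_atlas (T U E F : Type) (A : atlas T E) (B : atlas U F) :
    atlas (T * U) (E * F) :=
  {| dom := fun p => dom A p.1 `*` dom B p.2;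
     phi := fun p q => (phi A p.1 q.1, phi B p.2 q.2);
     psi := fun p v => (psi A p.1 v.1, psi B p.2 v.2) |}.

Definition vec_atlas (E : Type) : atlas E E :=
  {| dom := fun=> setT; phi := fun=> id; psi := fun=> id |}.

End Manifolds.

#[short(type="topGroupType")]
HB.structure Definition TopGroup := {T of Topological T & Group T}.

Record lieGroup (R : realType) (E : normedModType R) := LieGroup {
  lg_sort :> topGroupType;
  lg_atlas : atlas lg_sort E;
  lg_hausdorff : hausdorff_space lg_sort;
  lg_manifold : is_manifold (@analytic_at R E E) setT lg_atlas;
  lg_mul_analytic :
    regular_map (@analytic_at R (E * E)%type E)
      (prod_atlas lg_atlas lg_atlas) lg_atlas setT (fun q => (q.1 * q.2)%g);
  lg_inv_analytic :
    regular_map (@analytic_at R E E) lg_atlas lg_atlas setT (fun g => g^-1%g) }.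

Record complexLieGroup (R : realType) (d : nat) := ComplexLieGroup {
  clg :> lieGroup (@cvec R d);
  clg_manifold : is_manifold (@cholomorphic_at R _ _) setT (lg_atlas clg);
  clg_mul_holomorphic :
    regular_map
      (holomorphic_at
        (fun v : cvec d * cvec d =>
           (@mulI R 'rV[R]_d v.1, @mulI R 'rV[R]_d v.2) : cvec d * cvec d)
        (@mulI R 'rV[R]_d : cvec d -> cvec d))
      (prod_atlas (lg_atlas clg) (lg_atlas clg)) (lg_atlas clg) setT
      (fun q => (q.1 * q.2)%g);
  clg_inv_holomorphic :
    regular_map (@cholomorphic_at R _ _) (lg_atlas clg) (lg_atlas clg) setT
      (fun g => g^-1%g) }.

Section LieTheory.
Context {R : realType}.
Implicit Types E F : normedModType R.

Definition lie_hom E F (G : lieGroup E) (H : lieGroup F) (f : G -> H) :=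
  (forall x y, f (x * y)%g = (f x * f y)%g) /\
  regular_map (@analytic_at R E F) (lg_atlas G) (lg_atlas H) setT f.

Definition hol_hom d e (G : complexLieGroup R d) (H : complexLieGroup R e)
    (f : G -> H) :=
  (forall x y, f (x * y)%g = (f x * f y)%g) /\
  regular_map (@cholomorphic_at R _ _) (lg_atlas G) (lg_atlas H) setT f.

Definition is_universal_complexification E (G : lieGroup E)
    d (GC : complexLieGroup R d) (eta : G -> GC) :=
  lie_hom eta /\
  forall e (H : complexLieGroup R e) (f : G -> H), lie_hom f ->
    exists! F : GC -> H, hol_hom F /\ forall g, F (eta g) = f g.

(* The Lie algebra of [G] is the tangent space at 1, that is, [E]. *)

Definition lie_diff E F (G : lieGroup E) (H : lieGroup F) (f : G -> H) : E -> F :=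
  tdiff (lg_atlas G) (lg_atlas H) f 1%g.

Definition Ad E (G : lieGroup E) (g : G) : E -> E :=
  lie_diff (fun h : G => (g * h * g^-1)%g).

(* [X, Y] is the derivative of [x |-> Ad x Y] at 1 in the direction [X]. *)
Definition bracket E (G : lieGroup E) (X Y : E) : E :=
  'D_X (fun v => Ad (psi (lg_atlas G) 1%g v) Y) (phi (lg_atlas G) 1%g 1%g).

Definition one_parameter_subgroup E (G : lieGroup E) (X : E) (c : R -> G) :=
  [/\ continuous c,
      forall s t, c (s + t) = (c s * c t)%g
    & is_derive (0 : R^o) (1 : R^o) (phi (lg_atlas G) 1%g \o c : R^o -> E) X].

Definition lie_exp E (G : lieGroup E) (X : E) : G :=
  xget 1%g [set g : G | exists2 c, one_parameter_subgroup X c & g = c 1].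

(* [j] realizes [K] as the connected Lie subgroup of [G] with Lie algebra [k]. *)
Definition is_connected_subgroup n l (G : lieGroup 'rV[R]_n)
    (K : lieGroup 'rV[R]_l) (j : K -> G) (k : {vspace 'rV[R]_n}) :=
  [/\ connected [set: K], lie_hom j, injective j, injective (lie_diff j)
    & range (lie_diff j) = [set X | X \in k]].

End LieTheory.

Section Semisimple.
Context {R : realType} {n : nat} (G : lieGroup 'rV[R]_n).
Implicit Types k p a : {vspace 'rV[R]_n}.

Definition killing (X Y : 'rV[R]_n) : R :=
  \tr (lin1_mx (bracket G X \o bracket G Y)).

Definition abelian_subspace a :=
  forall X Y, X \in a -> Y \in a -> bracket G X Y = 0.

Definition is_ideal a := forall X Y, Y \in a -> bracket G X Y \in a.

Definition semisimple := forall a, is_ideal a -> abelian_subspace a -> a = 0%VS.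

Definition cartan_decomposition k p :=
  [/\ (k + p)%VS = fullv /\ (k :&: p)%VS = 0%VS,
      forall X Y, X \in k -> Y \in k -> bracket G X Y \in k,
      forall X Y, X \in k -> Y \in p -> bracket G X Y \in p,
      forall X Y, X \in p -> Y \in p -> bracket G X Y \in k
    & (forall X, X \in k -> X != 0 -> killing X X < 0) /\
      (forall X, X \in p -> X != 0 -> 0 < killing X X)].

Definition maximal_abelian p a :=
  [/\ (a <= p)%VS, abelian_subspace a
    & forall b, (a <= b)%VS -> (b <= p)%VS -> abelian_subspace b -> b = a].

(* Only the values of [alpha] on [a], where it is linear, matter. *)
Definition restricted_root a (alpha : 'rV[R]_n -> R) :=
  (exists2 H, H \in a & alpha H != 0) /\
  (exists2 X, X != 0 & forall H, H \in a -> bracket G H X = alpha H *: X).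

Definition regular_set a : set 'rV[R]_n :=
  [set H | H \in a /\ forall alpha, restricted_root a alpha -> alpha H != 0].

Definition closed_weyl_chamber a (ap : set 'rV[R]_n) :=
  exists2 H, regular_set a H & ap = closure (connected_component (regular_set a) H).

End Semisimple.

Section Adapted.
Context {R : realType} {n : nat} (G : lieGroup 'rV[R]_n).

(* TG is identified with G * g by left translations. *)
Definition TG : topologicalType := (G * 'rV[R]_n)%type.

Definition TG_atlas : atlas TG ('rV[R]_n * 'rV[R]_n) :=
  prod_atlas (lg_atlas G) (vec_atlas 'rV[R]_n).

(* [nabla] is a left-invariant connection, given on left-invariant fields;
   [u] is the velocity of [c] in the left trivialization, in terms of which
   the acceleration of [c] is u' + nabla u u. *)
Definition geodesic (nabla : 'rV[R]_n -> 'rV[R]_n -> 'rV[R]_n)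
    (I : set R) (c : R -> G) (u : R -> 'rV[R]_n) :=
  [/\ open I, is_interval I & forall t, I t ->
    [/\ {for t, continuous c},
        is_derive (t : R^o) (1 : R^o)
          (fun s : R^o => phi (lg_atlas G) 1%g ((c t)^-1 * c s)%g) (u t)
      & is_derive (t : R^o) (1 : R^o) (u : R^o -> 'rV[R]_n)
          (- nabla (u t) (u t))]].

(* [Z] is a holomorphic atlas on the domain [Om], compatible with its
   real-analytic structure. *)
Definition complex_structure (Om : set TG) (Z : atlas TG (@cvec R n)) :=
  [/\ is_manifold (@cholomorphic_at R _ _) Om Z,
      regular_map (@analytic_at R _ _) TG_atlas Z Om id
    & regular_map (@analytic_at R _ _) Z TG_atlas Om id].

Definition adapted_complexification
    (nabla : 'rV[R]_n -> 'rV[R]_n -> 'rV[R]_n) (Om : set TG) :=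
  [/\ open Om, connected Om, forall g : G, Om (g, 0)
    & exists2 Z, complex_structure Om Z &
        forall I c u, geodesic nabla I c u ->
        forall x y : R, I x -> Om (c x, y *: u x) ->
          holomorphic_at (@mulI R R^o) (@mulI R 'rV[R]_n)
            (fun z => phi Z (c x, y *: u x) (c z.1, z.2 *: u z.1)) (x, y)].

Definition maximal_adapted_complexification
    (nabla : 'rV[R]_n -> 'rV[R]_n -> 'rV[R]_n) (Om : set TG) :=
  adapted_complexification nabla Om /\
  forall Om', adapted_complexification nabla Om' -> Om' `<=` Om.

End Adapted.

Section Slice.
Context {R : realType} {n : nat} (G : lieGroup 'rV[R]_n).
Context (k p : {vspace 'rV[R]_n}).

Definition kpart (X : 'rV[R]_n) : 'rV[R]_n := daddv_pi k p X.
Definition ppart (X : 'rV[R]_n) : 'rV[R]_n := daddv_pi p k X.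

Definition nabla (m : R) (X Y : 'rV[R]_n) : 'rV[R]_n :=
  2^-1 *: (bracket G X Y + (1 + m) *:
    (bracket G (kpart X) (ppart Y) + bracket G (kpart Y) (ppart X))).

Definition Sigma (ap : set 'rV[R]_n) : set (TG G) :=
  [set q | q.1 = 1%g /\ ap (ppart q.2)].

Context {l : nat} {K : lieGroup 'rV[R]_l} (j : K -> G).

Definition L_act (g : G) (h : K) (q : TG G) : TG G :=
  ((g * q.1 * (j h)^-1)%g, Ad (j h) q.2).

Definition L_orbit (S : set (TG G)) : set (TG G) :=
  [set q | exists g h s, S s /\ q = L_act g h s].

(* The element of the Lie algebra of [K] corresponding to [X] in [k]. *)
Definition lie_lift (X : 'rV[R]_n) : 'rV[R]_l := xget 0 [set Y | lie_diff j Y = X].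

Context {d : nat} {GC : complexLieGroup R d} (eta : G -> GC).
Context {e : nat} {KC : complexLieGroup R e} (kappa : K -> KC) (iota : KC -> GC).

(* [iota] is the map through which the factor in K^C acts on G^C. *)
Definition P_ (m : R) (q : TG G) : GC :=
  (eta q.1
   * lie_exp GC (@mulI R 'rV[R]_d (lie_diff eta (- m *: kpart q.2 + ppart q.2)))
   * iota (lie_exp KC (@mulI R 'rV[R]_e (lie_diff kappa ((1 + m) *: lie_lift (kpart q.2))))))%g.

Definition nonsingular (m : R) : set (TG G) :=
  [set q | bijective (tdiff (TG_atlas G) (lg_atlas GC) (P_ m) q)].

Definition Sigma_ (ap : set 'rV[R]_n) (m : R) : set (TG G) :=
  connected_component (Sigma ap `&` nonsingular m) (1%g, 0).

End Slice.

(* Main.v *)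
From HB Require Import structures.
Require Import Defs.
From mathcomp Require Import all_boot all_order all_algebra.
From mathcomp Require Import all_classical all_reals all_analysis.
From mathcomp Require Import ring lra zify.
Set Implicit Arguments.
Unset Strict Implicit.
Unset Printing Implicit Defensive.
Import Order.TTheory GRing.Theory Num.Theory numFieldNormedType.Exports.
Local Open Scope classical_set_scope.
Local Open Scope ring_scope.

(** The map P_m intertwines the action of L with two-sided translations of the complexified group:
    P_m((g, h).q) = eta(g) P_m(q) eta(j h)^-1 ([polar_equivariant]). The set where its differential
    is bijective is therefore L-invariant, and so is its component Omega through (1, 0), because G
    and K are connected ([component_L_act]). By left invariance Omega is G x U, where the fibre U
    over the identity is an open, connected, Ad(K)-invariant neighbourhood of 0 in the Lie algebra.
    What remains is a statement about U ([slice0_saturation]): if T is the set of X in U with X_p in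
    the closed chamber and S is the component of T containing 0, then U = Ad(K) S.

    That U = Ad(K) T is the conjugacy of elements of p into the chamber, obtained by Hunt's
    maximisation ([hunt], [slice_move]). To replace T by S, one shows that Ad(K) S is open and
    closed in U. The chamber is convex and U is open, so S is open and closed in T; Ad(K) is
    compact, so saturations of closed sets are closed. The saturations of S and of the rest of T are
    disjoint by [slice0_stable]: if X is in S and A in Ad(K) carries X back into T, then XA is in S.
    Indeed Hunt's argument, applied to the image under A of a regular element, corrects A by some z
    in the identity component of the stabilizer of (XA)_p so that Az preserves the chamber. Then
    S(Az) is a connected part of T through 0, and the orbit of XA under the stabilizer component
    joins XA to XAz inside T.

    Ad(K) is bounded because it preserves the inner product made from the Killing form and the
    Cartan decomposition. It is closed ([Gam_closed]) because derivations that preserve k and p are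
    inner, given by elements of k ([derivation_inner]): an automorphism near 1 that respects k and
    p, corrected by the best element of a compact piece of Ad(K), deviates from 1 by an amount
    bounded by its own square, hence not at all.

    The Lie theory is developed from the chart definition without differential equations.
    Analyticity gives the product u + v + O(|u||v|) in a chart ([local_group]); the exponential is a
    limit of dyadic powers ([exp_approx_cvg], [lie_exp_map]); the identities of the bracket, which
    is the derivative of Ad, come from [bracket_taylor] and from limits along sequences tending to
    the identity. *)

Section NormedSpaces.

(** * Limits and Frechet derivatives in epsilon form *)

Context {R : realType}.
Implicit Types E F : normedModType R.

Lemma norm_lim_le E (u : nat -> E) (l : E) (c : R) :
  u @ \oo --> l -> (forall k, `|u k| <= c) -> `|l| <= c.
Proof.
move=> ul uc; have nl : (fun k => `|u k|) @ \oo --> `|l| by apply: cvg_norm.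
have := limr_le (cvgP _ nl); rewrite (cvg_lim _ nl) //; apply.
exact: nearW.
Qed.

Lemma seq_cvgB E (u v : nat -> E) (l l' : E) :
  u @ \oo --> l -> v @ \oo --> l' -> (fun k => u k - v k) @ \oo --> l - l'.
Proof. by move=> ul vl; apply: cvgB. Qed.

Lemma nbhs_addP E (x : E) (P : set E) :
  nbhs x P <-> exists2 d : R, 0 < d & forall h, `|h| < d -> P (x + h).
Proof.
split.
  move=> /nbhs_ballP[d d0 dP]; exists d => // h hd.
  by apply: dP; rewrite -ball_normE /= opprD addNKr normrN.
move=> [d d0 dP]; apply/nbhs_ballP; exists d => // y.
rewrite -ball_normE /= => yd; rewrite -[y](subrKC x); apply: dP.
by rewrite distrC.
Qed.

Lemma differentiable_eps E F (f : E -> F) (x : E) (L : {linear E -> F}) :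
  continuous L ->
  (forall e : R, 0 < e -> exists2 d : R, 0 < d &
     forall h, `|h| < d -> `|f (x + h) - f x - L h| <= e * `|h|) ->
  differentiable f x /\ 'd f x = L :> (E -> F).
Proof.
move=> cL H.
have fL : f \o shift x = cst (f x) + L +o_ 0 id.
  apply/eqaddoP => e e0; have [d d0 dP] := H e e0.
  apply/nbhs_addP; exists d => // h hd; rewrite add0r.
  by rewrite !fctE /= [h + x]addrC opprD addrA; exact: dP.
have dE : 'd f x = L :> (E -> F) by apply: diff_unique.
by split=> //; apply/diff_locallyP; rewrite dE.
Qed.

Lemma diff_eps E F (f : E -> F) (x : E) (e : R) :
  differentiable f x -> 0 < e -> exists2 d : R, 0 < d &
     forall h, `|h| < d -> `|f (x + h) - f x - 'd f x h| <= e * `|h|.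
Proof.
move=> /diff_locally fx e0.
have /eqaddoP/(_ e e0)/nbhs_addP[d d0 dP] := fx.
exists d => // h /dP; rewrite add0r.
by rewrite !fctE /= [h + x]addrC opprD addrA.
Qed.

End NormedSpaces.

(** * Difference estimates for multilinear maps *)

Lemma prodr_except (K : fieldType) k (i : 'I_k) (r : K) :
  r != 0 -> \prod_(j < k | j != i) r = r ^+ k / r.
Proof.
move=> r0; apply: (mulIf r0); rewrite divfK // mulrC.
have <- : \prod_(j < k) r = r * \prod_(j < k | j != i) r by rewrite (bigD1 i).
by rewrite prodr_const card_ord.
Qed.

Section Multilinear.
Context {R : realType} {E F : normedModType R} {k : nat}.
Variable p : ('I_k -> E) -> F.
Hypothesis p_multi : multilinear p.

Definition hybrid (u v : 'I_k -> E) (m : nat) : 'I_k -> E :=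
  fun j => if (j < m)%N then v j else u j.

(** A telescoping sum over the families [hybrid u v i], which pass from [u] to [v] one argument at a
    time. *)
Lemma multilinear_sub (u v : 'I_k -> E) :
  p u - p v = \sum_(i < k) p (dfwith (hybrid u v i) i (u i - v i)).
Proof.
have h0 : hybrid u v 0 = u by apply/funext => j; rewrite /hybrid ltn0.
have hk : hybrid u v k = v by apply/funext => j; rewrite /hybrid ltn_ord.
transitivity (- ((p \o hybrid u v) k - (p \o hybrid u v) 0%N)).
  by rewrite /= h0 hk opprB.
rewrite -(telescope_sumr (p \o hybrid u v) (leq0n k)) big_mkord -sumrN /=.
apply: eq_bigr => i _; rewrite opprB.
have E1 : hybrid u v i = dfwith (hybrid u v i) i (u i).
  apply/funext => j; have [<-|ne] := eqVneq i j.
    by rewrite dfwithin /hybrid ltnn.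
  by rewrite dfwithout.
have E2 : hybrid u v i.+1 = dfwith (hybrid u v i) i (v i).
  apply/funext => j; have [<-|ne] := eqVneq i j.
    by rewrite dfwithin /hybrid ltnSn.
  rewrite dfwithout // /hybrid ltnS leq_eqVlt eq_sym.
  by rewrite (negbTE (ne : val i != val j)).
rewrite E2 {1}E1.
have := p_multi (hybrid u v i) i (-1) (v i) (u i).
by rewrite !scaleN1r [- _ + _]addrC [- p _ + _]addrC => ->.
Qed.

Lemma multilinear_sub_le (c : R) (u v : 'I_k -> E) (rho : 'I_k -> R) :
  (forall w, `|p w| <= c * \prod_i `|w i|) -> 0 <= c ->
  (forall i, `|u i| <= rho i) -> (forall i, `|v i| <= rho i) ->
  `|p u - p v| <= c * \sum_(i < k) (`|u i - v i| * \prod_(j | j != i) rho j).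
Proof.
move=> pc c0 ur vr; rewrite multilinear_sub mulr_sumr.
apply: le_trans (ler_norm_sum _ _ _) _; apply: ler_sum => i _.
apply: le_trans (pc _) _; apply: ler_wpM2l => //.
rewrite (bigD1 i) //= dfwithin; apply: ler_wpM2l => //.
apply: ler_prod => j ji; rewrite normr_ge0 /= dfwithout 1?eq_sym //.
by rewrite /hybrid; case: ifP.
Qed.

Lemma multilinear_diag_sub_le (c rho : R) (w x : E) :
  (forall v, `|p v| <= c * \prod_i `|v i|) -> 0 <= c -> 0 < rho ->
  `|w| <= rho -> `|w + x| <= rho ->
  `|p (fun=> w + x) - p (fun=> w)| <= c * rho ^+ k * k%:R * (`|x| / rho).
Proof.
move=> pc c0 r0 wr wxr.
have := @multilinear_sub_le c (fun=> w + x) (fun=> w) (fun=> rho) pc c0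
  (fun=> wxr) (fun=> wr).
move=> /le_trans; apply; rewrite -!mulrA; apply: ler_wpM2l => //.
rewrite le_eqVlt; apply/orP; left; apply/eqP.
under eq_bigr do rewrite prodr_except ?lt0r_neq0 //.
rewrite sumr_const card_ord -[LHS]mulr_natl addrAC subrr add0r; ring.
Qed.

(** Both first differences telescope with the same increment [x] in slot [i]; each difference of
    summands telescopes again, now with increment [y]. The factor k^2 counts the pairs of slots. *)
Lemma multilinear_diag_sub2_le (c rho : R) (w x y : E) :
  (forall v, `|p v| <= c * \prod_i `|v i|) -> 0 <= c -> 0 < rho ->
  `|w| <= rho -> `|w + x| <= rho -> `|w + y| <= rho -> `|w + x + y| <= rho ->
  `|p (fun=> w + x + y) - p (fun=> w + y) - (p (fun=> w + x) - p (fun=> w))|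
    <= c * rho ^+ k * k%:R ^+ 2 * (`|x| * `|y| / rho ^+ 2).
Proof.
move=> pc c0 r0 wr wxr wyr wxyr; rewrite !multilinear_sub -sumrB.
apply: le_trans (ler_norm_sum _ _ _) _.
have -> : c * rho ^+ k * k%:R ^+ 2 * (`|x| * `|y| / rho ^+ 2) =
    \sum_(i < k) (c * rho ^+ k * k%:R * (`|x| * `|y| / rho ^+ 2)).
  by rewrite sumr_const card_ord -[RHS]mulr_natl; ring.
have E1 : w + x + y - (w + y) = x by rewrite [w + x]addrC -[x + w + y]addrA addrK.
have E2 : w + x - w = x by rewrite addrC addKr.
apply: ler_sum => i _; rewrite E1 E2.
pose rh j := if j == i then `|x| else rho.
have pr : \prod_j rh j = rho ^+ k * (`|x| / rho).
  rewrite (bigD1 i) //= /rh eqxx (eq_bigr (fun=> rho)); last first.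
    by move=> j /negbTE ->.
  by rewrite prodr_except ?lt0r_neq0 // mulrCA.
apply: le_trans (@multilinear_sub_le c _ _ rh pc c0 _ _) _.
- move=> j; rewrite /rh; case: eqP => [->|/eqP ne]; first by rewrite dfwithin.
  rewrite dfwithout 1?eq_sym // /hybrid.
  by case: ifP => _ //; rewrite ?[y + w]addrC // addrA [x + w]addrC.
- move=> j; rewrite /rh; case: eqP => [->|/eqP ne]; first by rewrite dfwithin.
  by rewrite dfwithout 1?eq_sym // /hybrid; case: ifP => _ //; rewrite addrC.
rewrite -!mulrA; apply: ler_wpM2l => //.
have -> : rho ^+ k * (k%:R * (`|x| * (`|y| / rho ^+ 2))) =
    \sum_(j < k) (`|y| / rho * (rho ^+ k * (`|x| / rho))).
  rewrite sumr_const card_ord -[RHS]mulr_natl expr2 invfM; ring.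
apply: ler_sum => j _; rewrite -pr [in leRHS](bigD1 j) //= mulrA.
apply: ler_wpM2r; first by apply: prodr_ge0 => l _; rewrite /rh; case: ifP => // _; exact: ltW.
have [ji|ne] := eqVneq j i.
  by rewrite ji !dfwithin subrr normr0 /rh eqxx mulr_ge0 // divr_ge0 // ltW.
rewrite !dfwithout 1?eq_sym // /rh (negbTE ne) divfK ?lt0r_neq0 //.
by rewrite /hybrid; case: ifP => _; rewrite addrC addKr.
Qed.

End Multilinear.

(** * Lipschitz, second-difference and tangent estimates for analytic maps *)

Section Analytic.
Context {R : realType}.
Implicit Types E F : normedModType R.

Lemma half_sum_le (n : nat) : \sum_(0 <= k < n) (2^-1 : R) ^+ k <= 2.
Proof.
suff -> : \sum_(0 <= k < n) (2^-1 : R) ^+ k = 2 - 2 * 2^-1 ^+ n.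
  by rewrite lerBlDr lerDl mulr_ge0 // exprn_ge0 // invr_ge0.
elim: n => [|n IH]; first by rewrite big_geq // expr0 mulr1 subrr.
rewrite big_nat_recr //= IH exprS mulrA divff // mul1r.
by rewrite mulr2n mulrDl mul1r opprD addrA subrK.
Qed.

Lemma sqr_le_exp2 (k : nat) : (k ^ 2 <= 2 * 2 ^ k)%N.
Proof.
case: k => [//|[//|[//|k]]]; elim: k => [//|k IH].
rewrite expnS; apply: leq_trans (leq_mul (leqnn 2) IH); rewrite -!mulnn; lia.
Qed.

(** Absorbs the k^2 of the second differences: working at a quarter of the radius of convergence
    leaves a summable 2^-k. *)
Lemma sqr_quarter_le (k : nat) :
  (4^-1 : R) ^+ k * k%:R ^+ 2 <= 2 * 2^-1 ^+ k.
Proof.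
have e4 : (4^-1 : R) = 2^-1 * 2^-1 by rewrite -invfM -natrM.
rewrite e4 exprMn -mulrA mulrC; apply: ler_wpM2r.
  by rewrite exprn_ge0 // invr_ge0.
rewrite exprVn mulrC ler_pdivrMr ?exprn_gt0 //.
by rewrite -!natrX -natrM ler_nat sqr_le_exp2.
Qed.

(** The bound on mixed second differences stands in for a bound on the second derivative; applied to
    the group law it yields an error term of order |u||v|. *)
Definition lip2_at E F (f : E -> F) (a : E) :=
  exists C rho : R, [/\ 0 < rho, 0 <= C,
    forall u v, `|u - a| <= rho -> `|v - a| <= rho ->
      `|f u - f v| <= C * `|u - v|
  & forall b x y, `|b - a| <= rho -> `|b + x - a| <= rho ->
      `|b + y - a| <= rho -> `|b + x + y - a| <= rho ->
      `|f (b + x + y) - f (b + y) - (f (b + x) - f b)| <= C * (`|x| * `|y|)].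

(** The terms of a convergent series are bounded, which gives Cauchy-type bounds M r^-k on the
    coefficients. *)
Lemma analytic_geometric E F (f : E -> F) (a : E) : analytic_at f a ->
  exists (p : forall k, ('I_k -> E) -> F) (M r : R),
    [/\ 0 < r, 0 <= M, forall k, multilinear (p k),
        forall k v, `|p k v| <= M * r^-1 ^+ k * \prod_i `|v i|
      & forall x, `|x| < r ->
          series (fun k => p k (fun=> x)) @ \oo --> f (a + x)].
Proof.
move=> [p [c [r [r0 pm pc cr pf]]]].
have /cvg_series_cvg_0/cvgP/cvg_seq_bounded[M [_ /(_ (`|M| + 1))]] := cr.
have -> : M < `|M| + 1 by rewrite (le_lt_trans (ler_norm M)) // ltrDl.
move=> /(_ isT) cM.
have M0 : 0 <= `|M| + 1 by rewrite addr_ge0.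
exists p, (`|M| + 1), r; split => // k v.
apply: le_trans (pc k v) _; apply: ler_wpM2r; first by apply: prodr_ge0.
rewrite exprVn ler_pdivlMr ?exprn_gt0 //.
by apply: le_trans (cM k I); exact: ler_norm.
Qed.

Section FixedSeries.
Context {E F : normedModType R}.
Variables (f : E -> F) (a : E) (p : forall k, ('I_k -> E) -> F) (M r : R).
Arguments p {k}.
Hypothesis r0 : 0 < r.
Hypothesis M0 : 0 <= M.
Hypothesis pm : forall k, multilinear (@p k).
Hypothesis pM : forall k v, `|@p k v| <= M * r^-1 ^+ k * \prod_i `|v i|.
Hypothesis pf : forall x, `|x| < r ->
  series (fun k => @p k (fun=> x)) @ \oo --> f (a + x).

Let rho := r / 4.
Let rho0 : 0 < rho. Proof. by rewrite divr_gt0. Qed.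
Let rhor : rho < r.
Proof. by rewrite /rho ltr_pdivrMr // ltr_pMr // ltr1n. Qed.

Let coef_ge0 k : 0 <= M * r^-1 ^+ k.
Proof. by rewrite mulr_ge0 // exprn_ge0 // invr_ge0 ltW. Qed.

Let coef_rho k : M * r^-1 ^+ k * rho ^+ k = M * 4^-1 ^+ k.
Proof.
by rewrite -mulrA -exprMn /rho mulrA mulVf ?lt0r_neq0 // mul1r.
Qed.

Let sum_le (u : nat -> R) (B : R) : (forall k, u k <= 2^-1 ^+ k * B) ->
  0 <= B -> forall n, \sum_(0 <= k < n) u k <= 2 * B.
Proof.
move=> uB B0 n; apply: (@le_trans _ _ (\sum_(0 <= k < n) 2^-1 ^+ k * B)).
  by apply: ler_sum.
by rewrite -mulr_suml ler_wpM2r // half_sum_le.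
Qed.

Lemma series_lip w x : `|w| <= rho -> `|w + x| <= rho ->
  `|f (a + (w + x)) - f (a + w)| <= 4 * M / rho * `|x|.
Proof.
move=> wr wxr.
have lt (z : E) : `|z| <= rho -> `|z| < r by move=> /le_lt_trans; apply.
have H := seq_cvgB (pf (lt _ wxr)) (pf (lt _ wr)).
apply: (norm_lim_le H) => n.
rewrite /series /= -!sumrB; apply: le_trans (ler_norm_sum _ _ _) _.
have -> : 4 * M / rho * `|x| = 2 * (2 * (M * (`|x| / rho))) by field; rewrite lt0r_neq0.
apply: sum_le; last by rewrite !mulr_ge0 // invr_ge0 ltW.
move=> k; apply: le_trans (multilinear_diag_sub_le (@pm k) (@pM k) (coef_ge0 k) rho0 wr wxr) _.
rewrite coef_rho.
have -> : 2^-1 ^+ k * (2 * (M * (`|x| / rho))) = M * (2 * 2^-1 ^+ k) * (`|x| / rho).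
  ring.
apply: ler_wpM2r; first by rewrite divr_ge0 // ltW.
rewrite -mulrA; apply: ler_wpM2l => //.
apply: le_trans (sqr_quarter_le k); apply: ler_wpM2l.
  by rewrite exprn_ge0 // invr_ge0.
by rewrite -natrX ler_nat -mulnn; case: (k) => // k'; rewrite leq_pmulr.
Qed.

Lemma series_lip2 w x y : `|w| <= rho -> `|w + x| <= rho ->
  `|w + y| <= rho -> `|w + x + y| <= rho ->
  `|f (a + (w + x + y)) - f (a + (w + y)) - (f (a + (w + x)) - f (a + w))|
    <= 4 * M / rho ^+ 2 * (`|x| * `|y|).
Proof.
move=> wr wxr wyr wxyr.
have lt (z : E) : `|z| <= rho -> `|z| < r by move=> /le_lt_trans; apply.
have H := seq_cvgB (seq_cvgB (pf (lt _ wxyr)) (pf (lt _ wyr)))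
  (seq_cvgB (pf (lt _ wxr)) (pf (lt _ wr))).
apply: (norm_lim_le H) => n.
rewrite /series /= -!sumrB; apply: le_trans (ler_norm_sum _ _ _) _.
have -> : 4 * M / rho ^+ 2 * (`|x| * `|y|) =
    2 * (2 * (M * (`|x| * `|y| / rho ^+ 2))) by field; rewrite lt0r_neq0.
apply: sum_le; last by rewrite !mulr_ge0 // ?invr_ge0 ?exprn_ge0 // ltW.
move=> k; apply: le_trans (multilinear_diag_sub2_le (@pm k) (@pM k) (coef_ge0 k)
  rho0 wr wxr wyr wxyr) _.
rewrite coef_rho.
have -> : 2^-1 ^+ k * (2 * (M * (`|x| * `|y| / rho ^+ 2))) =
    M * (2 * 2^-1 ^+ k) * (`|x| * `|y| / rho ^+ 2) by ring.
apply: ler_wpM2r; first by rewrite divr_ge0 ?mulr_ge0 // ?exprn_ge0 // ltW.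
rewrite -mulrA; apply: ler_wpM2l => //; exact: sqr_quarter_le.
Qed.

Definition linear_part (x : E) : F := @p 1 (fun=> x).

Lemma linear_part_linear : linear linear_part.
Proof.
move=> c x y; have := @pm 1%N (fun=> 0) ord0 c x y.
have e z : dfwith (fun=> 0 : E) (ord0 : 'I_1) z = fun=> z.
  by apply/funext => i; rewrite (ord1 i) dfwithin.
by rewrite !e.
Qed.

Lemma series_tangent x : `|x| <= rho ->
  `|f (a + x) - f a - linear_part x| <= 32 * M / r ^+ 2 * `|x| ^+ 2.
Proof.
move=> xr.
have cx : series (fun k => @p k (fun=> x)) @ \oo --> f (a + x).
  by apply: pf; exact: le_lt_trans rhor.
have c0 : series (fun k => @p k (fun=> 0)) @ \oo --> f a.
  by rewrite -[a in f a]addr0; apply: pf; rewrite normr0.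
have c1 : series (fun k => if k == 1%N then linear_part x else 0) @ \oo
    --> linear_part x.
  apply: cvg_near_cst; exists 2%N => // n n2.
  rewrite /series /= (bigD1_seq 1%N) ?iota_uniq ?mem_index_iota //= big1 ?addr0 //.
  by move=> i /negbTE ->.
have H := seq_cvgB (seq_cvgB cx c0) c1.
apply: (norm_lim_le H) => n.
rewrite /series /= -!sumrB; apply: le_trans (ler_norm_sum _ _ _) _.
have -> : 32 * M / r ^+ 2 * `|x| ^+ 2 = 2 * (16 * M * (`|x| / r) ^+ 2).
  by field; rewrite lt0r_neq0.
apply: sum_le; last by rewrite !mulr_ge0 // invr_ge0 ltW.
have B0 k : 0 <= 2^-1 ^+ k * (16 * M * (`|x| / r) ^+ 2).
  by rewrite !mulr_ge0 // ?exprn_ge0 // invr_ge0 ltW.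
have p0 k : (0 < k)%N -> @p k (fun=> 0) = 0.
  case: k => // k _; apply/eqP; rewrite -normr_le0; apply: le_trans (pM _) _.
  by rewrite big_ord_recl normr0 mul0r mulr0.
case=> [|[|k]].
- have -> : (fun=> x) = (fun=> 0) :> ('I_0 -> E) by apply/funext; case.
  by rewrite subrr subr0 normr0.
- by rewrite p0 // subr0 subrr normr0.
rewrite p0 // !subr0; apply: le_trans (pM _) _.
(* Only terms of degree at least 2 are left; factoring out (|x|/r)^2 leaves powers of |x|/r <=
   1/4. *)
rewrite prodr_const card_ord -mulrA -exprMn [r^-1 * _]mulrC.
have q4 : `|x| / r <= 4^-1.
  by rewrite ler_pdivrMr // mulrC.
have q0 : 0 <= `|x| / r by rewrite divr_ge0 // ltW.
have -> : 2^-1 ^+ k.+2 * (16 * M * (`|x| / r) ^+ 2) =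
    M * ((`|x| / r) ^+ 2 * (4 * 2^-1 ^+ k)).
  by rewrite !exprS; field; rewrite lt0r_neq0.
apply: ler_wpM2l => //; rewrite -addn2 addnC exprD; apply: ler_wpM2l.
  by rewrite exprn_ge0.
apply: (@le_trans _ _ (2^-1 ^+ k)).
  apply: lerXn2r; rewrite ?nnegrE ?invr_ge0 //.
  by apply: le_trans q4 _; rewrite lef_pV2 ?posrE // ler_nat.
by rewrite ler_peMl ?exprn_ge0 ?invr_ge0 // ler1n.
Qed.

End FixedSeries.

Lemma analytic_lip2 E F (f : E -> F) (a : E) : analytic_at f a -> lip2_at f a.
Proof.
move=> /analytic_geometric[p [M [r [r0 M0 pm pM pf]]]].
have rho0 : 0 < r / 4 by rewrite divr_gt0.
exists (4 * M / (r / 4) + 4 * M / (r / 4) ^+ 2), (r / 4).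
have C1 : 0 <= 4 * M / (r / 4) by rewrite divr_ge0 ?mulr_ge0 // ltW.
have C2 : 0 <= 4 * M / (r / 4) ^+ 2 by rewrite divr_ge0 ?mulr_ge0 // ?exprn_ge0 // ltW.
split=> //; first by rewrite addr_ge0.
- move=> u v ur vr.
  have e : u - a = v - a + (u - v) by rewrite [RHS]addrC addrA subrK.
  have := series_lip r0 M0 pm pM pf vr; move=> /(_ (u - v)); rewrite -e.
  move=> /(_ ur); rewrite ![a + _]addrC !subrK => /le_trans; apply.
  by rewrite ler_wpM2r // lerDl.
- move=> b x y br bxr byr bxyr.
  have e z t : b + z - t = b - t + z by rewrite addrAC.
  have e2 : b + x + y - a = b - a + x + y by rewrite addrAC e.
  have := @series_lip2 _ _ f a p M r r0 M0 pm pM pf (b - a) x y br.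
  rewrite -e2 -!e => /(_ bxr byr bxyr); rewrite ![a + _]addrC !subrK.
  by move=> /le_trans; apply; rewrite ler_wpM2r ?mulr_ge0 // lerDr.
Qed.

Lemma analytic_differentiable E F (f : E -> F) (a : E) :
  analytic_at f a -> differentiable f a.
Proof.
move=> /analytic_geometric[p [M [r [r0 M0 pm pM pf]]]].
pose L : {linear E -> F} := HB.pack (linear_part p)
  (GRing.isLinear.Build _ _ _ _ _ (linear_part_linear pm)).
have rho0 : 0 < r / 4 by rewrite divr_gt0.
have cL : continuous L.
  apply: bounded_linear_continuous.
  apply/linear_boundedP; near=> c => x.
  apply: le_trans (pM 1%N _) _; rewrite big_ord_recl big_ord0 mulr1.
  by apply: ler_wpM2r => //; near: c; apply: nbhs_pinfty_ge; rewrite num_real.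
apply: (proj1 (@differentiable_eps _ _ _ f a L cL _)) => e e0.
pose C := 32 * M / r ^+ 2.
have C0 : 0 <= C by rewrite divr_ge0 ?mulr_ge0 // ?exprn_ge0 // ltW.
exists (Num.min (r / 4) (e / (C + 1))).
  by rewrite lt_min rho0 divr_gt0 // ltr_wpDl.
move=> h; rewrite lt_min => /andP[/ltW hr /ltW he].
apply: le_trans (series_tangent r0 M0 pM pf hr) _.
rewrite -/C expr2 mulrA; apply: ler_wpM2r => //.
apply: (@le_trans _ _ ((C + 1) * `|h|)); first by rewrite ler_wpM2r // lerDl.
by rewrite mulrC -ler_pdivlMr // ltr_wpDl.
Unshelve. all: by end_near.
Qed.

End Analytic.

(** * Differentiable maps in charts and the chain rule *)

Section DifferentiableMaps.
Context {R : realType}.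

Lemma near_eq_differentiable (E F : normedModType R) (f g : E -> F) (x : E) :
  (\forall y \near x, f y = g y) -> differentiable f x ->
  differentiable g x /\ 'd g x = 'd f x :> (E -> F).
Proof.
move=> /nbhs_addP[d0 d00 fg] df; apply: differentiable_eps.
  exact: diff_continuous.
move=> e e0; have [d dpos dP] := diff_eps df e0.
exists (Num.min d d0); first by rewrite lt_min dpos.
move=> h; rewrite lt_min => /andP[hd hd0].
have fgx : f x = g x by have := fg 0; rewrite normr0 addr0; apply.
by rewrite -fg // -fgx; exact: dP.
Qed.

(** The topological content of [is_manifold] over the whole space, with pointwise continuity. It
    also holds for the model space and passes to products, so that the chain rule applies to maps
    out of G x G and TG. *)
Definition proper_atlas (T : topologicalType) (E : normedModType R)
    (A : atlas T E) :=
  [/\ forall x, open (dom A x) /\ dom A x x,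
      forall x y, dom A x y -> psi A x (phi A x y) = y,
      forall x y, dom A x y -> {for y, continuous (phi A x)},
      forall x v, (phi A x @` dom A x) v -> {for v, continuous (psi A x)}
    & forall x, open (phi A x @` dom A x)].

Lemma manifold_proper (T : topologicalType) (E : normedModType R)
    (reg : (E -> E) -> E -> Prop) (A : atlas T E) :
  is_manifold reg setT A -> proper_atlas A.
Proof.
case=> d0 psiK cphi cpsi _; split=> [x|x y|x y xy|x v xv|x].
- by have [? _ ? _] := d0 x I.
- exact: psiK.
- have [od _ _ _] := d0 x I; have := cphi x I; rewrite continuous_open_subspace //.
  by apply; rewrite inE.
- have [_ _ _ oi] := d0 x I; have := cpsi x I; rewrite continuous_open_subspace //.
  by apply; rewrite inE.
- by have [_ _ _ oi] := d0 x I.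
Qed.

Lemma vec_atlas_proper (E : normedModType R) : proper_atlas (vec_atlas E).
Proof.
have e : (fun v : E => v) @` setT = setT.
  by apply/seteqP; split=> // x _; exists x.
split=> //=.
- by move=> x; split => //; exact: openT.
- by move=> x y _; exact: cvg_id.
- by move=> x v _; exact: cvg_id.
- by move=> x; rewrite e; exact: openT.
Qed.

Lemma open_setX (T U : topologicalType) (A : set T) (B : set U) :
  open A -> open B -> open (A `*` B).
Proof.
move=> oA oB; rewrite openE => -[x y] [/= Ax By].
by exists (A, B) => //; split; apply: open_nbhs_nbhs.
Qed.

Lemma prod_atlas_proper (T U : topologicalType) (E F : normedModType R)
    (A : atlas T E) (B : atlas U F) :
  proper_atlas A -> proper_atlas B -> proper_atlas (prod_atlas A B).
Proof.
move=> [dA kA pA qA iA] [dB kB pB qB iB].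
have im (x : T * U) : phi (prod_atlas A B) x @` dom (prod_atlas A B) x =
    (phi A x.1 @` dom A x.1) `*` (phi B x.2 @` dom B x.2).
  apply/seteqP; split=> [[u v] /= [[y z] /= [dy dz] [<- <-]]|[u v] /=].
    by split; [exists y|exists z].
  by move=> [[y dy <-] [z dz <-]]; exists (y, z).
split=> [[x y]|[x y] [z t] /= [dz dt]|[x y] [z t] /= [dz dt]|[x y] [u v]|x].
- split; last by split; [exact: (dA x).2|exact: (dB y).2].
  by apply: open_setX; [exact: (dA x).1|exact: (dB y).1].
- by rewrite kA // kB.
- apply: cvg_pair; rewrite /=.
    apply: (@cvg_comp _ _ _ fst (phi A x) _ (nbhs z)); first exact: cvg_fst.
    exact: pA.
  apply: (@cvg_comp _ _ _ snd (phi B y) _ (nbhs t)); first exact: cvg_snd.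
  exact: pB.
- rewrite im => -[/= iu iv]; apply: cvg_pair; rewrite /=.
    apply: (@cvg_comp _ _ _ fst (psi A x) _ (nbhs u)); first exact: cvg_fst.
    exact: qA.
  apply: (@cvg_comp _ _ _ snd (psi B y) _ (nbhs v)); first exact: cvg_snd.
  exact: qB.
- by rewrite im; apply: open_setX; [exact: iA|exact: iB].
Qed.

Section ProperAtlas.
Context {T : topologicalType} {E : normedModType R} (A : atlas T E).
Hypothesis pA : proper_atlas A.

Lemma dom_nbhs x y : dom A x y -> nbhs y (dom A x).
Proof.
move=> dxy; case: pA => dA _ _ _ _.
by apply: open_nbhs_nbhs; split=> //; exact: (dA x).1.
Qed.

Lemma dom_refl x : dom A x x.
Proof. by case: pA => dA _ _ _ _; exact: (dA x).2. Qed.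

Lemma phiK x y : dom A x y -> psi A x (phi A x y) = y.
Proof. by case: pA => _ kA _ _ _; exact: kA. Qed.

Lemma phi_cvg x y : dom A x y -> phi A x z @[z --> y] --> phi A x y.
Proof. by case: pA => _ _ cA _ _; exact: cA. Qed.

Lemma psi_cvg x y : dom A x y -> psi A x v @[v --> phi A x y] --> y.
Proof.
by move=> dy; case: pA => _ kA _ qA _; rewrite -{2}(kA x y dy); apply: qA; exists y.
Qed.

Lemma psiK_near x y : dom A x y ->
  \forall v \near phi A x y, dom A x (psi A x v) /\ phi A x (psi A x v) = v.
Proof.
case: pA => _ kA _ _ oA dy.
have : nbhs (phi A x y) (phi A x @` dom A x).
  by apply: open_nbhs_nbhs; split; [exact: oA|exists y].
by apply: filterS => v [z dz <-]; rewrite kA.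
Qed.

End ProperAtlas.

(* Continuity is required separately: outside the domain of a chart, [phi]
   takes junk values, so differentiability of the chart expression alone does
   not say where [f] sends nearby points. *)
Definition mdiff (T U : topologicalType) (E F : normedModType R)
    (A : atlas T E) (B : atlas U F) (f : T -> U) (x : T) :=
  {for x, continuous f} /\
  differentiable (phi B (f x) \o f \o psi A x) (phi A x x).

Lemma regular_mdiff (T U : topologicalType) (E F : normedModType R)
    (A : atlas T E) (B : atlas U F) (f : T -> U) :
  regular_map (@analytic_at R E F) A B setT f -> forall x, mdiff A B f x.
Proof.
by move=> rf x; have [cf af] := rf x I; split=> //; exact: analytic_differentiable.
Qed.

Lemma mdiff_comp (T U V : topologicalType) (E F H : normedModType R)
    (A : atlas T E) (B : atlas U F) (C : atlas V H) (f : T -> U) (g : U -> V) x :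
  proper_atlas A -> proper_atlas B ->
  mdiff A B f x -> mdiff B C g (f x) ->
  mdiff A C (g \o f) x /\
  tdiff A C (g \o f) x = tdiff B C g (f x) \o tdiff A B f x :> (E -> H).
Proof.
move=> pA pB [cf df] [cg dg].
set F1 := phi B (f x) \o f \o psi A x in df.
set G1 := phi C (g (f x)) \o g \o psi B (f x) in dg.
have F1x : F1 (phi A x x) = phi B (f x) (f x).
  by rewrite /F1 /= phiK //; exact: dom_refl.
(* Continuity of [f] keeps nearby values in the domain of the chart at [f x], where [psi] really
   inverts [phi]. *)
have ne : \forall v \near phi A x x,
    (G1 \o F1) v = (phi C (g (f x)) \o (g \o f) \o psi A x) v.
  have cfp : f (psi A x v) @[v --> phi A x x] --> f x.
    apply: (@cvg_comp _ _ _ (psi A x) f _ (nbhs x)); last exact: cf.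
    by apply: psi_cvg => //; exact: dom_refl.
  have : \forall v \near phi A x x, dom B (f x) (f (psi A x v)).
    exact: cfp (dom_nbhs pB (dom_refl pB (f x))).
  by apply: filterS => v dv; rewrite /G1 /F1 /= phiK.
rewrite -F1x in dg.
have dGF := differentiable_comp df dg.
have [d1 d2] := near_eq_differentiable ne dGF.
split; last by rewrite /tdiff d2 diff_comp // F1x.
by split=> //; apply: (@cvg_comp _ _ _ f g _ (nbhs (f x))).
Qed.

Lemma mdiff_id (T : topologicalType) (E : normedModType R) (A : atlas T E) x :
  proper_atlas A -> mdiff A A id x /\ tdiff A A id x = id :> (E -> E).
Proof.
move=> pA.
have ne : \forall v \near phi A x x, v = (phi A x \o id \o psi A x) v.
  by have := psiK_near pA (dom_refl pA x); apply: filterS => v [].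
have [d1 d2] := near_eq_differentiable ne (@ex_diff _ _ _ _ _ _ _ (is_diff_id (phi A x x))).
split; first by split => //; exact: cvg_id.
by rewrite /tdiff d2 diff_val.
Qed.

Lemma mdiff_cst (T U : topologicalType) (E F : normedModType R)
    (A : atlas T E) (B : atlas U F) (b : U) x :
  mdiff A B (fun=> b) x /\ tdiff A B (fun=> b) x = (fun=> 0) :> (E -> F).
Proof.
have e : phi B b \o (fun=> b) \o psi A x = cst (phi B b b) by [].
split; last by rewrite /tdiff e diff_cst.
by split; [exact: cvg_cst|rewrite e; exact: differentiable_cst].
Qed.

Lemma mdiff_pair (S T U : topologicalType) (D E F : normedModType R)
    (Z : atlas S D) (A : atlas T E) (B : atlas U F) (f : S -> T) (g : S -> U) x :
  mdiff Z A f x -> mdiff Z B g x ->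
  mdiff Z (prod_atlas A B) (fun y => (f y, g y)) x /\
  tdiff Z (prod_atlas A B) (fun y => (f y, g y)) x =
    (fun v => (tdiff Z A f x v, tdiff Z B g x v)) :> (D -> E * F).
Proof.
move=> [cf df] [cg dg]; split.
  split; last exact: differentiable_pair.
  by apply: cvg_pair; [exact: cf|exact: cg].
exact: (@diff_pair _ D E F _ _ _ df dg).
Qed.

Lemma mdiff_fst (T U : topologicalType) (E F : normedModType R)
    (A : atlas T E) (B : atlas U F) x : proper_atlas A -> proper_atlas B ->
  mdiff (prod_atlas A B) A fst x.
Proof.
move=> pA pB; split; first exact: cvg_fst.
have ne : \forall v \near (phi A x.1 x.1, phi B x.2 x.2),
   v.1 = (phi A x.1 \o fst \o psi (prod_atlas A B) x) v.
  have := psiK_near (prod_atlas_proper pA pB) (dom_refl (prod_atlas_proper pA pB) x).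
  by apply: filterS => -[v w] /= [_ [-> _]].
apply: (near_eq_differentiable ne _).1.
have pl : linear (fun v : E * F => v.1) by [].
pose L : {linear (E * F)%type -> E} := HB.pack (fun v : E * F => v.1)
  (GRing.isLinear.Build _ _ _ _ _ pl).
by apply: (@linear_differentiable _ _ _ L) => y; exact: cvg_fst.
Qed.

Lemma mdiff_snd (T U : topologicalType) (E F : normedModType R)
    (A : atlas T E) (B : atlas U F) x : proper_atlas A -> proper_atlas B ->
  mdiff (prod_atlas A B) B snd x.
Proof.
move=> pA pB; split; first exact: cvg_snd.
have ne : \forall v \near (phi A x.1 x.1, phi B x.2 x.2),
   v.2 = (phi B x.2 \o snd \o psi (prod_atlas A B) x) v.
  have := psiK_near (prod_atlas_proper pA pB) (dom_refl (prod_atlas_proper pA pB) x).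
  by apply: filterS => -[v w] /= [_ [_ ->]].
apply: (near_eq_differentiable ne _).1.
have pl : linear (fun v : E * F => v.2) by [].
pose L : {linear (E * F)%type -> F} := HB.pack (fun v : E * F => v.2)
  (GRing.isLinear.Build _ _ _ _ _ pl).
by apply: (@linear_differentiable _ _ _ L) => y; exact: cvg_snd.
Qed.

Lemma is_derive_epsP (E : normedModType R) (g : R^o -> E) (X : E) (t : R) :
  is_derive (t : R^o) (1 : R^o) g X <->
  (forall e : R, 0 < e -> exists2 d : R, 0 < d &
    forall s : R, `|s| < d -> `|g (t + s) - g t - s *: X| <= e * `|s|).
Proof.
have sx_lin : linear ( *:%R ^~ X : R^o -> _).
  by move=> u y z; rewrite scalerDl scalerA.
pose L : {linear R^o -> E} := HB.pack ( *:%R ^~ X)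
  (GRing.isLinear.Build _ _ _ _ _ sx_lin).
have cL : continuous L by exact: scalel_continuous.
split=> [[dg gX] e e0|H].
  have dg' : differentiable g t by apply/derivable1_diffP.
  have [d d0 dP] := diff_eps dg' e0; exists d => // s /dP.
  rewrite -gX deriveE // -linearZ /=.
  by have -> : s *: (1 : R^o) = s by rewrite -[RHS]mulr1.
have [dg gL] := @differentiable_eps R R^o E g t L cL H.
have dg' : derivable g t 1 by apply/derivable1_diffP.
by split=> //; rewrite deriveE // gL /= scale1r.
Qed.

End DifferentiableMaps.

(** * The group law in a chart at the identity *)

Section LocalGroup.
Context {R : realType} {E : normedModType R} (G : lieGroup E).
Local Notation A := (lg_atlas G).

Lemma lg_proper : proper_atlas A.
Proof. exact: manifold_proper (lg_manifold G). Qed.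

(** The chart is recentred so that the identity has coordinate 0 and [local_law] is u + v up to
    second order. *)
Definition chart1 (g : G) : E := phi A 1%g g - phi A 1%g 1%g.
Definition point1 (v : E) : G := psi A 1%g (phi A 1%g 1%g + v).
Local Notation ch := chart1.
Local Notation ex := point1.

Lemma mulg_mdiff (q : G * G) :
  mdiff (prod_atlas A A) A (fun q : G * G => (q.1 * q.2)%g) q.
Proof. refine (regular_mdiff (@lg_mul_analytic _ _ G) q). Qed.

Lemma invg_mdiff (g : G) : mdiff A A (fun g : G => g^-1%g) g.
Proof. exact: regular_mdiff (@lg_inv_analytic _ _ G) g. Qed.

Lemma cvg_mulg (T : Type) (F : set_system T) {FF : Filter F} (f g : T -> G)
    (x y : G) : f @ F --> x -> g @ F --> y -> (f t * g t)%g @[t --> F] --> (x * y)%g.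
Proof.
move=> fx gy; apply: (cvg_comp2 fx gy (h := fun a b => (a * b)%g)).
exact: (mulg_mdiff (x, y)).1.
Qed.

Lemma cvg_invg (T : Type) (F : set_system T) {FF : Filter F} (f : T -> G)
    (x : G) : f @ F --> x -> (f t)^-1%g @[t --> F] --> x^-1%g.
Proof.
move=> fx; apply: (@cvg_comp _ _ _ f (fun g => g^-1%g) _ (nbhs x)) => //.
exact: (invg_mdiff x).1.
Qed.

Lemma dom1 : dom A 1%g 1%g. Proof. exact: dom_refl lg_proper _. Qed.

Lemma chart1K g : dom A 1%g g -> ex (ch g) = g.
Proof. by move=> dg; rewrite /ex /ch subrKC phiK //; exact: lg_proper. Qed.

Lemma chart1_1 : ch 1%g = 0. Proof. exact: subrr. Qed.

Lemma point1_0 : ex 0 = 1%g.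
Proof. by rewrite -chart1_1 chart1K //; exact: dom1. Qed.

Lemma chart1_cvg g : dom A 1%g g -> ch @ g --> ch g.
Proof.
move=> dg; apply: cvgB; last exact: cvg_cst.
exact: phi_cvg lg_proper _ _ dg.
Qed.

Lemma point1_cvg g : dom A 1%g g -> ex @ ch g --> g.
Proof.
move=> dg.
apply: (@cvg_comp _ _ _ (fun v => phi A 1%g 1%g + v) (psi A 1%g) _
  (nbhs (phi A 1%g g))); last exact: psi_cvg lg_proper _ _ dg.
have -> : phi A 1%g g = phi A 1%g 1%g + ch g by rewrite /ch subrKC.
by apply: cvgD; [exact: cvg_cst|exact: cvg_id].
Qed.

Lemma point1_cvg0 : ex @ (0 : E) --> (1%g : G).
Proof. by rewrite -chart1_1; exact: point1_cvg dom1. Qed.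

Lemma point1K_near g : dom A 1%g g -> 
  \forall v \near ch g, dom A 1%g (ex v) /\ ch (ex v) = v.
Proof.
move=> dg; have /nbhs_addP[d d0 dP] := psiK_near lg_proper dg.
apply/nbhs_addP; exists d => // h /dP [d1 d2].
have e : phi A 1%g 1%g + (ch g + h) = phi A 1%g g + h.
  by rewrite addrA /ch subrKC.
by rewrite /ch /ex e; split => //; rewrite d2 -e addrC addKr.
Qed.

Definition local_law (u v : E) : E := ch (ex u * ex v)%g.

Lemma local_law_lip2 : lip2_at (fun z => local_law z.1 z.2) (0 : E * E).
Proof.
have [_ /analytic_lip2] := @lg_mul_analytic _ _ G (1%g, 1%g) I.
move=> [C [rho [rho0 C0 L1 L2]]]; exists C, rho; split=> //.
- move=> u v; rewrite !subr0 => ur vr.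
  set b0 := phi (prod_atlas A A) (1%g, 1%g) (1%g, 1%g) in L1 L2.
  have e1 (z : E * E) : b0 + z - b0 = z by rewrite addrC addKr.
  have := L1 (b0 + u) (b0 + v); rewrite !e1 => /(_ ur vr).
  rewrite opprD addrACA subrr add0r /local_law /ch /= mulg1.
  by rewrite opprB addrA subrK.
- move=> b x y; rewrite !subr0 => br bxr byr bxyr.
  set b0 := phi (prod_atlas A A) (1%g, 1%g) (1%g, 1%g) in L1 L2.
  have := L2 (b0 + b) x y.
  have e1 (z : E * E) : b0 + z - b0 = z by rewrite addrC addKr.
  rewrite -(addrA b0 b x) -(addrA b0 b y) -(addrA b0 (b + x) y) !e1.
  move=> /(_ br bxr byr bxyr).
  rewrite /local_law /ch /= mulg1.
  have e2 (p q r s t : E) : p - t - (q - t) - ((r - t) - (s - t)) = p - q - (r - s).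
    by rewrite !opprB !addrA !subrK.
  by rewrite e2.
Qed.

(** Since the law m satisfies m(u, 0) = u and m(0, v) = v, the error m(u, v) - u - v is a mixed
    second difference, hence O(|u||v|). Triple products with a varying middle factor are included
    because powers and conjugates are compared by exchanging one inner factor at a time. *)
Lemma local_group : exists rho C : R, [/\ 0 < rho, 1 <= C,
  forall v, `|v| <= rho -> dom A 1%g (ex v) /\ ch (ex v) = v,
  forall u v v' w, `|u| <= rho -> `|v| <= rho -> `|v'| <= rho -> `|w| <= rho ->
    dom A 1%g (ex u * ex v * ex w)%g /\
    `|ch (ex u * ex v * ex w)%g - ch (ex u * ex v' * ex w)%g| <= C * `|v - v'|
  & forall u v, `|u| <= rho -> `|v| <= rho ->
    `|ch (ex u * ex v)%g - u - v| <= C * (`|u| * `|v|)].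
Proof.
have [C [r1 [r10 C0 L1 L2]]] := local_law_lip2.
have := point1K_near dom1; rewrite chart1_1 => /nbhs_addP[r2 r20 H2].
have c3 : (ex z.1.1 * ex z.1.2 * ex z.2)%g @[z --> (0 : E * E * E)] --> (1%g : G).
  rewrite -[X in _ --> X]mulg1 -[X in _ --> (X * _)%g]mulg1.
  have ce (p : E * E * E -> E) : p @ (0 : E * E * E) --> (0 : E) ->
      ex (p z) @[z --> (0 : E * E * E)] --> (1%g : G).
    by move=> cp; apply: (@cvg_comp _ _ _ p ex _ (nbhs 0)) => //; exact: point1_cvg0.
  have c1 : @fst (E * E) E @ (0 : E * E * E) --> (0 : E * E) by exact: cvg_fst.
  apply: cvg_mulg; last by apply: ce; exact: cvg_snd.
  apply: cvg_mulg; apply: ce.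
    by apply: (@cvg_comp _ _ _ fst fst _ (nbhs (0 : E * E))) => //; exact: cvg_fst.
  by apply: (@cvg_comp _ _ _ fst snd _ (nbhs (0 : E * E))) => //; exact: cvg_snd.
have /nbhs_addP[r3 r30 H3] := c3 _ (dom_nbhs lg_proper dom1).
pose D := C + 1.
have D0 : 0 < D by rewrite ltr_wpDl.
have D1 : 1 <= D by rewrite lerDr.
(* Dividing by [D] keeps the product of two small elements in the ball of radius [r1], so the
   Lipschitz bound can be applied twice. *)
pose r := Num.min (r1 / D) (Num.min (r2 / 2) (r3 / 2)).
have rr1D : r <= r1 / D by rewrite ge_min lexx.
have rr1 : r <= r1.
  by apply: le_trans rr1D _; rewrite ler_pdivrMr // ler_peMr // ltW.
have rr2 : r < r2.
  have : r <= r2 / 2 by rewrite !ge_min lexx !orbT.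
  move=> /le_lt_trans; apply; lra.
have rr3 : r < r3.
  have : r <= r3 / 2 by rewrite !ge_min lexx !orbT.
  move=> /le_lt_trans; apply; lra.
have r0 : 0 < r by rewrite !lt_min !divr_gt0.
have exK v : `|v| <= r -> dom A 1%g (ex v) /\ ch (ex v) = v.
  by move=> /le_lt_trans/(_ rr2)/H2; rewrite add0r.
have lD : C <= D by rewrite lerDl.
have nE (u v : E) c : `|u| <= c -> `|v| <= c -> `|(u, v)| <= c.
  by move=> uc vc; rewrite prod_normE ge_max uc.
have lip u v u' v' : `|u| <= r1 -> `|v| <= r1 -> `|u'| <= r1 -> `|v'| <= r1 ->
    `|local_law u v - local_law u' v'| <= D * Num.max `|u - u'| `|v - v'|.
  move=> ur vr ur' vr'; have := L1 (u, v) (u', v').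
  rewrite !subr0 => /(_ (nE _ _ _ ur vr) (nE _ _ _ ur' vr')) /= /le_trans; apply.
  rewrite prod_normE /=; exact: ler_wpM2r.
have law00 : local_law 0 0 = 0 by rewrite /local_law point1_0 mulg1 chart1_1.
have z1 : `|0 : E| <= r1 by rewrite normr0 ltW.
have zr : `|0 : E| <= r by rewrite normr0 ltW.
exists r, (D ^+ 2); split=> //.
- by rewrite expr_ge1 // ltW.
- move=> u v v' w ur vr vr' wr.
  have dom3 t : `|t| <= r -> dom A 1%g (ex u * ex t * ex w)%g.
    move=> tr; have := H3 (u, t, w); rewrite add0r; apply.
    by rewrite !prod_normE !gt_max !(le_lt_trans _ rr3).
  have dom2 t : `|t| <= r -> dom A 1%g (ex u * ex t)%g.
    move=> tr; have := H3 (u, t, 0); rewrite add0r /= point1_0 mulg1; apply.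
    by rewrite !prod_normE !gt_max normr0 r30 !(le_lt_trans _ rr3).
  have small t : `|t| <= r -> `|local_law u t| <= r1.
    move=> tr; rewrite -[local_law u t]subr0 -law00.
    apply: le_trans (lip _ _ _ _ (le_trans ur rr1) (le_trans tr rr1) z1 z1) _.
    rewrite !subr0 mulrC -ler_pdivlMr // ge_max.
    by rewrite (le_trans ur rr1D) (le_trans tr rr1D).
  split; first exact: dom3.
  have e t : `|t| <= r -> ch (ex u * ex t * ex w)%g = local_law (local_law u t) w.
    by move=> tr; rewrite /local_law chart1K //; exact: dom2.
  rewrite !e //.
  have wr1 := le_trans wr rr1.
  apply: le_trans (lip _ _ _ _ (small _ vr) wr1 (small _ vr') wr1) _.
  rewrite subrr normr0 max_l // expr2 -mulrA; apply: ler_wpM2l; first exact: ltW.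
  have ur1 := le_trans ur rr1.
  apply: le_trans (lip _ _ _ _ ur1 (le_trans vr rr1) ur1 (le_trans vr' rr1)) _.
  by rewrite subrr normr0 max_r.
- move=> u v ur vr.
  have ur1 := le_trans ur rr1; have vr1 := le_trans vr rr1.
  have := L2 0 (u, 0) (0, v); rewrite !add0r !subr0.
  have -> : (u, 0) + (0, v) = (u, v) :> E * E.
    by rewrite -[LHS]/(u + 0, 0 + v) addr0 add0r.
  rewrite oppr0 normr0 => /(_ (ltW r10) (nE _ _ _ ur1 z1) (nE _ _ _ z1 vr1) (nE _ _ _ ur1 vr1)).
  rewrite /= law00 subr0 /local_law point1_0 mul1g mulg1.
  rewrite (exK _ vr).2 (exK _ ur).2 addrAC => /le_trans; apply.
  rewrite !prod_normE /= normr0 max_l // max_r //.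
  apply: ler_wpM2r; first by rewrite mulr_ge0.
  by apply: le_trans lD _; rewrite expr2 ler_peMr // ltW.
Qed.

End LocalGroup.

(** * Dyadic sequences and completeness *)

Section Halves.
Context {R : realType}.
Local Notation h k := ((2^-1 : R) ^+ k).

Lemma half_gt0 k : 0 < h k. Proof. by rewrite exprn_gt0 // invr_gt0. Qed.
Lemma half_ge0 k : 0 <= h k. Proof. exact: ltW (half_gt0 k). Qed.
Lemma half_le1 k : h k <= 1.
Proof. by rewrite exprn_ile1 // ?invr_ge0 // invf_le1 // ler1n. Qed.

Lemma half_pow k : (2 ^ k)%:R * h k = 1.
Proof. by rewrite natrX -exprMn mulfV ?expr1n // pnatr_eq0. Qed.

Lemma half_cvg0 (c : R) : (fun k => c * h k) @ \oo --> 0.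
Proof. by apply: cvg_geometric; rewrite ger0_norm ?invr_ge0 // invf_lt1 // ltr1n. Qed.

Lemma half_le0 (x c : R) : (forall k, x <= c * h k) -> x <= 0.
Proof.
move=> H; have c0 := @half_cvg0 c.
have := limr_ge (cvgP _ c0); rewrite (cvg_lim _ c0) //; apply.
exact: nearW.
Qed.

Lemma squeeze_eq (E : normedModType R) (u : nat -> E) (l m : E) (b : nat -> R) :
  u @ \oo --> l -> b @ \oo --> 0 -> (forall k, `|u k - m| <= b k) -> l = m.
Proof.
move=> ul b0 um; suff um' : u @ \oo --> m by apply: (cvg_unique _ ul um').
apply/cvgrPdist_le => e e0.
have /cvgrPdist_le/(_ e e0) := b0; apply: filterS => k.
rewrite sub0r normrN distrC => bk; apply: le_trans (um k) _.
exact: le_trans (ler_norm _) bk.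
Qed.

(** Completeness for sequences with geometric steps, the kind produced by dyadic approximation.
    Stated as a property, it covers real groups, modelled on row vectors, and complex ones, modelled
    on pairs of them. *)
Definition geom_complete (E : normedModType R) :=
  forall (u : nat -> E) (c : R),
    (forall k, `|u k.+1 - u k| <= c * h k) -> cvgn u.

Lemma geom_complete_R (u : nat -> R) (c : R) :
  (forall k, `|u k.+1 - u k| <= c * h k) -> cvgn u.
Proof.
move=> uc.
have H : cvgn [normed series (telescope u)].
  apply: (@series_le_cvg _ _ (geometric c 2^-1)) => [k|k|k|].
  - exact: normr_ge0.
  - by rewrite /geometric /=; apply: le_trans (uc k).
  - exact: uc.
  - by apply: is_cvg_geometric_series; rewrite ger0_norm ?invr_ge0 // invf_lt1 // ltr1n.
have := normed_cvg H.
have -> : series (telescope u) = (fun k => u k - u 0%N).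
  by rewrite telescopeK; apply/funext.
move=> cu; have -> : u = (fun k => (u k - u 0%N) + u 0%N).
  by apply/funext => k; rewrite subrK.
by apply: is_cvgD => //; exact: is_cvg_cst.
Qed.

Lemma mx_norm_leP m n (M : 'M[R]_(m, n)) (c : R) : 0 <= c ->
  (forall i j, `|M i j| <= c) <-> `|M| <= c.
Proof.
move=> c0; rewrite [`|M|]/Num.norm /= mx_normrE; split.
  by move=> H; apply/bigmax_leP; split=> // -[i j] _; exact: H.
by move=> /bigmax_leP[_ H] i j; exact: (H (i, j)).
Qed.

Lemma coord_norm_le m n (M : 'M[R]_(m, n)) i j : `|M i j| <= `|M|.
Proof. by move: i j; apply/mx_norm_leP. Qed.

Lemma geom_complete_rV n : geom_complete 'rV[R]_n.
Proof.
move=> u c uc.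
have H i : cvgn (fun k => u k ord0 i).
  apply: (geom_complete_R (c := c)) => k; apply: le_trans (uc k).
  by have := coord_norm_le (u k.+1 - u k) ord0 i; rewrite !mxE.
apply/cvg_ex; exists (\row_i lim ((fun k => u k ord0 i) @ \oo)).
apply/cvgrPdist_le => e e0.
have : \forall k \near \oo, forall i : 'I_n,
    `|lim ((fun k => u k ord0 i) @ \oo) - u k ord0 i| <= e.
  apply: filter_forall => i.
  by have /cvgrPdist_le := H i; apply.
apply: filterS => k Hk; apply/mx_norm_leP => [|i j]; first exact: ltW.
by rewrite !mxE (ord1 i).
Qed.

Lemma geom_complete_prod (E F : normedModType R) :
  geom_complete E -> geom_complete F -> geom_complete (E * F)%type.
Proof.
move=> cE cF u c uc.
have u1 : cvgn (fun k => (u k).1).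
  by apply: (cE _ c) => k; apply: le_trans (uc k); rewrite prod_normE le_max lexx.
have u2 : cvgn (fun k => (u k).2).
  by apply: (cF _ c) => k; apply: le_trans (uc k); rewrite prod_normE le_max lexx orbT.
apply/cvg_ex; exists (lim ((fun k => (u k).1) @ \oo), lim ((fun k => (u k).2) @ \oo)).
have -> : u = (fun k => ((u k).1, (u k).2)) by apply/funext => k; case: (u k).
by apply: cvg_pair.
Qed.

End Halves.

(** * The local exponential as a limit of dyadic powers *)

Section LocalPowers.
Context {R : realType} {E : normedModType R} (G : lieGroup E).
Local Notation ch := (@chart1 R E G).
Local Notation ex := (@point1 R E G).
Local Notation U := (dom (lg_atlas G) 1%g).
Local Notation h k := ((2^-1 : R) ^+ k).
Variables (rho C : R).
Hypothesis rho0 : 0 < rho.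
Hypothesis C1 : 1 <= C.
Hypothesis Hpt : forall v, `|v| <= rho -> U (ex v) /\ ch (ex v) = v.
Hypothesis Hprod : forall u v v' w,
  `|u| <= rho -> `|v| <= rho -> `|v'| <= rho -> `|w| <= rho ->
    U (ex u * ex v * ex w)%g /\
    `|ch (ex u * ex v * ex w)%g - ch (ex u * ex v' * ex w)%g| <= C * `|v - v'|.
Hypothesis Hlaw : forall u v, `|u| <= rho -> `|v| <= rho ->
    `|ch (ex u * ex v)%g - u - v| <= C * (`|u| * `|v|).

Let C0 : 0 < C. Proof. exact: lt_le_trans C1. Qed.
Let z0 : `|0 : E| <= rho. Proof. by rewrite normr0 ltW. Qed.

Lemma mul_step u v : `|u| <= rho -> `|v| <= rho ->
  U (ex u * ex v)%g /\ `|ch (ex u * ex v)%g - u| <= C * `|v|.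
Proof.
move=> ur vr; have [d] := Hprod ur vr z0 z0.
move: d; rewrite !point1_0 !mulg1 subr0 (Hpt ur).2 => d dv.
by split.
Qed.

Lemma mul_lip a a' b b' : `|a| <= rho -> `|a'| <= rho -> `|b| <= rho ->
  `|b'| <= rho ->
  `|ch (ex a * ex b)%g - ch (ex a' * ex b')%g| <= C * `|a - a'| + C * `|b - b'|.
Proof.
move=> ar ar' br br'.
have [_ H1] := Hprod z0 ar ar' br; have [_ H2] := Hprod ar' br br' z0.
move: H1 H2; rewrite !point1_0 !mul1g !mulg1 => H1 H2.
apply: le_trans (ler_distD (ch (ex a' * ex b)%g) _ _) _.
exact: lerD.
Qed.

Lemma pow_small v n : C * n%:R * `|v| <= rho -> `|v| <= rho ->
  forall i, (i <= n)%N ->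
    U (ex v ^+ i)%g /\ `|ch (ex v ^+ i)%g| <= C * i%:R * `|v|.
Proof.
move=> vn vr; elim=> [|i IH] iltn.
  by rewrite expg0 chart1_1 normr0 mulr0 mul0r; split => //; exact: dom1.
have [di ci] := IH (ltnW iltn).
have wr : `|ch (ex v ^+ i)%g| <= rho.
  apply: le_trans ci _; apply: le_trans vn; apply: ler_wpM2r => //.
  by apply: ler_wpM2l; [exact: ltW|rewrite ler_nat ltnW].
have [] := mul_step wr vr; rewrite chart1K // -expgSr => d1 d2.
split=> //; rewrite -[ch _](subrK (ch (ex v ^+ i)%g)).
apply: le_trans (ler_normD _ _) _.
rewrite -natr1 mulrDr mulrDl mulr1 addrC; exact: lerD.
Qed.

Lemma pow_le_rho v n i : C * n%:R * `|v| <= rho -> `|v| <= rho -> (i <= n)%N ->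
  `|ch (ex v ^+ i)%g| <= rho.
Proof.
move=> vn vr ilen; have [_ ci] := pow_small vn vr ilen.
apply: le_trans ci _; apply: le_trans vn; apply: ler_wpM2r => //.
by apply: ler_wpM2l; [exact: ltW|rewrite ler_nat].
Qed.

Lemma pow_lip v v' n : C * n%:R * `|v| <= rho -> `|v| <= rho ->
  C * n%:R * `|v'| <= rho -> `|v'| <= rho ->
  `|ch (ex v ^+ n)%g - ch (ex v' ^+ n)%g| <= C * n%:R * `|v - v'|.
Proof.
move=> vn vr vn' vr'.
(* Replace the factors [ex v'] by [ex v] one by one; each exchange happens between two small powers
   and is controlled by [Hprod]. *)
pose F i := ch (ex v ^+ i * ex v' ^+ (n - i))%g.
suff H i : (i <= n)%N -> `|F i - F 0%N| <= C * i%:R * `|v - v'|.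
  by have := H n (leqnn n); rewrite /F subnn subn0 !expg0 mulg1 mul1g.
elim: i => [_|i IH iltn]; first by rewrite subrr normr0 mulr0 mul0r.
apply: le_trans (ler_distD (F i) _ _) _.
rewrite -natr1 mulrDr mulrDl mulr1 addrC; apply: lerD; first exact: IH (ltnW iltn).
have le2 : (n - i.+1 <= n)%N by rewrite leq_subr.
have [d1 _] := pow_small vn vr (ltnW iltn).
have [d2 _] := pow_small vn' vr' le2.
have [_] := Hprod (pow_le_rho vn vr (ltnW iltn)) vr vr' (pow_le_rho vn' vr' le2).
rewrite !chart1K // -expgSr /F.
have -> : (n - i = (n - i.+1).+1)%N by rewrite subnS prednK // subn_gt0.
by rewrite [(ex v' ^+ (n - i.+1).+1)%g]expgS mulgA.
Qed.

(** The i-th multiplication contributes an error C |v^i| |v|, of order i |v|^2, and these add up to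
    order n^2 |v|^2. *)
Lemma pow_quad v n : C * n%:R * `|v| <= rho -> `|v| <= rho ->
  `|ch (ex v ^+ n)%g - n%:R *: v| <= C ^+ 2 * n%:R ^+ 2 * `|v| ^+ 2.
Proof.
move=> vn vr.
suff H i : (i <= n)%N ->
    `|ch (ex v ^+ i)%g - i%:R *: v| <= C ^+ 2 * i%:R ^+ 2 * `|v| ^+ 2.
  exact: H.
elim: i => [_|i IH iltn].
  by rewrite expg0 chart1_1 scale0r subrr normr0 expr0n mulr0 mul0r.
have [d1 c1] := pow_small vn vr (ltnW iltn).
have := Hlaw (pow_le_rho vn vr (ltnW iltn)) vr; rewrite chart1K // -expgSr.
move=> H; set w := ch (ex v ^+ i)%g in c1 H IH.
have -> : ch (ex v ^+ i.+1)%g - i.+1%:R *: v =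
    (ch (ex v ^+ i.+1)%g - w - v) + (w - i%:R *: v).
  rewrite -natr1 scalerDl scale1r opprD addrA [in RHS]addrA.
  by rewrite [_ - w - v + w]addrAC subrK [RHS]addrAC.
apply: le_trans (ler_normD _ _) _.
apply: le_trans (lerD H (IH (ltnW iltn))) _.
apply: (@le_trans _ _ (C * (C * i%:R * `|v| * `|v|) + C ^+ 2 * i%:R ^+ 2 * `|v| ^+ 2)).
  apply: lerD => //; apply: ler_wpM2l; [exact: ltW|exact: ler_wpM2r].
rewrite -natr1 -subr_ge0.
have -> : C ^+ 2 * (i%:R + 1) ^+ 2 * `|v| ^+ 2 -
  (C * (C * i%:R * `|v| * `|v|) + C ^+ 2 * i%:R ^+ 2 * `|v| ^+ 2) =
  C ^+ 2 * `|v| ^+ 2 * (i%:R + 1) by ring.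
by rewrite !mulr_ge0 // ?exprn_ge0 // ?addr_ge0 // ltW.
Qed.

(** The innermost pair [ex v * ex (- v)] has a coordinate of order |v|^2; removing the pairs from
    the inside costs that much n times. *)
Lemma pow_opp v n : C * n%:R * `|v| <= rho -> 2 * C * `|v| <= rho ->
  `|ch (ex v ^+ n * ex (- v) ^+ n)%g| <= C ^+ 2 * n%:R * `|v| ^+ 2.
Proof.
move=> vn v2.
have vr : `|v| <= rho.
  by apply: le_trans v2; rewrite ler_peMl // mulr_ege1 // ler1n.
have vr' : `|- v| <= rho by rewrite normrN.
have vn' : C * n%:R * `|- v| <= rho by rewrite normrN.
suff H i : (i <= n)%N ->
    `|ch (ex v ^+ i * ex (- v) ^+ i)%g| <= C ^+ 2 * i%:R * `|v| ^+ 2.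
  exact: H.
elim: i => [_|i IH iltn].
  by rewrite !expg0 mulg1 chart1_1 normr0 mulr0 mul0r.
have [d1 _] := pow_small vn vr (ltnW iltn).
have [d2 _] := pow_small vn' vr' (ltnW iltn).
have [dz cz] := mul_step vr vr'.
set z := ch (ex v * ex (- v))%g in cz.
have zr : `|z| <= rho.
  rewrite -[z](subrK v); apply: le_trans (ler_normD _ _) _.
  apply: le_trans (lerD cz (lexx _)) _; rewrite normrN; apply: le_trans v2.
  by rewrite -mulrA mulr_natl mulr2n lerD2l ler_peMl.
have zq : `|z| <= C * `|v| ^+ 2.
  by have := Hlaw vr vr'; rewrite opprK -/z subrK normrN expr2.
have [_] := Hprod (pow_le_rho vn vr (ltnW iltn)) zr z0 (pow_le_rho vn' vr' (ltnW iltn)).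
rewrite !chart1K // point1_0 mulg1 subr0.
have -> : (ex v ^+ i * (ex v * ex (- v)) * ex (- v) ^+ i =
  ex v ^+ i.+1 * ex (- v) ^+ i.+1)%g by rewrite expgSr expgS !mulgA.
move=> H; rewrite -[ch _](subrK (ch (ex v ^+ i * ex (- v) ^+ i)%g)).
apply: le_trans (ler_normD _ _) _; apply: le_trans (lerD H (IH (ltnW iltn))) _.
rewrite -natr1 mulrDr mulr1 mulrDl addrC lerD2l expr2 -mulrA.
by apply: ler_wpM2l => //; exact: ltW.
Qed.


(** Small enough that an element enlarged twice by the factor [C] still has norm at most rho / 4. *)
Let dl := rho / (4 * C ^+ 2).

Let dl0 : 0 < dl. Proof. by rewrite divr_gt0 // mulr_gt0 // exprn_gt0. Qed.

Let dlC2 : C * (C * dl) <= rho / 4.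
Proof. by rewrite /dl le_eqVlt; apply/orP; left; apply/eqP; field; rewrite lt0r_neq0. Qed.

Let rho4 : rho / 4 <= rho / 2.
Proof. by rewrite ler_pM2l // lef_pV2 ?posrE // ler_nat. Qed.

Let dlC : C * dl <= rho / 4.
Proof. by apply: le_trans dlC2; rewrite ler_peMl // mulr_ge0 // ltW. Qed.

Let dlC' : C * dl <= rho.
Proof. by apply: le_trans dlC _; rewrite ler_pdivrMr // ler_peMr ?ler1n // ltW. Qed.

Let dlrho : dl <= rho.
Proof. by apply: le_trans dlC'; rewrite ler_peMl // ltW. Qed.

Let normh (X : E) k : `|h k *: X| = h k * `|X|.
Proof. by rewrite normrZ ger0_norm // half_ge0. Qed.

Let hle (X : E) k : `|X| <= dl -> `|h k *: X| <= rho.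
Proof.
move=> Xd; rewrite normh; apply: le_trans dlrho; apply: le_trans Xd.
by rewrite ler_piMl // half_le1.
Qed.

Let hpow (X : E) k : C * (2 ^ k)%:R * `|h k *: X| = C * `|X|.
Proof. by rewrite normh -mulrA [_%:R * _]mulrA half_pow mul1r. Qed.

Let CX (X : E) : `|X| <= dl -> C * `|X| <= rho.
Proof. by move=> Xd; apply: le_trans dlC'; rewrite ler_pM2l. Qed.

Let hpow_le (X : E) k : `|X| <= dl -> C * (2 ^ k)%:R * `|h k *: X| <= rho.
Proof. by move=> Xd; rewrite hpow CX. Qed.

Definition exp_approx (X : E) (k : nat) : E := ch (ex (h k *: X) ^+ (2 ^ k))%g.

Definition exp_coord (X : E) : E := lim (exp_approx X @ \oo).

Hypothesis cplt : geom_complete E.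

(** With v = 2^-(k+1) X, the square of [ex v] has coordinate z = 2v + O(|v|^2). The next
    approximation is thus the 2^k-th power of [ex z], compared with that of [ex (2v)]; [pow_lip]
    multiplies the error by 2^k, which leaves O(2^-k). *)
Lemma exp_approx_cvg X : `|X| <= dl -> exp_approx X @ \oo --> exp_coord X.
Proof.
move=> Xd; apply: (cplt (c := C ^+ 2 * `|X| ^+ 2)) => k; rewrite /exp_approx.
set v := h k.+1 *: X.
have vr : `|v| <= rho by exact: hle.
have [dz cz] := mul_step vr vr.
have := Hlaw vr vr; set z := ch (ex v * ex v)%g in cz *.
have vv : v + v = h k *: X.
  by rewrite -scalerDl; congr (_ *: X); rewrite exprS; field.
rewrite -addrA -opprD vv => zq.
have nv : `|v| = 2^-1 * h k * `|X| by rewrite normh exprS.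
have zv : `|z| <= C * (h k * `|X|).
  rewrite -[z](subrK v); apply: le_trans (ler_normD _ _) _.
  apply: (@le_trans _ _ (C * `|v| + C * `|v|)).
    by apply: lerD => //; rewrite ler_peMl.
  rewrite le_eqVlt; apply/orP; left; apply/eqP; rewrite nv; by field.
have zr : `|z| <= rho.
  apply: le_trans zv _; apply: (@le_trans _ _ (C * `|X|)); last exact: CX.
  by rewrite ler_pM2l // ler_piMl // half_le1.
have zn : C * (2 ^ k)%:R * `|z| <= rho.
  apply: (@le_trans _ _ (C * (C * `|X|))).
    apply: (@le_trans _ _ (C * (2 ^ k)%:R * (C * (h k * `|X|)))).
      by apply: ler_wpM2l => //; rewrite mulr_ge0 // ltW.
    rewrite -mulrA; apply: ler_wpM2l; first exact: ltW.
    by rewrite mulrCA [_%:R * (_ * _)]mulrA half_pow mul1r.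
  apply: (@le_trans _ _ (C * (C * dl))); first by rewrite !ler_pM2l.
  by apply: le_trans dlC2 _; rewrite ler_pdivrMr // ler_peMr ?ler1n // ltW.
have -> : (ex v ^+ (2 ^ k.+1) = ex z ^+ (2 ^ k))%g.
  by rewrite /z chart1K // expnS expgnA expg2.
apply: le_trans (pow_lip zn zr (hpow_le k Xd) (hle k Xd)) _.
apply: (@le_trans _ _ (C * (2 ^ k)%:R * (C * (`|v| * `|v|)))).
  by apply: ler_wpM2l => //; rewrite mulr_ge0 // ltW.
rewrite nv.
have -> : C * (2 ^ k)%:R * (C * (2^-1 * h k * `|X| * (2^-1 * h k * `|X|))) =
   C ^+ 2 * `|X| ^+ 2 * h k * ((2 ^ k)%:R * h k) * 4^-1.
  by field.
rewrite half_pow mulr1 ler_piMr // ?invf_le1 ?ler1n //.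
by rewrite !mulr_ge0 // ?exprn_ge0 // ?half_ge0 // ltW.
Qed.

Lemma exp_coord_lip X Y : `|X| <= dl -> `|Y| <= dl ->
  `|exp_coord X - exp_coord Y| <= C * `|X - Y|.
Proof.
move=> Xd Yd.
apply: (norm_lim_le (seq_cvgB (exp_approx_cvg Xd) (exp_approx_cvg Yd))) => k.
apply: le_trans (pow_lip (hpow_le k Xd) (hle k Xd) (hpow_le k Yd) (hle k Yd)) _.
by rewrite -scalerBr hpow.
Qed.

Lemma exp_coord_quad X : `|X| <= dl ->
  `|exp_coord X - X| <= C ^+ 2 * `|X| ^+ 2.
Proof.
move=> Xd.
have cX : (fun _ : nat => X) @ \oo --> X by exact: cvg_cst.
apply: (norm_lim_le (seq_cvgB (exp_approx_cvg Xd) cX)) => k.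
have := pow_quad (hpow_le k Xd) (hle k Xd).
rewrite scalerA half_pow scale1r => /le_trans; apply.
by rewrite -mulrA -exprMn normh [_%:R * (_ * _)]mulrA half_pow mul1r.
Qed.

Lemma exp_coord0 : exp_coord 0 = 0.
Proof.
have d0 : `|0 : E| <= dl by rewrite normr0 ltW.
have := exp_coord_quad d0; rewrite subr0 normr0 expr0n mulr0 normr_le0.
by move/eqP.
Qed.

Lemma exp_coord_le X : `|X| <= dl -> `|exp_coord X| <= C * `|X|.
Proof.
move=> Xd; have d0 : `|0 : E| <= dl by rewrite normr0 ltW.
by have := exp_coord_lip Xd d0; rewrite exp_coord0 !subr0.
Qed.

Lemma exp_coord_rho X : `|X| <= dl -> `|exp_coord X| <= rho.
Proof. by move=> Xd; apply: le_trans (exp_coord_le Xd) (CX Xd). Qed.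

Definition loc_exp (X : E) : G := ex (exp_coord X).

Lemma loc_exp_chart X : `|X| <= dl ->
  U (loc_exp X) /\ ch (loc_exp X) = exp_coord X.
Proof. by move=> Xd; apply: Hpt; exact: exp_coord_rho. Qed.

Lemma loc_exp_inj_eq X g : `|X| <= dl -> U g -> exp_coord X = ch g -> loc_exp X = g.
Proof. by move=> Xd Ug e; rewrite /loc_exp e chart1K. Qed.

(** Compare [ex (n v)] with [ex v ^+ n] for v = 2^-k Y: their coordinates differ by O(|v|^2), hence
    their 2^k-th powers by O(2^-k). The second power is also the n-th power of the approximation of
    exp Y. *)
Lemma loc_exp_muln n Y : n%:R * `|Y| <= dl -> `|Y| <= dl ->
  loc_exp (n%:R *: Y) = (loc_exp Y ^+ n)%g.
Proof.
move=> nYd Yd.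
have nYd' : `|n%:R *: Y| <= dl by rewrite normrZ normr_nat.
have eYn : C * n%:R * `|exp_coord Y| <= rho.
  apply: (@le_trans _ _ (C * n%:R * (C * `|Y|))).
    by apply: ler_wpM2l; [rewrite mulr_ge0 // ltW|exact: exp_coord_le].
  rewrite -mulrA [n%:R * _]mulrCA.
  apply: (@le_trans _ _ (C * (C * dl))); first by rewrite !ler_pM2l.
  by apply: le_trans dlC2 _; rewrite ler_pdivrMr // ler_peMr ?ler1n // ltW.
have [dn _] := pow_small eYn (exp_coord_rho Yd) (leqnn n).
apply: loc_exp_inj_eq => //.
(* The first term is the quadratic error of [pow_quad] raised to the power 2^k, the second the
   distance of the approximation of exp Y from its limit, raised to the power n. *)
pose b k := C ^+ 3 * n%:R ^+ 2 * `|Y| ^+ 2 * h k +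
  C * n%:R * `|exp_approx Y k - exp_coord Y|.
apply: (squeeze_eq (exp_approx_cvg nYd') (b := b)).
  rewrite -[X in _ --> X]addr0; apply: cvgD; first exact: half_cvg0.
  rewrite -[X in _ --> X](mulr0 (C * n%:R)); apply: cvgMr.
  apply/norm_cvg0P; rewrite -(subrr (exp_coord Y)).
  by apply: seq_cvgB; [exact: exp_approx_cvg|exact: cvg_cst].
move=> k; rewrite /b; set v := h k *: Y.
have vr : `|v| <= rho by exact: hle.
have nv : C * n%:R * `|v| <= rho.
  apply: (@le_trans _ _ (C * dl)); last exact: dlC'.
  rewrite -mulrA ler_pM2l //; apply: le_trans nYd; apply: ler_wpM2l => //.
  by rewrite normh ler_piMl // half_le1.
have [dw cw] := pow_small nv vr (leqnn n).
have wr := pow_le_rho nv vr (leqnn n).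
have wq := pow_quad nv vr.
set w := ch (ex v ^+ n)%g in cw wr wq.
have exw : ex w = (ex v ^+ n)%g by rewrite /w chart1K.
have wn : C * (2 ^ k)%:R * `|w| <= rho.
  apply: (@le_trans _ _ (C * (2 ^ k)%:R * (C * n%:R * `|v|))).
    by apply: ler_wpM2l => //; rewrite mulr_ge0 // ltW.
  rewrite normh.
  have -> : C * (2 ^ k)%:R * (C * n%:R * (h k * `|Y|)) =
     ((2 ^ k)%:R * h k) * (C * (C * (n%:R * `|Y|))) by ring.
  rewrite half_pow mul1r.
  apply: (@le_trans _ _ (C * (C * dl))); first by rewrite !ler_pM2l.
  by apply: le_trans dlC2 _; rewrite ler_pdivrMr // ler_peMr ?ler1n // ltW.
have e1 : h k *: (n%:R *: Y) = n%:R *: v by rewrite /v !scalerA mulrC.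
have := pow_lip (hpow_le k nYd') (hle k nYd') wn wr.
rewrite exw -[X in ch (X ^+ _)%g - _]/(ex (h k *: (n%:R *: Y))) => H1.
have en : C * n%:R * `|exp_approx Y k| <= rho.
  apply: (@le_trans _ _ (C * n%:R * (C * `|Y|))).
    apply: ler_wpM2l; first by rewrite mulr_ge0 // ltW.
    have [_] := pow_small (hpow_le k Yd) (hle k Yd) (leqnn (2 ^ k)).
    by rewrite hpow.
  rewrite -mulrA [n%:R * _]mulrCA.
  apply: (@le_trans _ _ (C * (C * dl))); first by rewrite !ler_pM2l.
  by apply: le_trans dlC2 _; rewrite ler_pdivrMr // ler_peMr ?ler1n // ltW.
have er : `|exp_approx Y k| <= rho := pow_le_rho (hpow_le k Yd) (hle k Yd) (leqnn _).
have H2 := pow_lip en er eYn (exp_coord_rho Yd).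
have e2 : (ex (exp_approx Y k) ^+ n = (ex v ^+ n) ^+ (2 ^ k))%g.
  rewrite /exp_approx chart1K; last first.
    exact: (pow_small (hpow_le k Yd) (hle k Yd) (leqnn (2 ^ k))).1.
  by rewrite expgnAC.
rewrite e2 in H2.
apply: le_trans (ler_distD (ch ((ex v ^+ n) ^+ (2 ^ k))%g) _ _) _.
apply: lerD => //; apply: le_trans H1 _.
apply: (@le_trans _ _ (C * (2 ^ k)%:R * (C ^+ 2 * n%:R ^+ 2 * `|v| ^+ 2))).
  by apply: ler_wpM2l; [rewrite mulr_ge0 // ltW|rewrite e1 distrC].
rewrite normh.
have -> : C * (2 ^ k)%:R * (C ^+ 2 * n%:R ^+ 2 * (h k * `|Y|) ^+ 2) =
   C ^+ 3 * n%:R ^+ 2 * `|Y| ^+ 2 * h k * ((2 ^ k)%:R * h k) by ring.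
by rewrite half_pow mulr1.
Qed.

Lemma loc_exp_oppr Y : `|Y| <= dl -> (loc_exp Y * loc_exp (- Y))%g = 1%g.
Proof.
move=> Yd; have Yd' : `|- Y| <= dl by rewrite normrN.
have [d0 _] := mul_step (exp_coord_rho Yd) (exp_coord_rho Yd').
suff : ch (loc_exp Y * loc_exp (- Y))%g = 0.
  by move=> e; rewrite -[LHS](chart1K d0) e point1_0.
pose b k := C ^+ 2 * `|Y| ^+ 2 * h k.
have cv : (fun k => ch (ex (exp_approx Y k) * ex (exp_approx (- Y) k))%g) @ \oo
    --> ch (loc_exp Y * loc_exp (- Y))%g.
  apply: (@cvg_comp _ _ _ (fun k => ex (exp_approx Y k) * ex (exp_approx (- Y) k))%g
    ch _ (nbhs (loc_exp Y * loc_exp (- Y))%g)); last exact: chart1_cvg d0.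
  have c1 Z : `|Z| <= dl -> ex (exp_approx Z k) @[k --> \oo] --> loc_exp Z.
    move=> Zd; apply: (@cvg_comp _ _ _ (exp_approx Z) ex _ (nbhs (exp_coord Z))).
      exact: exp_approx_cvg.
    have [dz ez] := loc_exp_chart Zd.
    by rewrite -ez; exact: point1_cvg.
  by apply: cvg_mulg; exact: c1.
apply: (squeeze_eq cv (b := b)); first exact: half_cvg0.
move=> k; rewrite subr0 /exp_approx !chart1K.
- rewrite scalerN; apply: le_trans (pow_opp (hpow_le k Yd) _) _.
    rewrite -mulrA; apply: (@le_trans _ _ (2 * (C * dl))).
      rewrite !ler_pM2l // normh; apply: le_trans Yd.
      by rewrite ler_piMl // half_le1.
    rewrite mulrC -ler_pdivlMr //; exact: le_trans dlC rho4.
  rewrite normh /b.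
  have -> : C ^+ 2 * (2 ^ k)%:R * (h k * `|Y|) ^+ 2 =
     C ^+ 2 * `|Y| ^+ 2 * h k * ((2 ^ k)%:R * h k) by ring.
  by rewrite half_pow mulr1.
- exact: (pow_small (hpow_le k Yd') (hle k Yd') (leqnn (2 ^ k))).1.
- exact: (pow_small (hpow_le k Yd) (hle k Yd) (leqnn (2 ^ k))).1.
Qed.

End LocalPowers.

Section LocalExp.
Context {R : realType} {E : normedModType R} (G : lieGroup E).
Hypothesis cplt : geom_complete E.
Local Notation ch := (@chart1 R E G).
Local Notation ex := (@point1 R E G).
Local Notation U := (dom (lg_atlas G) 1%g).

(** Collects what the global construction uses, with a single constant and no reference to the
    approximating powers. *)
Lemma local_exp : exists (dl C : R) (f : E -> E), 0 < dl /\ 0 < C /\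
  [/\ forall X, `|X| <= dl -> U (ex (f X)) /\ ch (ex (f X)) = f X,
      forall X Y, `|X| <= dl -> `|Y| <= dl -> `|f X - f Y| <= C * `|X - Y|,
      forall X, `|X| <= dl -> `|f X - X| <= C * `|X| ^+ 2,
      forall n X, n%:R * `|X| <= dl -> `|X| <= dl ->
        ex (f (n%:R *: X)) = (ex (f X) ^+ n)%g
    & forall X, `|X| <= dl -> (ex (f X) * ex (f (- X)))%g = 1%g ] /\
  forall X X' Y Y', `|X| <= dl -> `|X'| <= dl -> `|Y| <= dl -> `|Y'| <= dl ->
      U (ex (f X) * ex (f Y))%g /\
      `|ch (ex (f X) * ex (f Y))%g - ch (ex (f X') * ex (f Y'))%g| <=
        C * (`|X - X'| + `|Y - Y'|).
Proof.
have [rho [C [rho0 C1 H1 H2 H3]]] := local_group G.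
have C0 : 0 < C by exact: lt_le_trans C1.
have CC : C <= C ^+ 2 by rewrite expr2 ler_peMl // ltW.
have fr X := @exp_coord_rho _ _ _ _ _ rho0 C1 H1 H2 H3 cplt X.
exists (rho / (4 * C ^+ 2)), (C ^+ 2), (exp_coord G); split.
  by rewrite divr_gt0 // mulr_gt0 // exprn_gt0.
split; first by rewrite exprn_gt0.
have lip X Y := @exp_coord_lip _ _ _ _ _ rho0 C1 H1 H2 H3 cplt X Y.
split.
  split.
  - exact: (@loc_exp_chart _ _ _ _ _ rho0 C1 H1 H2 H3 cplt).
  - by move=> X Y Xd Yd; apply: le_trans (lip _ _ Xd Yd) _; apply: ler_wpM2r.
  - exact: (@exp_coord_quad _ _ _ _ _ rho0 C1 H1 H2 H3 cplt).
  - exact: (@loc_exp_muln _ _ _ _ _ rho0 C1 H1 H2 H3 cplt).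
  - exact: (@loc_exp_oppr _ _ _ _ _ rho0 C1 H1 H2 H3 cplt).
move=> X X' Y Y' Xd Xd' Yd Yd'; split.
  exact: (mul_step rho0 H1 H2 (fr _ Xd) (fr _ Yd)).1.
apply: le_trans (mul_lip rho0 H2 (fr _ Xd) (fr _ Xd') (fr _ Yd) (fr _ Yd')) _.
rewrite -mulrDr expr2 -[leRHS]mulrA; apply: ler_wpM2l; first exact: ltW.
by rewrite mulrDr; apply: lerD; exact: lip.
Qed.

End LocalExp.

(** * Extension of the exponential to the whole Lie algebra *)

Lemma near_cvg (T : Type) (V : topologicalType) (F : set_system T) {FF : Filter F}
    (f g : T -> V) (l : V) :
  (\forall x \near F, f x = g x) -> g @ F --> l -> f @ F --> l.
Proof.
move=> fg; apply: cvg_trans; apply: near_eq_cvg.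
by apply: filterS fg => x ->.
Qed.

Section GlobalExp.
Context {R : realType} {E : normedModType R} (G : lieGroup E).
Local Notation ch := (@chart1 R E G).
Local Notation ex := (@point1 R E G).
Local Notation U := (dom (lg_atlas G) 1%g).
Local Notation h k := ((2^-1 : R) ^+ k).
Variables (dl C : R) (f : E -> E).
Hypothesis dl0 : 0 < dl.
Hypothesis C0 : 0 < C.
Hypothesis Hdom : forall X, `|X| <= dl -> U (ex (f X)) /\ ch (ex (f X)) = f X.
Hypothesis Hlip : forall X Y, `|X| <= dl -> `|Y| <= dl ->
  `|f X - f Y| <= C * `|X - Y|.
Hypothesis Hquad : forall X, `|X| <= dl -> `|f X - X| <= C * `|X| ^+ 2.
Hypothesis Hmuln : forall n X, n%:R * `|X| <= dl -> `|X| <= dl ->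
  ex (f (n%:R *: X)) = (ex (f X) ^+ n)%g.
Hypothesis Hopp : forall X, `|X| <= dl -> (ex (f X) * ex (f (- X)))%g = 1%g.
Hypothesis Hmul : forall X X' Y Y', `|X| <= dl -> `|X'| <= dl ->
  `|Y| <= dl -> `|Y'| <= dl ->
  U (ex (f X) * ex (f Y))%g /\
  `|ch (ex (f X) * ex (f Y))%g - ch (ex (f X') * ex (f Y'))%g| <=
      C * (`|X - X'| + `|Y - Y'|).

Local Notation e X := (ex (f X)).

Let dyadic (s : R) k := (Num.truncn (s * 2 ^+ k))%:R * h k.

Let dyadic_le s k : 0 <= s -> dyadic s k <= s.
Proof.
move=> s0; rewrite /dyadic exprVn ler_pdivrMr ?exprn_gt0 //.
by rewrite truncn_le mulr_ge0 // exprn_ge0.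
Qed.

Let dyadic_ge0 s k : 0 <= dyadic s k.
Proof. by rewrite mulr_ge0 // half_ge0. Qed.

Let dyadic_near s k : 0 <= s -> `|s - dyadic s k| <= h k.
Proof.
move=> s0; rewrite ger0_norm ?subr_ge0 ?dyadic_le // lerBlDl /dyadic.
rewrite -[X in _ + X]mul1r -mulrDl exprVn ler_pdivlMr ?exprn_gt0 //.
by rewrite natr1 ltW // truncnS_gt.
Qed.

(** For dyadic parameters with a common denominator both sides are powers of one element, by
    [Hmuln]; the Lipschitz bounds carry the equality over to real parameters. *)
Lemma loc_exp_addr_ge0 s t Y : 0 <= s -> 0 <= t -> (s + t) * `|Y| <= dl ->
  (e (s *: Y) * e (t *: Y))%g = e ((s + t) *: Y).
Proof.
move=> s0 t0 stY.
have sub q : 0 <= q -> q <= s + t -> `|q *: Y| <= dl.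
  move=> q0 qst; rewrite normrZ ger0_norm //; apply: le_trans stY.
  exact: ler_wpM2r.
have sY : `|s *: Y| <= dl by apply: sub => //; rewrite lerDl.
have tY : `|t *: Y| <= dl by apply: sub => //; rewrite lerDr.
have stY' : `|(s + t) *: Y| <= dl by apply: sub; rewrite ?addr_ge0.
have [d0 _] := Hmul sY sY tY tY.
have [d1 e1] := Hdom stY'.
rewrite -[LHS](chart1K d0) -[RHS](chart1K d1); congr (ex _).
apply/eqP; rewrite -subr_eq0 -normr_le0.
apply: (half_le0 (c := C * (1 + 1) * `|Y| + C * (1 + 1) * `|Y|)) => k.
set s' := dyadic s k; set t' := dyadic t k.
have s'0 : 0 <= s' := dyadic_ge0 s k.
have t'0 : 0 <= t' := dyadic_ge0 t k.
have s's : s' <= s := dyadic_le k s0.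
have t't : t' <= t := dyadic_le k t0.
have s'Y : `|s' *: Y| <= dl.
  by apply: sub => //; apply: le_trans s's _; rewrite lerDl.
have t'Y : `|t' *: Y| <= dl.
  by apply: sub => //; apply: le_trans t't _; rewrite lerDr.
have st'Y : `|(s' + t') *: Y| <= dl.
  by apply: sub; [rewrite addr_ge0|exact: lerD].
have [_ H1] := Hmul sY s'Y tY t'Y.
have [d2 e2] := Hdom st'Y.
have key : (e (s' *: Y) * e (t' *: Y))%g = e ((s' + t') *: Y).
  rewrite /s' /t' /dyadic -mulrDl -!scalerA -natrD.
  set i := Num.truncn _; set j := Num.truncn _.
  have hij : (i + j)%:R * `|h k *: Y| <= dl.
    rewrite normrZ ger0_norm ?half_ge0 // mulrA natrD mulrDl -/(dyadic s k) -/(dyadic t k).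
    by move: st'Y; rewrite normrZ ger0_norm // addr_ge0.
  have ile (l : nat) : (l <= i + j)%N -> l%:R * `|h k *: Y| <= dl.
    by move=> l1; apply: le_trans hij; apply: ler_wpM2r => //; rewrite ler_nat.
  have [ij0|ij0] := posnP (i + j).
    move/eqP: ij0; rewrite addn_eq0 => /andP[/eqP -> /eqP ->].
    have z0 : 0%:R * `|0 : E| <= dl by rewrite mul0r ltW.
    have z0' : `|0 : E| <= dl by rewrite normr0 ltW.
    by rewrite !scale0r; have := Hmuln z0 z0'; rewrite scaler0 expg0 => ->; rewrite mulg1.
  have hk : `|h k *: Y| <= dl by have := ile 1%N ij0; rewrite mul1r.
  by rewrite !Hmuln // ?ile ?leq_addr ?leq_addl // expgnDr.
rewrite key e2 in H1.
rewrite e1; apply: le_trans (ler_distD (f ((s' + t') *: Y)) _ _) _.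
rewrite mulrDl; apply: lerD.
  apply: le_trans H1 _; rewrite -!scalerBl !normrZ -mulrDl.
  have -> : C * (1 + 1) * `|Y| * h k = C * ((h k + h k) * `|Y|) by ring.
  rewrite ler_pM2l //; apply: ler_wpM2r => //.
  by apply: lerD; exact: dyadic_near.
apply: le_trans (Hlip st'Y stY') _; rewrite -!scalerBl !normrZ.
have -> : C * (1 + 1) * `|Y| * h k = C * ((h k + h k) * `|Y|) by ring.
rewrite ler_pM2l //; apply: ler_wpM2r => //.
rewrite distrC opprD addrACA.
by apply: le_trans (ler_normD _ _) _; apply: lerD; exact: dyadic_near.
Qed.

(** Negative parameters are turned into inverses, and each mixed-sign case becomes an addition of
    nonnegative parameters read from the other side. *)
Lemma loc_exp_addr s t Y : (`|s| + `|t|) * `|Y| <= dl ->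
  (e (s *: Y) * e (t *: Y))%g = e ((s + t) *: Y).
Proof.
set r := `|s| + `|t| => rY.
have pos q u Z : `|Z| = `|Y| -> 0 <= q -> 0 <= u -> q + u <= r ->
    e ((q + u) *: Z) = (e (q *: Z) * e (u *: Z))%g.
  move=> ZY q0 u0 le; rewrite loc_exp_addr_ge0 // ZY; apply: le_trans rY.
  exact: ler_wpM2r.
have opp q : `|q| <= r -> e ((- q) *: Y) = ((e (q *: Y))^-1)%g.
  move=> qr; apply/esym/mulg1_eq; rewrite scaleNr Hopp //.
  by rewrite normrZ; apply: le_trans rY; exact: ler_wpM2r.
have sr : `|s| <= r by rewrite lerDl.
have tr : `|t| <= r by rewrite lerDr.
have [s0|s0] := leP 0 s; have [t0|t0] := leP 0 t.
- by rewrite -pos // /r !ger0_norm.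
- have nt0 : 0 <= - t by rewrite oppr_ge0 ltW.
  rewrite -[X in (_ * e (X *: _))%g](opprK t) opp ?normrN //.
  have [ts|st] := leP (- t) s.
    have E1 : e (s *: Y) = (e ((s + t) *: Y) * e ((- t) *: Y))%g.
      rewrite -pos // ?addrK //; first by rewrite -[t]opprK subr_ge0.
      by rewrite -[X in X <= _](ger0_norm s0).
    by rewrite E1 mulgK.
  have E1 : e ((- t) *: Y) = (e ((- t - s) *: Y) * e (s *: Y))%g.
    rewrite -pos ?subrK // ?subr_ge0 ?(ltW st) //.
    by rewrite -[X in X <= _](ger0_norm nt0) normrN.
  have -> : s + t = - (- t - s) by rewrite opprB opprK.
  rewrite [RHS]opp; last first.
    rewrite ger0_norm ?subr_ge0 ?(ltW st) //.
    by apply: le_trans tr; rewrite -[leRHS]normrN (ger0_norm nt0) gerBl.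
  by rewrite E1 invgM mulgA mulgV mul1g.
- have ns0 : 0 <= - s by rewrite oppr_ge0 ltW.
  rewrite -[X in (e (X *: _) * _)%g](opprK s) opp ?normrN //.
  have [st|ts] := leP (- s) t.
    have E1 : e (t *: Y) = (e ((- s) *: Y) * e ((s + t) *: Y))%g.
      rewrite -pos // ?addKr //; first by rewrite addrC -[s]opprK subr_ge0.
      by rewrite -[X in X <= _](ger0_norm t0).
    by rewrite E1 mulKg.
  have E1 : e ((- s) *: Y) = (e (t *: Y) * e ((- s - t) *: Y))%g.
    have e1 : t + (- s - t) = - s by rewrite addrC subrK.
    rewrite -pos ?e1 // ?subr_ge0 ?(ltW ts) //.
    by rewrite -[X in X <= _](ger0_norm ns0) normrN.
  have -> : s + t = - (- s - t) by rewrite opprB opprK addrC.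
  rewrite [RHS]opp; last first.
    rewrite ger0_norm ?subr_ge0 ?(ltW ts) //.
    by apply: le_trans sr; rewrite -[leRHS]normrN (ger0_norm ns0) gerBl.
  by rewrite E1 invgM -mulgA mulVg mulg1.
- have ns0 : 0 <= - s by rewrite oppr_ge0 ltW.
  have nt0 : 0 <= - t by rewrite oppr_ge0 ltW.
  have Eq q : q *: Y = (- q) *: (- Y) by rewrite scaleNr scalerN opprK.
  rewrite (Eq s) (Eq t) (Eq (s + t)) opprD pos ?normrN //.
  by rewrite /r -(normrN s) -(normrN t) !ger0_norm.
Qed.

Lemma loc_exp_cvg X : `|X| < dl -> (fun Y => e Y) @ X --> e X.
Proof.
move=> Xd; have [d1 e1] := Hdom (ltW Xd).
apply: (@cvg_comp _ _ _ f ex _ (nbhs (f X))); last first.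
  by have := point1_cvg d1; rewrite e1.
apply/cvgrPdist_le => eps eps0; apply/nbhs_addP.
exists (Num.min (dl - `|X|) (eps / C)).
  by rewrite lt_min subr_gt0 Xd divr_gt0.
move=> y; rewrite lt_min ltrBrDl => /andP[y1 y2].
have yd : `|X + y| <= dl by apply: le_trans (ler_normD _ _) (ltW y1).
apply: le_trans (Hlip (ltW Xd) yd) _.
by rewrite opprD addNKr normrN mulrC -ler_pdivlMr // ltW.
Qed.

Definition glob_exp (X : E) : G :=
  let N := (Num.truncn (`|X| / dl)).+1 in (e (N%:R^-1 *: X) ^+ N)%g.

Let divN N (X : E) : (0 < N)%N -> `|X| <= N%:R * dl -> `|N%:R^-1 *: X| <= dl.
Proof.
move=> N0 XN; rewrite normrZ ger0_norm ?invr_ge0 // mulrC ler_pdivrMr ?ltr0n //.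
by rewrite mulrC.
Qed.

(** Two admissible denominators agree with their product as a common denominator, so any
    sufficiently large [N] may be used; this lets several vectors share one [N]. *)
Lemma glob_expE N (X : E) : (0 < N)%N -> `|X| <= N%:R * dl ->
  glob_exp X = (e (N%:R^-1 *: X) ^+ N)%g.
Proof.
have step M P : (0 < M)%N -> (0 < P)%N -> `|X| <= M%:R * dl ->
    (e (M%:R^-1 *: X) ^+ M = e ((M * P)%:R^-1 *: X) ^+ (M * P))%g.
  move=> M0 P0 XM; rewrite [X in (_ = _ ^+ X)%g]mulnC expgnA; congr (_ ^+ _)%g.
  have e0 : P%:R *: ((M * P)%:R^-1 *: X) = M%:R^-1 *: X.
    rewrite scalerA natrM invfM mulrCA mulfV ?mulr1 //.
    by rewrite pnatr_eq0 -lt0n.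
  have small : P%:R * `|(M * P)%:R^-1 *: X| <= dl.
    by have := divN M0 XM; rewrite -e0 normrZ normr_nat.
  rewrite -Hmuln // ?e0 //.
  by apply: le_trans small; rewrite ler_peMl // ler1n.
move=> N0 XN; rewrite /glob_exp; set M := Num.truncn _.
have XM : `|X| <= M.+1%:R * dl.
  rewrite -ler_pdivrMr //; apply: ltW; exact: truncnS_gt.
by rewrite (step M.+1 N) // (step N M.+1) // mulnC.
Qed.

Lemma big_nat (x : R) : exists2 N, (0 < N)%N & x <= N%:R * dl.
Proof.
exists (Num.truncn (x / dl)).+1 => //.
by rewrite -ler_pdivrMr //; apply: ltW; exact: truncnS_gt.
Qed.

Lemma glob_exp_addr (s t : R) (Y : E) :
  glob_exp ((s + t) *: Y) = (glob_exp (s *: Y) * glob_exp (t *: Y))%g.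
Proof.
have [N N0 HN] := big_nat ((`|s| + `|t|) * `|Y|).
have b q : `|q| <= `|s| + `|t| -> `|q *: Y| <= N%:R * dl.
  by move=> qst; rewrite normrZ; apply: le_trans HN; exact: ler_wpM2r.
rewrite !(glob_expE (N := N)) ?b ?lerDl ?lerDr ?ler_normD //.
have sw q : N%:R^-1 *: (q *: Y) = q *: (N%:R^-1 *: Y) by rewrite !scalerA mulrC.
have small : (`|s| + `|t|) * `|N%:R^-1 *: Y| <= dl.
  rewrite normrZ ger0_norm ?invr_ge0 // mulrCA mulrC ler_pdivrMr ?ltr0n //.
  by rewrite [leRHS]mulrC.
rewrite !sw -loc_exp_addr // expgMn // /commute loc_exp_addr //.
by rewrite loc_exp_addr 1?addrC // addrC.
Qed.

Lemma cvg_expgn (T : Type) (F : set_system T) {FF : Filter F} (g : T -> G) x n :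
  g @ F --> x -> (g t ^+ n)%g @[t --> F] --> (x ^+ n)%g.
Proof.
move=> gx; elim: n => [|n IH]; first by rewrite expg0; exact: cvg_cst.
rewrite expgS; under eq_fun do rewrite expgS.
exact: cvg_mulg.
Qed.

Lemma glob_exp_continuous : continuous glob_exp.
Proof.
move=> X; have [N N0 HN] := big_nat (`|X| + 1).
have lt1 : `|X| < N%:R * dl by apply: lt_le_trans HN; rewrite ltrDl.
have Nr0 : (0 : R) < N%:R by rewrite ltr0n.
have near : \forall Y \near X, glob_exp Y = (e (N%:R^-1 *: Y) ^+ N)%g.
  apply/nbhs_addP; exists 1 => // y y1; apply: glob_expE => //.
  apply: le_trans (ler_normD _ _) _; apply: le_trans HN.
  by rewrite lerD2l ltW.
apply: (near_cvg near).
rewrite (glob_expE N0 (ltW lt1)).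
apply: cvg_expgn.
apply: (@cvg_comp _ _ _ (fun Y => N%:R^-1 *: Y) (fun Y => e Y) _
  (nbhs (N%:R^-1 *: X))); first exact: scaler_continuous.
apply: loc_exp_cvg; rewrite normrZ ger0_norm ?invr_ge0 // mulrC ltr_pdivrMr //.
by rewrite mulrC.
Qed.

Lemma glob_exp_small X : `|X| <= dl -> glob_exp X = e X.
Proof.
move=> Xd; have H : `|X| <= 1%:R * dl by rewrite mul1r.
by rewrite (glob_expE (N := 1%N)) // invr1 scale1r expg1.
Qed.

End GlobalExp.

(** * One-parameter subgroups and [lie_exp] *)

Section OneParameter.
Context {R : realType} {E : normedModType R} (G : lieGroup E).
Local Notation ch := (@chart1 R E G).
Local Notation ex := (@point1 R E G).
Local Notation U := (dom (lg_atlas G) 1%g).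
Local Notation h k := ((2^-1 : R) ^+ k).

Lemma half_small (d x : R) : 0 < d -> exists k, h k * x < d.
Proof.
move=> d0; have /cvgrPdist_lt/(_ d d0)[k _ kP] := half_cvg0 x.
exists k; have := kP k (leqnn k); rewrite sub0r normrN mulrC.
by apply: le_lt_trans; exact: ler_norm.
Qed.

Lemma one_parameter0 X (c : R -> G) : one_parameter_subgroup X c -> c 0 = 1%g.
Proof.
by case=> _ ca _; apply: (@mulgI _ (c 0)); rewrite -ca addr0 mulg1.
Qed.

Lemma one_parameter_muln X (c : R -> G) n t : one_parameter_subgroup X c ->
  c (n%:R * t) = (c t ^+ n)%g.
Proof.
move=> cX; have [_ ca _] := cX; elim: n => [|n IH].
  by rewrite mul0r expg0 (one_parameter0 cX).
by rewrite -natr1 mulrDl mul1r ca IH expgSr.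
Qed.

Lemma one_parameter_near X (c : R -> G) (eps : R) : one_parameter_subgroup X c ->
  0 < eps -> exists2 d : R, 0 < d & forall t, `|t| < d ->
    U (c t) /\ `|ch (c t) - t *: X| <= eps * `|t|.
Proof.
move=> cX eps0; have [cc _ cd] := cX; have c0 := one_parameter0 cX.
have [d1 d10 H1] := (is_derive_epsP _ _ _).1 cd eps eps0.
have : nbhs (0 : R^o) (fun t => U (c t)).
  have := cc 0; rewrite /continuous_at c0 => cc0.
  exact: cc0 _ (dom_nbhs (lg_proper G) (dom1 G)).
move=> /nbhs_addP[d2 d20 H2].
exists (Num.min d1 d2); first by rewrite lt_min d10.
move=> t; rewrite lt_min => /andP[t1 t2]; split.
  by have := H2 t t2; rewrite add0r.
by have := H1 t t1; rewrite /= add0r c0.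
Qed.

(** At time 2^-k t the curves differ by o(2^-k), both being tangent to [X]; their 2^k-th powers, the
    values at t, then differ by o(1) through [pow_lip]. Large times are reached by taking powers. *)
Lemma one_parameter_unique X (c c' : R -> G) :
  one_parameter_subgroup X c -> one_parameter_subgroup X c' -> c =1 c'.
Proof.
move=> cX c'X; have [rho [C [rho0 C1 H1 H2 H3]]] := local_group G.
have C0 : 0 < C := lt_le_trans ltr01 C1.
have [d d0 Hd] := one_parameter_near cX ltr01.
have [d' d'0 Hd'] := one_parameter_near c'X ltr01.
pose K := `|X| + 1; have K0 : 0 < K by rewrite ltr_wpDl.
have bK (b : R -> G) t : `|ch (b t) - t *: X| <= 1 * `|t| -> `|ch (b t)| <= K * `|t|.
  rewrite mul1r => H; rewrite -[ch _](subrK (t *: X)).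
  apply: le_trans (ler_normD _ _) _; rewrite normrZ mulrDl mul1r addrC.
  by apply: lerD => //; rewrite mulrC.
pose tau := Num.min (Num.min d d') (rho / (C * K)).
have tau0 : 0 < tau by rewrite !lt_min d0 d'0 divr_gt0 // mulr_gt0.
(* [tau] keeps the whole string of powers up to time t in the ball where [pow_lip] holds. *)
have small t : `|t| < tau -> c t = c' t.
  rewrite !lt_min => /andP[/andP[td td']]; rewrite ltr_pdivlMr ?mulr_gt0 // => tr.
  have [U1 _] := Hd _ td; have [U2 _] := Hd' _ td'.
  rewrite -[LHS](chart1K U1) -[RHS](chart1K U2); congr (ex _).
  apply/eqP; rewrite -subr_eq0 -normr_le0; apply/ler_addgt0Pr => eps eps0.
  rewrite add0r.
  pose eps' := eps / (2 * C * (`|t| + 1)).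
  have eps'0 : 0 < eps' by rewrite divr_gt0 // !mulr_gt0 // ltr_wpDl.
  have [e1 e10 He] := one_parameter_near cX eps'0.
  have [e2 e20 He'] := one_parameter_near c'X eps'0.
  have [k] := @half_small (Num.min e1 e2) `|t| ltac:(by rewrite lt_min e10).
  rewrite lt_min => /andP[ke1 ke2].
  pose s := h k * t.
  have ns : `|s| = h k * `|t| by rewrite normrM ger0_norm // half_ge0.
  have st : `|s| <= `|t| by rewrite ns ler_piMl // half_le1.
  have ts : t = (2 ^ k)%:R * s by rewrite /s mulrA half_pow mul1r.
  have [V1 F1] := Hd _ (le_lt_trans st td); have [V2 F2] := Hd' _ (le_lt_trans st td').
  have kb b : `|ch b| <= K * `|s| -> C * (2 ^ k)%:R * `|ch b| <= rho /\ `|ch b| <= rho.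
    move=> bs; have b1 : C * (2 ^ k)%:R * `|ch b| <= rho.
      apply: le_trans (ltW tr).
      apply: (@le_trans _ _ (C * (2 ^ k)%:R * (K * `|s|))).
        by apply: ler_wpM2l => //; rewrite mulr_ge0 // ltW.
      rewrite ns.
      have -> : C * (2 ^ k)%:R * (K * (h k * `|t|)) = `|t| * (C * K) * ((2 ^ k)%:R * h k).
        by ring.
      by rewrite half_pow mulr1.
    split=> //; apply: le_trans b1; rewrite ler_peMl // mulr_ege1 // ler1n.
    by rewrite expn_gt0.
  have [p1 p2] := kb _ (bK _ _ F1); have [q1 q2] := kb _ (bK _ _ F2).
  have := pow_lip rho0 C1 H1 H2 p1 p2 q1 q2; rewrite !chart1K //.
  rewrite -(one_parameter_muln _ _ cX) -(one_parameter_muln _ _ c'X) -ts.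
  move=> /le_trans; apply.
  have [_ A1] := He s ltac:(by rewrite ns); have [_ A2] := He' s ltac:(by rewrite ns).
  apply: (@le_trans _ _ (C * (2 ^ k)%:R * (2 * (eps' * `|s|)))).
    apply: ler_wpM2l; first by rewrite mulr_ge0 // ltW.
    apply: le_trans (ler_distD (s *: X) _ _) _.
    by rewrite mulr_natl mulr2n; apply: lerD => //; rewrite distrC.
  rewrite ns.
  have -> : C * (2 ^ k)%:R * (2 * (eps' * (h k * `|t|))) =
     2 * C * eps' * `|t| * ((2 ^ k)%:R * h k) by ring.
  rewrite half_pow mulr1 /eps'.
  have -> : 2 * C * (eps / (2 * C * (`|t| + 1))) * `|t| = eps * (`|t| / (`|t| + 1)).
    by field; rewrite !lt0r_neq0 // ltr_wpDl.
  by rewrite ler_piMr ?(ltW eps0) // ler_pdivrMr ?ltr_wpDl // mul1r lerDl.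
move=> t; pose N := (Num.truncn (`|t| / tau)).+1.
have tN : t = N%:R * (N%:R^-1 * t) by rewrite mulrA mulfV ?mul1r // pnatr_eq0.
rewrite tN (one_parameter_muln _ _ cX) (one_parameter_muln _ _ c'X) small //.
rewrite normrM ger0_norm ?invr_ge0 // mulrC ltr_pdivrMr ?ltr0n // mulrC.
by rewrite -ltr_pdivrMr // truncnS_gt.
Qed.

Lemma one_parameter_mdiff X (c : R -> G) :
  one_parameter_subgroup X c <->
  [/\ continuous c, forall s t, c (s + t) = (c s * c t)%g,
      mdiff (vec_atlas R^o) (lg_atlas G) (c : R^o -> G) 0
    & tdiff (vec_atlas R^o) (lg_atlas G) (c : R^o -> G) 0 (1 : R^o) = X].
Proof.
have e (b : R -> G) : (phi (lg_atlas G) 1%g \o (b : R^o -> G)) \o psi (vec_atlas R^o) 0 =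
  phi (lg_atlas G) 1%g \o b by [].
split=> [cX|[cc ca [_ cd] ct]].
  have [cc ca [d1 d2]] := cX; have c0 := one_parameter0 cX.
  have dd : differentiable (phi (lg_atlas G) 1%g \o c : R^o -> E) 0.
    by apply/derivable1_diffP.
  split=> //; first by split; [exact: cc|rewrite c0 e].
  by rewrite /tdiff c0 e -deriveE.
have c0 : c 0 = 1%g by apply: (@mulgI _ (c 0)); rewrite -ca addr0 mulg1.
rewrite c0 e in cd; split=> //; split; first by apply/derivable1_diffP.
by rewrite deriveE // -ct /tdiff c0 e.
Qed.

Hypothesis cplt : geom_complete E.

Lemma exp_map : exists F : E -> G,
  [/\ continuous F, forall X, one_parameter_subgroup X (fun t => F (t *: X))
    & exists d C : R, [/\ 0 < d, 0 < C & forall X, `|X| <= d ->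
        U (F X) /\ `|ch (F X) - X| <= C * `|X| ^+ 2]].
Proof.
have [dl [C [f [dl0 [C0 [[H1 H2 H3 H4 H5] H6]]]]]] := local_exp G cplt.
pose F := glob_exp G dl f.
have Fs X : `|X| <= dl -> F X = ex (f X) by exact: (glob_exp_small dl0 H4).
have Fch X : `|X| <= dl -> U (F X) /\ `|ch (F X) - X| <= C * `|X| ^+ 2.
  by move=> Xd; rewrite Fs //; have [u ->] := H1 _ Xd; split=> //; exact: H3.
have Fc : continuous F by exact: (glob_exp_continuous dl0 C0 H1 H2 H4).
exists F; split=> //; last by exists dl, C.
move=> X; split.
- move=> t; apply: (@cvg_comp _ _ _ (fun t : R => t *: X) F _ (nbhs (t *: X))); last exact: Fc.
  exact: scalel_continuous.
- by move=> s t; exact: (glob_exp_addr dl0 C0 H1 H2 H4 H5 H6).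
apply/is_derive_epsP => eps eps0.
pose D := C * `|X| ^+ 2 + 1.
have D0 : 0 < D by rewrite ltr_wpDl ?mulr_ge0 ?exprn_ge0 ?ltr01 ?(ltW C0).
exists (Num.min (dl / (`|X| + 1)) (eps / D)).
  by rewrite lt_min !divr_gt0 // ltr_wpDl.
have X1 : 0 < `|X| + 1 by rewrite ltr_wpDl.
move=> s; rewrite lt_min !ltr_pdivlMr // => /andP[s1 s2].
rewrite /= add0r scale0r.
have z0 : `|0 : E| <= dl by rewrite normr0 ltW.
have -> : F 0 = 1%g.
  have [_] := Fch _ z0; rewrite subr0 normr0 expr0n mulr0 normr_le0 => /eqP c0.
  by have [u _] := Fch _ z0; rewrite -[LHS](chart1K u) c0 point1_0.
have sX : `|s *: X| <= dl.
  rewrite normrZ; apply: le_trans (ltW s1).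
  by apply: ler_wpM2l => //; rewrite lerDl.
have [_] := Fch _ sX; rewrite /chart1 => /le_trans; apply.
rewrite normrZ.
have -> : C * (`|s| * `|X|) ^+ 2 = `|s| * (`|s| * (C * `|X| ^+ 2)) by ring.
rewrite [leRHS]mulrC; apply: ler_wpM2l => //; apply: le_trans (ltW s2).
by apply: ler_wpM2l => //; rewrite lerDl.
Qed.

(** [lie_exp] chooses a one-parameter subgroup; by uniqueness the choice does not affect the
    value. *)
Lemma lie_exp_unique X (c : R -> G) : one_parameter_subgroup X c ->
  lie_exp G X = c 1.
Proof.
move=> cX; rewrite /lie_exp; case: xgetP => [g -> [c' c'X ->]|H].
  exact: one_parameter_unique c'X cX 1.
by case: (H (c 1)); exists c.
Qed.

Lemma lie_exp_map : [/\ continuous (lie_exp G),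
    forall X, one_parameter_subgroup X (fun t => lie_exp G (t *: X))
    & exists d C : R, [/\ 0 < d, 0 < C & forall X, `|X| <= d ->
        U (lie_exp G X) /\ `|ch (lie_exp G X) - X| <= C * `|X| ^+ 2]].
Proof.
have [F [F1 F2 F3]] := exp_map.
have -> : lie_exp G = F; last by [].
by apply/funext => X; rewrite (lie_exp_unique (F2 X)) scale1r.
Qed.

End OneParameter.

(** * Homomorphisms, translations and the adjoint representation *)

Section Homomorphisms.
Context {R : realType} {E F : normedModType R} (G : lieGroup E) (H : lieGroup F).
Variable f : G -> H.
Hypothesis fM : forall x y, f (x * y)%g = (f x * f y)%g.

Lemma morph1 : f 1%g = 1%g.
Proof. by apply: (@mulgI _ (f 1%g)); rewrite -fM !mulg1. Qed.

Lemma morphV x : f x^-1%g = ((f x)^-1)%g.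
Proof. by apply/esym/mulg1_eq; rewrite -fM mulgV morph1. Qed.

Hypothesis fc : continuous f.
Hypothesis fd : mdiff (lg_atlas G) (lg_atlas H) f 1%g.

Lemma one_parameter_morph X (c : R -> G) : one_parameter_subgroup X c ->
  one_parameter_subgroup (lie_diff f X) (f \o c).
Proof.
move=> cX; have c0 := one_parameter0 cX.
have /one_parameter_mdiff[cc ca cd ct] := cX.
have fd' : mdiff (lg_atlas G) (lg_atlas H) f (c 0) by rewrite c0.
have [d1 d2] := mdiff_comp (vec_atlas_proper R^o) (lg_proper G) cd fd'.
apply/one_parameter_mdiff; split=> //.
- move=> t; apply: (@cvg_comp _ _ _ c f _ (nbhs (c t))); [exact: cc|exact: fc].
- by move=> s t; rewrite /= ca fM.
- by rewrite d2 /= ct c0.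
Qed.

Lemma lie_exp_morph (cE : geom_complete E) X :
  f (lie_exp G X) = lie_exp H (lie_diff f X).
Proof.
have [_ eo _] := lie_exp_map G cE.
by rewrite (lie_exp_unique (one_parameter_morph (eo X))) /= scale1r.
Qed.

End Homomorphisms.

Section TangentMaps.
Context {R : realType}.

Lemma tdiff_linear (T U : topologicalType) (E F : normedModType R)
    (A : atlas T E) (B : atlas U F) (f : T -> U) x : linear (tdiff A B f x).
Proof. by move=> c u v; rewrite /tdiff linearP. Qed.

HB.instance Definition _ (T U : topologicalType) (E F : normedModType R)
    (A : atlas T E) (B : atlas U F) (f : T -> U) x :=
  GRing.isLinear.Build R E F _ (tdiff A B f x) (tdiff_linear A B f x).

Lemma tdiff_continuous (T U : topologicalType) (E F : normedModType R)
    (A : atlas T E) (B : atlas U F) (f : T -> U) x :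
  mdiff A B f x -> continuous (tdiff A B f x).
Proof. by case=> _ df; exact: diff_continuous. Qed.

End TangentMaps.

Section Translations.
Context {R : realType} {E : normedModType R} (G : lieGroup E).
Local Notation A := (lg_atlas G).

Lemma lmul_mdiff (g x : G) : mdiff A A (fun h => g * h)%g x.
Proof.
have [m1 _] := mdiff_cst A A g x.
have [m2 _] := mdiff_id x (lg_proper G).
have [m3 _] := mdiff_pair m1 m2.
exact: (mdiff_comp (lg_proper G) (prod_atlas_proper (lg_proper G) (lg_proper G))
  m3 (mulg_mdiff (g, x))).1.
Qed.

Lemma rmul_mdiff (g x : G) : mdiff A A (fun h => h * g)%g x.
Proof.
have [m1 _] := mdiff_cst A A g x.
have [m2 _] := mdiff_id x (lg_proper G).
have [m3 _] := mdiff_pair m2 m1.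
exact: (mdiff_comp (lg_proper G) (prod_atlas_proper (lg_proper G) (lg_proper G))
  m3 (mulg_mdiff (x, g))).1.
Qed.

Definition conj_by (g h : G) : G := (g * h * g^-1)%g.

Lemma conj_by1 g : conj_by g 1%g = 1%g.
Proof. by rewrite /conj_by mulg1 mulgV. Qed.

Lemma conj_byM g x y : conj_by g (x * y)%g = (conj_by g x * conj_by g y)%g.
Proof. by rewrite /conj_by !mulgA mulgVK. Qed.

Lemma conj_by_mdiff g x : mdiff A A (conj_by g) x.
Proof.
exact: (mdiff_comp (lg_proper G) (lg_proper G) (lmul_mdiff g x)
  (rmul_mdiff g^-1%g (g * x)%g)).1.
Qed.

Lemma conj_by_continuous g : continuous (conj_by g).
Proof. by move=> x; exact: (conj_by_mdiff g x).1. Qed.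

Lemma AdE (g : G) : Ad g = tdiff A A (conj_by g) 1%g.
Proof. by []. Qed.

Lemma Ad_linear (g : G) : linear (Ad g).
Proof. exact: tdiff_linear. Qed.

Lemma Ad_continuous (g : G) : continuous (Ad g).
Proof. exact: tdiff_continuous (conj_by_mdiff g 1%g). Qed.

Lemma AdM (g h : G) X : Ad (g * h)%g X = Ad g (Ad h X).
Proof.
have m := conj_by_mdiff g (conj_by h 1%g).
have [_] := mdiff_comp (lg_proper G) (lg_proper G) (conj_by_mdiff h 1%g) m.
rewrite conj_by1 -!AdE => e.
rewrite -[RHS]/((Ad g \o Ad h) X) -e; congr (tdiff A A _ 1%g X); apply/funext => x.
by rewrite /= /conj_by invgM !mulgA.
Qed.

Lemma Ad1 X : Ad (1%g : G) X = X.
Proof.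
have [_ e] := mdiff_id (1%g : G) (lg_proper G).
rewrite -[RHS]/(id X) -e; congr (tdiff A A _ 1%g X); apply/funext => x.
by rewrite mul1g invg1 mulg1.
Qed.

Lemma AdVK (g : G) X : Ad g^-1%g (Ad g X) = X.
Proof. by rewrite -AdM mulVg Ad1. Qed.

Lemma AdKV (g : G) X : Ad g (Ad g^-1%g X) = X.
Proof. by rewrite -AdM mulgV Ad1. Qed.

Lemma AdD (g : G) X Y : Ad g (X + Y) = Ad g X + Ad g Y.
Proof. by rewrite !AdE linearD. Qed.
Lemma AdB (g : G) X Y : Ad g (X - Y) = Ad g X - Ad g Y.
Proof. by rewrite !AdE linearB. Qed.
Lemma AdZ (g : G) c X : Ad g (c *: X) = c *: Ad g X.
Proof. by rewrite !AdE linearZ. Qed.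
Lemma Ad0 (g : G) : Ad g 0 = 0.
Proof. by rewrite !AdE linear0. Qed.

End Translations.

Section AdNaturality.
Context {R : realType} {E F : normedModType R} (G : lieGroup E) (H : lieGroup F).
Variable f : G -> H.
Hypothesis fM : forall x y, f (x * y)%g = (f x * f y)%g.
Hypothesis fd : mdiff (lg_atlas G) (lg_atlas H) f 1%g.

Lemma lie_diff_Ad g X : lie_diff f (Ad g X) = Ad (f g) (lie_diff f X).
Proof.
have f1 : f 1%g = 1%g := morph1 fM.
have m1 : mdiff (lg_atlas G) (lg_atlas H) f (conj_by g 1%g) by rewrite conj_by1.
have [_ e1] := mdiff_comp (lg_proper G) (lg_proper G) (conj_by_mdiff g 1%g) m1.
have m2 : mdiff (lg_atlas H) (lg_atlas H) (conj_by (f g)) (f 1%g).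
  exact: conj_by_mdiff.
have [_ e2] := mdiff_comp (lg_proper G) (lg_proper H) fd m2.
have e : f \o conj_by g = conj_by (f g) \o f.
  by apply/funext => x; rewrite /= /conj_by !fM (morphV fM).
have := congr1 (fun k => k X) e1; have := congr1 (fun k => k X) e2.
rewrite e conj_by1 /= f1 => -> E1.
by rewrite /lie_diff !AdE -E1.
Qed.

Lemma lie_diff_eps (eps : R) : 0 < eps -> exists2 d : R, 0 < d &
  forall w, `|w| < d ->
    `|chart1 (f (point1 G w)) - lie_diff f w| <= eps * `|w|.
Proof.
move=> eps0; have [_ df] := fd; have [d d0 Hd] := diff_eps df eps0.
exists d => // w /Hd.
rewrite /= phiK; [|exact: lg_proper|exact: dom1].
by rewrite /chart1 /point1 /lie_diff /tdiff (morph1 fM).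
Qed.

End AdNaturality.

(** * Lipschitz estimates for Ad near the identity *)

Section AdEstimates.
Context {R : realType} {E : normedModType R} (G : lieGroup E).
Local Notation ch := (@chart1 R E G).
Local Notation ex := (@point1 R E G).
Local Notation U := (dom (lg_atlas G) 1%g).
Local Notation h k := ((2^-1 : R) ^+ k).

Lemma invg_small (eps : R) : 0 < eps -> exists2 d : R, 0 < d & forall v, `|v| < d ->
  U (ex v)^-1%g /\ `|ch (ex v)^-1%g| < eps.
Proof.
move=> eps0.
have c1 : (ex v)^-1%g @[v --> (0 : E)] --> (1%g : G).
  by rewrite -[X in _ --> X]invg1; apply: cvg_invg; exact: point1_cvg0.
have c2 : ch (ex v)^-1%g @[v --> (0 : E)] --> (0 : E).
  apply: (@cvg_comp _ _ _ (fun v => (ex v)^-1%g) ch _ (nbhs (1%g : G))) => //.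
  by have := chart1_cvg (dom1 G); rewrite chart1_1.
have /nbhs_addP[d1 d10 H1] := c1 _ (dom_nbhs (lg_proper G) (dom1 G)).
have /cvgrPdist_lt/(_ _ eps0)/nbhs_addP[d2 d20 H2] := c2.
exists (Num.min d1 d2); first by rewrite lt_min d10.
move=> v; rewrite lt_min => /andP[/H1 v1 /H2]; move: v1.
by rewrite !add0r normrN.
Qed.

(* A derivative bound that holds in the limit is homogeneous, hence global. *)
Lemma small_bound_global (F : normedModType R) (L : E -> F) (c : R) :
  (forall t w, L (t *: w) = t *: L w) ->
  (forall eps : R, 0 < eps -> exists2 d : R, 0 < d & forall w, `|w| < d ->
     `|L w| <= (c + eps) * `|w|) ->
  forall w, `|L w| <= c * `|w|.
Proof.
move=> LZ H w; apply/ler_addgt0Pr => eps eps0.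
have [d d0 Hd] := H (eps / (`|w| + 1)) ltac:(by rewrite divr_gt0 // ltr_wpDl).
have [k] := half_small `|w| d0.
rewrite -[h k]ger0_norm ?half_ge0 // -normrZ => /Hd.
rewrite LZ !normrZ ger0_norm ?half_ge0 // mulrCA ler_pM2l ?half_gt0 //.
move=> /le_trans; apply; rewrite mulrDl lerD2l mulrAC -mulrA.
rewrite ler_piMr ?ltW // ltr_pdivrMr ?ltr_wpDl // mul1r ltrDl.
by [].
Qed.

(** The products vx and xv have the same first-order part, so their coordinates differ by O(|v||x|).
    Multiplying both by v^-1 on the right compares the conjugate of x with x, and letting x tend to
    0 gives the bound on the derivative. *)
Lemma Ad_near1 : exists r K : R, [/\ 0 < r, 0 < K & forall v w, `|v| <= r ->
  `|Ad (ex v) w - w| <= K * `|v| * `|w|].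
Proof.
have [rho [C [rho0 C1 H1 H2 H3]]] := local_group G.
have C0 : 0 < C := lt_le_trans ltr01 C1.
have [d1 d10 Hd1] := invg_small rho0.
pose r := Num.min (d1 / 2) (rho / (2 * C)).
have r0 : 0 < r by rewrite lt_min !divr_gt0 // mulr_gt0.
have rrho : r <= rho / (2 * C) by rewrite ge_min lexx orbT.
have rho2 : rho / (2 * C) <= rho / 2.
  by rewrite ler_pM2l // lef_pV2 ?posrE // ?mulr_gt0 // ler_peMr.
have rho21 : rho / 2 <= rho by rewrite ler_pdivrMr // ler_peMr ?ler1n // ltW.
have CrC : C * (rho / (2 * C)) = rho / 2 by field; rewrite lt0r_neq0.
exists r, (C * (2 * C)); split=> //; first by rewrite !mulr_gt0.
move=> v w vr.
have v1 : `|v| <= rho by apply: le_trans (le_trans vr rrho) (le_trans rho2 rho21).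
have [dV cV] : U (ex v)^-1%g /\ `|ch (ex v)^-1%g| < rho.
  apply: Hd1; apply: le_lt_trans vr _; rewrite gt_min.
  by rewrite ltr_pdivrMr // ltr_pMr // ltr1n.
set v' := ch (ex v)^-1%g in cV.
have exv' : ex v' = (ex v)^-1%g by rewrite chart1K.
pose L (x : E) := Ad (ex v) x - x.
rewrite -/(L w); apply: small_bound_global => [t x|eps eps0].
  by rewrite /L AdZ scalerBr.
have [d d0 Hd] := lie_diff_eps (@conj_byM _ _ G (ex v)) (conj_by_mdiff (ex v) 1%g) eps0.
exists (Num.min d (rho / (2 * C))); first by rewrite lt_min d0 divr_gt0 // mulr_gt0.
move=> x; rewrite lt_min => /andP[xd /ltW xr].
have x1 : `|x| <= rho by apply: le_trans xr (le_trans rho2 rho21).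
have Hx := Hd x xd.
have [d2 c2] := mul_step rho0 H1 H2 v1 x1; have [d3 c3] := mul_step rho0 H1 H2 x1 v1.
have q2 := H3 _ _ v1 x1; have q3 := H3 _ _ x1 v1.
have sm (a b y : E) : `|a| <= rho / (2 * C) -> `|b| <= rho / (2 * C) ->
    `|y - a| <= C * `|b| -> `|y| <= rho.
  move=> a1 b1 y1; rewrite -[y](subrK a); apply: le_trans (ler_normD _ _) _.
  rewrite [leRHS]splitr; apply: lerD; last exact: le_trans a1 rho2.
  by apply: le_trans y1 _; rewrite -CrC ler_pM2l.
have v2 := le_trans vr rrho.
have z0 : `|0 : E| <= rho by rewrite normr0 ltW.
have [_] := H2 0 (ch (ex v * ex x)%g) (ch (ex x * ex v)%g) v' z0
  (sm _ _ _ v2 xr c2) (sm _ _ _ xr v2 c3) (ltW cV).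
rewrite point1_0 !mul1g !chart1K // mulgK (H1 x x1).2 -/(conj_by (ex v) (ex x)) => key.
have comm : `|ch (ex v * ex x)%g - ch (ex x * ex v)%g| <= 2 * C * `|v| * `|x|.
  have e (a b c y : E) : a - b = (a - c - y) - (b - y - c).
    by rewrite [b - y - c]addrAC opprB addrA subrK opprB addrA subrK.
  rewrite (e _ _ v x); apply: le_trans (ler_normB _ _) _; apply: le_trans (lerD q2 q3) _.
  by rewrite le_eqVlt; apply/orP; left; apply/eqP; ring.
have -> : L x = (ch (conj_by (ex v) (ex x)) - x) -
    (ch (conj_by (ex v) (ex x)) - lie_diff (conj_by (ex v)) x).
  by rewrite opprB addrC addrA subrK.
apply: le_trans (ler_normB _ _) _; rewrite mulrDl; apply: lerD => //.
apply: le_trans key _; rewrite -!mulrA ler_pM2l // !mulrA.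
by [].
Qed.

(** Ad(u) - Ad(v) = Ad(v) (Ad(v^-1 u) - 1), where v^-1 u has a coordinate of order |u - v|. *)
Lemma Ad_lip : exists r K : R, [/\ 0 < r, 0 < K & forall u v w,
  `|u| <= r -> `|v| <= r ->
  `|Ad (ex u) w - Ad (ex v) w| <= K * `|u - v| * `|w|].
Proof.
have [rho [C [rho0 C1 H1 H2 H3]]] := local_group G.
have C0 : 0 < C := lt_le_trans ltr01 C1.
have [r1 [K [r10 K0 HK]]] := Ad_near1.
have [d1 d10 Hd1] := invg_small rho0.
pose r := Num.min (Num.min r1 (d1 / 2)) (Num.min rho (r1 / (2 * C))).
have r0 : 0 < r by rewrite !lt_min !divr_gt0 ?mulr_gt0 // r10 rho0.
have [ra [rb [rc rd]]] : r <= r1 /\ r <= d1 / 2 /\ r <= rho /\ r <= r1 / (2 * C).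
  by rewrite /r !ge_min !lexx ?orbT.
exists r, ((K * r1 + 1) * (K * C)); split=> //.
  by rewrite !mulr_gt0 // addr_gt0 // mulr_gt0.
move=> u v w ur vr.
have ur' := le_trans ur rc; have vr' := le_trans vr rc.
have [dV cV] : U (ex v)^-1%g /\ `|ch (ex v)^-1%g| < rho.
  apply: Hd1; apply: le_lt_trans (le_trans vr rb) _.
  by rewrite ltr_pdivrMr // ltr_pMr // ltr1n.
have z0 : `|0 : E| <= rho by rewrite normr0 ltW.
have [dz] := H2 (ch (ex v)^-1%g) u v 0 (ltW cV) ur' vr' z0.
move: dz; rewrite point1_0 !mulg1 !chart1K // mulVg chart1_1 subr0 => dz cz.
set z := ch _ in cz.
have exz : ex z = ((ex v)^-1 * ex u)%g by rewrite /z chart1K.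
have zr : `|z| <= r1.
  apply: le_trans cz _; rewrite mulrC -ler_pdivlMr //.
  apply: le_trans (ler_normB _ _) _.
  apply: le_trans (lerD (le_trans ur rd) (le_trans vr rd)) _.
  by rewrite le_eqVlt; apply/orP; left; apply/eqP; field; rewrite lt0r_neq0.
have -> : Ad (ex u) w - Ad (ex v) w = Ad (ex v) (Ad (ex z) w - w).
  by rewrite AdB exz -AdM mulgA mulgV mul1g.
have bd y : `|Ad (ex v) y| <= (K * r1 + 1) * `|y|.
  rewrite -[Ad _ _](subrK y) mulrDl mul1r; apply: le_trans (ler_normD _ _) _.
  rewrite lerD2r; apply: le_trans (HK _ _ (le_trans vr ra)) _.
  by rewrite ler_wpM2r // ler_pM2l // (le_trans vr ra).
apply: le_trans (bd _) _; rewrite -!mulrA ler_pM2l ?addr_gt0 ?mulr_gt0 //.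
apply: le_trans (HK _ _ zr) _; rewrite -!mulrA ler_pM2l //.
by rewrite mulrA ler_wpM2r.
Qed.

End AdEstimates.

(** * Linear parts of almost additive maps *)

Section AlmostAdditive.
Context {R : realType}.
Implicit Types E F : normedModType R.
Local Notation h k := ((2^-1 : R) ^+ k).

Lemma norm_lim_le_near E (u : nat -> E) (l : E) (c : R) :
  u @ \oo --> l -> (\forall k \near \oo, `|u k| <= c) -> `|l| <= c.
Proof.
move=> ul uc; have nl : (fun k => `|u k|) @ \oo --> `|l| by apply: cvg_norm.
by have := limr_le (cvgP _ nl); rewrite (cvg_lim _ nl) //; apply.
Qed.

Lemma half_near (d x : R) : 0 < d -> \forall k \near \oo, h k * x <= d.
Proof.
move=> d0; have /cvgrPdist_le/(_ d d0) := @half_cvg0 R x.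
apply: filterS => k; rewrite sub0r normrN mulrC.
by apply: le_trans; exact: ler_norm.
Qed.

(** Cauchy's functional equation: homogeneity holds for integers, then for dyadic numbers, and the
    bound extends it to all reals. *)
Lemma additive_bounded_homogeneous E F (f : E -> F) (K : R) :
  (forall x y, f (x + y) = f x + f y) -> (forall x, `|f x| <= K * `|x|) ->
  forall t x, f (t *: x) = t *: f x.
Proof.
move=> fD fK.
have f0 : f 0 = 0 by apply: (@addrI _ (f 0)); rewrite -fD !addr0.
have fN x : f (- x) = - f x.
  by apply: (@addrI _ (f x)); rewrite -fD !subrr.
have fn n x : f (n%:R *: x) = n%:R *: f x.
  elim: n => [|n IH]; first by rewrite !scale0r.
  by rewrite -natr1 !scalerDl !scale1r fD IH.
have fpos t x : 0 <= t -> f (t *: x) = t *: f x.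
  move=> t0; apply/eqP; rewrite -subr_eq0 -normr_le0.
  apply: (half_le0 (c := K * `|x| + `|f x|)) => k.
  set n := Num.truncn (t * 2 ^+ k); set s := n%:R * h k.
  have st : `|t - s| <= h k.
    have sle : s <= t.
      by rewrite /s exprVn ler_pdivrMr ?exprn_gt0 // truncn_le mulr_ge0 // exprn_ge0.
    rewrite ger0_norm ?subr_ge0 // lerBlDl /s.
    rewrite -[X in _ + X]mul1r -mulrDl exprVn ler_pdivlMr ?exprn_gt0 //.
    by rewrite natr1 ltW // truncnS_gt.
  have fs : f (s *: x) = s *: f x.
    have fh y : f (h k *: y) = h k *: f y.
      have -> : f y = (2 ^ k)%:R *: f (h k *: y).
        by rewrite -fn scalerA half_pow scale1r.
      by rewrite scalerA mulrC half_pow scale1r.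
    by rewrite /s mulrC -scalerA fh fn scalerA.
  have -> : f (t *: x) - t *: f x = f ((t - s) *: x) - (t - s) *: f x.
    by rewrite !scalerBl fD fN fs opprB addrA subrK.
  apply: le_trans (ler_normB _ _) _; rewrite mulrDl; apply: lerD.
    apply: le_trans (fK _) _; rewrite normrZ mulrCA [leRHS]mulrC.
    apply: ler_wpM2r => //; have := fK x; exact: le_trans.
  by rewrite normrZ mulrC; apply: ler_wpM2l.
move=> t x; have [/fpos //|t0] := leP 0 t.
have -> : t *: x = - ((- t) *: x) by rewrite scaleNr opprK.
by rewrite fN fpos ?oppr_ge0 ?ltW // scaleNr opprK.
Qed.

(** [D X] is the limit of 2^k B(2^-k X). The quadratic defect of additivity makes successive terms
    differ by O(2^-k) and disappears in the limit. *)
Lemma almost_additive_linear E F (B : E -> F) (r K Q : R) : geom_complete F ->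
  0 < r -> 0 <= Q ->
  (forall X, `|X| <= r -> `|B X| <= K * `|X|) ->
  (forall X Y, `|X| <= r -> `|Y| <= r ->
     `|B (X + Y) - B X - B Y| <= Q * (`|X| * `|Y|)) ->
  exists D : E -> F, [/\ linear D, forall X, `|D X| <= K * `|X|
    & forall X, `|X| <= r -> `|B X - D X| <= 2 * Q * `|X| ^+ 2].
Proof.
move=> cF r0 Q0 BK BQ.
pose u (X : E) k := (2 ^ k)%:R *: B (h k *: X).
have normh (X : E) k : `|h k *: X| = h k * `|X| by rewrite normrZ ger0_norm // half_ge0.
have hr (X : E) k : `|X| <= r -> `|h k *: X| <= r.
  by move=> Xr; rewrite normh; apply: le_trans Xr; rewrite ler_piMl // half_le1.
have ustep (X : E) k : `|X| <= r -> `|u X k.+1 - u X k| <= Q * `|X| ^+ 2 * h k.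
  move=> Xr; have := BQ _ _ (hr X k.+1 Xr) (hr X k.+1 Xr).
  have -> : h k.+1 *: X + h k.+1 *: X = h k *: X.
    by rewrite -scalerDl; congr (_ *: X); rewrite exprS; field.
  rewrite -addrA -opprD distrC => H.
  have -> : u X k.+1 - u X k = (2 ^ k)%:R *:
      (B (h k.+1 *: X) + B (h k.+1 *: X) - B (h k *: X)).
    by rewrite /u scalerBr expnSr natrM -scalerA [2%:R *: _]scaler_nat mulr2n.
  rewrite normrZ normr_nat; apply: le_trans (ler_wpM2l _ H) _ => //.
  rewrite normh exprS.
  have -> : (2 ^ k)%:R * (Q * (2^-1 * h k * `|X| * (2^-1 * h k * `|X|))) =
     Q * `|X| ^+ 2 * h k * ((2 ^ k)%:R * h k) * 4^-1 by field.
  rewrite half_pow mulr1 ler_piMr ?invf_le1 ?ler1n //.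
  by rewrite !mulr_ge0 // ?exprn_ge0 // half_ge0.
have ucvg X : cvgn (u X).
  have [N] := half_small `|X| r0; rewrite -normh => /ltW XN.
  have c1 : cvgn (u (h N *: X)) by apply: cF => k; exact: ustep.
  have c2 : (fun k => (2 ^ N)%:R *: u (h N *: X) k) @ \oo -->
      (2 ^ N)%:R *: lim (u (h N *: X) @ \oo).
    apply: (@cvg_comp _ _ _ (u (h N *: X)) (fun y => (2 ^ N)%:R *: y) _
      (nbhs (lim (u (h N *: X) @ \oo)))) => //.
    exact: scaler_continuous.
  apply/cvg_ex; exists ((2 ^ N)%:R *: lim (u (h N *: X) @ \oo)).
  rewrite -(cvg_shiftn N).
  have -> : [sequence u X (n + N)%N]_n = (fun k => (2 ^ N)%:R *: u (h N *: X) k).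
    by apply/funext => k; rewrite /u !scalerA -exprD -natrM -expnD [(N + k)%N]addnC.
  exact: c2.
pose D X := lim (u X @ \oo).
have DK X : `|D X| <= K * `|X|.
  apply: (norm_lim_le_near (ucvg X)).
  apply: filterS (@half_near r `|X| r0) => k Xk.
  rewrite -normh in Xk; rewrite normrZ normr_nat.
  apply: le_trans (ler_wpM2l _ (BK _ Xk)) _ => //.
  by rewrite normh mulrCA [_%:R * _]mulrA half_pow mul1r.
have DD X Y : D (X + Y) = D X + D Y.
  apply/eqP; rewrite -subr_eq0 opprD addrA -normr_le0.
  apply: (half_le0 (c := Q * (`|X| * `|Y|))) => j.
  apply: (norm_lim_le_near (seq_cvgB (seq_cvgB (ucvg (X + Y)) (ucvg X)) (ucvg Y))).
  near=> k.
  have jk : (j <= k)%N by near: k; exact: nbhs_infty_ge.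
  have Xk : `|h k *: X| <= r by rewrite normh; near: k; exact: half_near.
  have Yk : `|h k *: Y| <= r by rewrite normh; near: k; exact: half_near.
  rewrite /u -!scalerBr [_ *: (X + Y)]scalerDr normrZ normr_nat.
  apply: le_trans (ler_wpM2l _ (BQ _ _ Xk Yk)) _ => //.
  rewrite !normh.
  have -> : (2 ^ k)%:R * (Q * (h k * `|X| * (h k * `|Y|))) =
    Q * (`|X| * `|Y|) * h k * ((2 ^ k)%:R * h k) by ring.
  rewrite half_pow mulr1; apply: ler_wpM2l; first by rewrite !mulr_ge0.
  by apply: ler_wiXn2l => //; rewrite ?invr_ge0 // invf_le1 // ler1n.
exists D; split=> //.
  have DZ := additive_bounded_homogeneous DD DK.
  by move=> t X Y; rewrite DD DZ.
move=> X Xr; rewrite distrC.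
have c0 : (fun _ : nat => B X) @ \oo --> B X by exact: cvg_cst.
apply: (norm_lim_le (seq_cvgB (ucvg X) c0)) => k.
have -> : B X = u X 0%N by rewrite /u expn0 expr0 !scale1r.
rewrite -(telescope_sumr (u X) (leq0n k)).
apply: le_trans (ler_norm_sum _ _ _) _.
apply: (@le_trans _ _ (\sum_(0 <= i < k) Q * `|X| ^+ 2 * h i)).
  by apply: ler_sum => i _; exact: ustep.
rewrite -mulr_sumr.
have -> : 2 * Q * `|X| ^+ 2 = Q * `|X| ^+ 2 * 2 by ring.
apply: ler_wpM2l; first by rewrite mulr_ge0 // exprn_ge0.
exact: half_sum_le.
Unshelve. all: by end_near.
Qed.

End AlmostAdditive.

(** * The bracket as the derivative of Ad *)

Section BracketCalculus.
Context {R : realType} {E : normedModType R} (G : lieGroup E).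
Hypothesis cplt : geom_complete E.
Local Notation ch := (@chart1 R E G).
Local Notation ex := (@point1 R E G).
Local Notation U := (dom (lg_atlas G) 1%g).
Local Notation h k := ((2^-1 : R) ^+ k).
Local Notation "[ X , Y ]" := (bracket G X Y).

(** The map X |-> Ad(ex X) w - w is almost additive, because ex X ex Y = ex z with z = X + Y +
    O(|X||Y|) and Ad is multiplicative. Its linear part has a quadratic remainder, hence is the
    derivative that defines the bracket; all constants are uniform in [w]. *)
Lemma bracket_taylor : exists r K Q : R, [/\ 0 < r, 0 < K, 0 < Q,
    forall w, linear (fun X => [X, w])
  & (forall X w, `|[X, w]| <= K * `|X| * `|w|) /\
    forall X w, `|X| <= r ->
      `|Ad (ex X) w - w - [X, w]| <= Q * `|X| ^+ 2 * `|w|].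
Proof.
have [rho [C [rho0 C1 H1 H2 H3]]] := local_group G.
have C0 : 0 < C := lt_le_trans ltr01 C1.
have [r1 [K [r10 K0 HK]]] := Ad_near1 G.
have [r2 [K2 [r20 K20 HK2]]] := Ad_lip G.
pose r := Num.min (Num.min r1 rho) (r2 / (2 * C)).
have r0 : 0 < r by rewrite !lt_min r10 rho0 divr_gt0 // mulr_gt0.
have [ra [rb rc]] : r <= r1 /\ r <= rho /\ r <= r2 / (2 * C).
  by rewrite /r !ge_min !lexx ?orbT.
have rC : 2 * C * r <= r2 by rewrite mulrC -ler_pdivlMr // mulr_gt0.
have r2C : r <= 2 * C * r.
  by rewrite ler_peMl ?(ltW r0) // mulr_ege1 // ler1n.
pose Q := K2 * C + K * K.
have Q0 : 0 < Q by rewrite addr_gt0 // mulr_gt0.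
have main w : exists D : E -> E, [/\ linear D,
    forall X, `|D X| <= K * `|w| * `|X|
    & forall X, `|X| <= r ->
        `|(Ad (ex X) w - w) - D X| <= 2 * (Q * `|w|) * `|X| ^+ 2].
  apply: (almost_additive_linear cplt r0) => [|X Xr|X Y Xr Yr].
  - by rewrite mulr_ge0 // ltW.
  - by rewrite mulrAC; apply: HK; exact: le_trans ra.
  have Xrho := le_trans Xr rb; have Yrho := le_trans Yr rb.
  have [dz cz] := mul_step rho0 H1 H2 Xrho Yrho.
  have qz := H3 _ _ Xrho Yrho; set z := ch _ in cz qz.
  have zr : `|z| <= r2.
    rewrite -[z](subrK X); apply: le_trans (ler_normD _ _) _.
    apply: le_trans (lerD cz Xr) _; apply: le_trans rC.
    have -> : 2 * C * r = C * r + C * r by ring.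
    by apply: lerD; [rewrite ler_pM2l|rewrite ler_peMl // ltW].
  have XYr : `|X + Y| <= r2.
    apply: le_trans (ler_normD _ _) _; apply: le_trans (lerD Xr Yr) _.
    apply: le_trans rC; have -> : 2 * C * r = C * r + C * r by ring.
    by apply: lerD; rewrite ler_peMl // ltW.
  have e1 : Ad (ex (X + Y)) w - w - (Ad (ex X) w - w) - (Ad (ex Y) w - w) =
     (Ad (ex (X + Y)) w - Ad (ex z) w) + (Ad (ex X) (Ad (ex Y) w - w) - (Ad (ex Y) w - w)).
    rewrite [Ad (ex X) (_ - _)]AdB /z chart1K // AdM.
    set a := Ad _ _; set b := Ad (ex X) (Ad _ _); set c := Ad (ex X) w; set d := Ad (ex Y) w.
    by rewrite addrA [in RHS](addrA (a - b)) subrK opprB (addrA (a - w)) subrK.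
  rewrite e1; apply: le_trans (ler_normD _ _) _.
  have -> : Q * `|w| * (`|X| * `|Y|) = K2 * (C * (`|X| * `|Y|)) * `|w| +
     K * `|X| * (K * `|Y| * `|w|) by rewrite /Q; ring.
  apply: lerD.
    apply: le_trans (HK2 _ _ _ XYr zr) _; apply: ler_wpM2r => //.
    rewrite ler_pM2l //; apply: le_trans qz.
    by rewrite distrC opprD addrA.
  apply: le_trans (HK _ _ (le_trans Xr ra)) _.
  apply: ler_wpM2l; first by rewrite mulr_ge0 // ltW.
  exact: HK (le_trans Yr ra).
have brE w D : linear D -> (forall X, `|D X| <= K * `|w| * `|X|) ->
    (forall X, `|X| <= r ->
        `|(Ad (ex X) w - w) - D X| <= 2 * (Q * `|w|) * `|X| ^+ 2) ->
    forall X, [X, w] = D X.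
  move=> DL DK DQ X.
  pose L : {linear E -> E} := HB.pack D (GRing.isLinear.Build _ _ _ _ _ DL).
  have cL : continuous L.
    apply: bounded_linear_continuous; apply/linear_boundedP.
    apply: filterS (nbhs_pinfty_ge (num_real (K * `|w|))) => c Kc x.
    by apply: le_trans (DK x) _; apply: ler_wpM2r.
  pose f v := Ad (psi (lg_atlas G) 1%g v) w.
  have fo : f (phi (lg_atlas G) 1%g 1%g) = w.
    by rewrite /f phiK ?Ad1 //; [exact: lg_proper|exact: dom1].
  have [df de] : differentiable f (phi (lg_atlas G) 1%g 1%g) /\
      'd f (phi (lg_atlas G) 1%g 1%g) = L :> (E -> E).
    apply: differentiable_eps => // eps eps0.
    pose c := 2 * (Q * `|w|) + 1.
    have c0 : 0 < c by rewrite ltr_wpDl // !mulr_ge0 // ltW.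
    exists (Num.min r (eps / c)); first by rewrite lt_min r0 divr_gt0.
    move=> v; rewrite lt_min => /andP[/ltW vr ve].
    rewrite fo -[f _]/(Ad (ex v) w); apply: le_trans (DQ v vr) _.
    rewrite expr2 [leLHS]mulrA; apply: ler_wpM2r => //.
    apply: (@le_trans _ _ (c * `|v|)); first by rewrite ler_wpM2r // lerDl.
    by rewrite mulrC -ler_pdivlMr // ltW.
  by rewrite /bracket -/f deriveE // de.
exists r, K, (2 * Q); split=> //; first by rewrite mulr_gt0.
  move=> w; have [D [DL DK DQ]] := main w.
  by move=> t X Y; rewrite !(brE w D DL DK DQ) DL.
split=> [X w|X w Xr]; have [D [DL DK DQ]] := main w; rewrite (brE w D DL DK DQ).
  by rewrite mulrAC; exact: DK.
by have := DQ X Xr; rewrite mulrA mulrAC.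
Qed.

Lemma bracketDl X X' w : [X + X', w] = [X, w] + [X', w].
Proof.
have [r [K [Q [_ _ _ L _]]]] := bracket_taylor.
by have := L w 1 X X'; rewrite !scale1r.
Qed.

Lemma bracket0l w : [0, w] = 0.
Proof. by apply: (@addrI _ [0, w]); rewrite -bracketDl !addr0. Qed.

Lemma bracketZl t X w : [t *: X, w] = t *: [X, w].
Proof.
have [r [K [Q [_ _ _ L _]]]] := bracket_taylor.
by have := L w t X 0; rewrite bracket0l !addr0.
Qed.

Lemma bracketNl X w : [- X, w] = - [X, w].
Proof. by rewrite -scaleN1r bracketZl scaleN1r. Qed.

Lemma bracketBl X X' w : [X - X', w] = [X, w] - [X', w].
Proof. by rewrite bracketDl bracketNl. Qed.

Lemma bracket_bound : exists2 K : R, 0 < K & forall X w, `|[X, w]| <= K * `|X| * `|w|.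
Proof. by have [r [K [Q [_ K0 _ _ [B _]]]]] := bracket_taylor; exists K. Qed.

(** Sequences that approach the identity with velocity [Z] at the scale 2^-k. By [tangent_Ad] any of
    them computes the bracket with [Z], so each identity is proved along a convenient one: chart
    points, a one-parameter subgroup, or the image under a homomorphism. *)
Definition tangent_seq (g : nat -> G) (Z : E) :=
  (\forall k \near \oo, U (g k)) /\ (fun k => (2 ^ k)%:R *: ch (g k)) @ \oo --> Z.

Lemma tangent_small (g : nat -> G) Z (d : R) : tangent_seq g Z -> 0 < d ->
  \forall k \near \oo, [/\ U (g k), `|ch (g k)| <= d
    & `|ch (g k)| <= h k * (`|Z| + 1)].
Proof.
move=> [gU gZ] d0.
have /cvgrPdist_le/(_ 1 ltr01) H := gZ.
near=> k.
have e : `|ch (g k)| = h k * `|(2 ^ k)%:R *: ch (g k)|.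
  by rewrite normrZ normr_nat mulrA [h k * _]mulrC half_pow mul1r.
have b : `|ch (g k)| <= h k * (`|Z| + 1).
  rewrite e; apply: ler_wpM2l; first exact: half_ge0.
  rewrite -[_ *: ch _](subKr Z); apply: le_trans (ler_normB _ _) _.
  by rewrite lerD2l; near: k.
split=> //; first by near: k.
by apply: le_trans b _; near: k; exact: half_near.
Unshelve. all: by end_near.
Qed.

Lemma squeeze_cvg (F : normedModType R) (u : nat -> F) (l : F) (b : nat -> R) :
  (\forall k \near \oo, `|l - u k| <= b k) -> b @ \oo --> 0 -> u @ \oo --> l.
Proof.
move=> H /cvgrPdist_le b0; apply/cvgrPdist_le => e e0.
have := b0 e e0; apply: filterS2 H => k lb.
rewrite sub0r normrN => be; apply: le_trans lb _.
exact: le_trans (ler_norm _) be.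
Qed.

Lemma tangent_Ad (g : nat -> G) Z w : tangent_seq g Z ->
  (fun k => (2 ^ k)%:R *: (Ad (g k) w - w)) @ \oo --> [Z, w].
Proof.
move=> gZ; have [r [K [Q [r0 K0 Q0 L [B T]]]]] := bracket_taylor.
pose b k := K * `|w| * `|Z - (2 ^ k)%:R *: ch (g k)| +
   Q * (`|Z| + 1) ^+ 2 * `|w| * h k.
apply: (squeeze_cvg (b := b)).
  apply: filterS (tangent_small gZ r0) => k [Uk kr kh].
  set z := ch (g k) in kr kh.
  have -> : Ad (g k) w - w = Ad (ex z) w - w by rewrite /z chart1K.
  rewrite -[[Z, w]](subrK [(2 ^ k)%:R *: z, w]) -addrA.
  apply: le_trans (ler_normD _ _) _; apply: lerD.
    by rewrite -bracketBl; apply: le_trans (B _ _) _; rewrite mulrAC.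
  rewrite bracketZl -scalerBr normrZ normr_nat distrC.
  apply: le_trans (ler_wpM2l _ (T _ w kr)) _ => //.
  apply: (@le_trans _ _ ((2 ^ k)%:R * (Q * (h k * (`|Z| + 1)) ^+ 2 * `|w|))).
    apply: ler_wpM2l => //; apply: ler_wpM2r => //; rewrite ler_pM2l //.
    by apply: lerXn2r => //; rewrite nnegrE // mulr_ge0 ?half_ge0 // addr_ge0.
  have -> : (2 ^ k)%:R * (Q * (h k * (`|Z| + 1)) ^+ 2 * `|w|) =
     Q * (`|Z| + 1) ^+ 2 * `|w| * h k * ((2 ^ k)%:R * h k) by ring.
  by rewrite half_pow mulr1.
rewrite -[X in _ --> X]addr0; apply: cvgD; last exact: half_cvg0.
rewrite -[X in _ --> X](mulr0 (K * `|w|)); apply: cvgMr.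
apply/norm_cvg0P; rewrite -(subrr Z).
by apply: seq_cvgB; [exact: cvg_cst|exact: gZ.2].
Qed.

Arguments tangent_Ad {g Z} w _.

Lemma tangent_point Z : tangent_seq (fun k => ex (h k *: Z)) Z.
Proof.
have [rho [C [rho0 C1 H1 H2 H3]]] := local_group G.
have near : \forall k \near \oo, `|h k *: Z| <= rho.
  apply: filterS (@half_near R rho `|Z| rho0) => k.
  by rewrite normrZ ger0_norm // half_ge0.
split; first by apply: filterS near => k /H1 [].
apply: cvg_near_cst; apply: filterS near => k /H1 [_ ->].
by rewrite scalerA half_pow scale1r.
Qed.

Lemma tangent_one_parameter Z (c : R -> G) : one_parameter_subgroup Z c ->
  tangent_seq (fun k => c (h k)) Z.
Proof.
move=> cZ.
have hk (d : R) : 0 < d -> \forall k \near \oo, `|h k : R| < d.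
  move=> d0; have d20 : 0 < d / 2 by rewrite divr_gt0.
  apply: filterS (@half_near R _ 1 d20) => k.
  rewrite mulr1 ger0_norm ?half_ge0 // => /le_lt_trans; apply.
  by rewrite ltr_pdivrMr // ltr_pMr // ltr1n.
split.
  have [d d0 Hd] := one_parameter_near cZ ltr01.
  by apply: filterS (hk d d0) => k /Hd [].
apply/cvgrPdist_le => e e0.
have [d d0 Hd] := one_parameter_near cZ e0.
apply: filterS (hk d d0) => k /Hd [_].
rewrite ger0_norm ?half_ge0 // => H.
have -> : Z = (2 ^ k)%:R *: (h k *: Z) by rewrite scalerA half_pow scale1r.
rewrite -scalerBr normrZ normr_nat distrC.
apply: le_trans (ler_wpM2l _ H) _ => //.
by rewrite mulrCA half_pow mulr1.
Qed.

Lemma bracketDr X w w' : [X, w + w'] = [X, w] + [X, w'].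
Proof.
apply: (cvg_unique _ (tangent_Ad (w + w') (tangent_point X))) => //.
have -> : (fun k => (2 ^ k)%:R *: (Ad (ex (h k *: X)) (w + w') - (w + w'))) =
  (fun k => (2 ^ k)%:R *: (Ad (ex (h k *: X)) w - w)) +
  (fun k => (2 ^ k)%:R *: (Ad (ex (h k *: X)) w' - w')).
  by apply/funext => k; rewrite !fctE AdD opprD addrACA scalerDr.
by apply: cvgD; apply: tangent_Ad; exact: tangent_point.
Qed.

Lemma bracketZr t X w : [X, t *: w] = t *: [X, w].
Proof.
apply: (cvg_unique _ (tangent_Ad (t *: w) (tangent_point X))) => //.
have -> : (fun k => (2 ^ k)%:R *: (Ad (ex (h k *: X)) (t *: w) - t *: w)) =
  (fun k => t *: ((2 ^ k)%:R *: (Ad (ex (h k *: X)) w - w))).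
  by apply/funext => k; rewrite AdZ -scalerBr !scalerA mulrC.
apply: (@cvg_comp _ _ _ (fun k => (2 ^ k)%:R *: (Ad (ex (h k *: X)) w - w))
  (fun y => t *: y) _ (nbhs [X, w])); last exact: scaler_continuous.
by apply: tangent_Ad; exact: tangent_point.
Qed.

Lemma bracketNr X w : [X, - w] = - [X, w].
Proof. by rewrite -scaleN1r bracketZr scaleN1r. Qed.

Lemma bracketBr X w w' : [X, w - w'] = [X, w] - [X, w'].
Proof. by rewrite bracketDr bracketNr. Qed.

Lemma bracket0r X : [X, 0] = 0.
Proof. by have := bracketZr 0 X 0; rewrite !scale0r. Qed.

Lemma bracketXX X : [X, X] = 0.
Proof.
have [_ eo _] := lie_exp_map G cplt.
have oX := eo X; have [_ ca _] := oX.
(* Conjugation by exp(sX) fixes every exp(tX), so it fixes the velocity [X] of that curve. *)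
have fix_ s : Ad (lie_exp G (s *: X)) X = X.
  set g := lie_exp G (s *: X).
  have gX := one_parameter_morph (@conj_byM _ _ G g) (@conj_by_continuous _ _ G g)
    (conj_by_mdiff g 1%g) oX.
  have e : conj_by g \o (fun t => lie_exp G (t *: X)) = (fun t => lie_exp G (t *: X)).
    by apply/funext => t; rewrite /= /conj_by /g -ca addrC ca mulgK.
  rewrite e in gX; have [_ _ [_ d1]] := gX; have [_ _ [_ d2]] := oX.
  by rewrite -[Ad g X]/(lie_diff (conj_by g) X) -d1.
apply: (cvg_unique _ (tangent_Ad X (tangent_one_parameter oX))) => //.
have -> : (fun k => (2 ^ k)%:R *: (Ad (lie_exp G (h k *: X)) X - X)) = fun=> 0.
  by apply/funext => k; rewrite fix_ subrr scaler0.
exact: cvg_cst.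
Qed.

Lemma bracketC X Y : [X, Y] = - [Y, X].
Proof.
have := bracketXX (X + Y).
rewrite bracketDl !bracketDr !bracketXX addr0 add0r => /eqP.
by rewrite addr_eq0 => /eqP.
Qed.

End BracketCalculus.
Arguments tangent_Ad {R E G} cplt {g Z} w _.

Section BracketMorphism.
Context {R : realType} {E F : normedModType R} (G : lieGroup E) (H : lieGroup F).
Variable f : G -> H.
Hypothesis fM : forall x y, f (x * y)%g = (f x * f y)%g.
Hypothesis fd : mdiff (lg_atlas G) (lg_atlas H) f 1%g.

Lemma tangent_morph (g : nat -> G) Z : tangent_seq g Z ->
  tangent_seq (f \o g) (lie_diff f Z).
Proof.
move=> gZ; have [gU gc] := gZ.
have g1 : g @ \oo --> (1%g : G).
  have z0 : (fun k => chart1 (g k)) @ \oo --> (0 : E).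
    have e : (fun k => ((2^-1 : R) ^+ k) *: ((2 ^ k)%:R *: chart1 (g k))) =
        (fun k => chart1 (g k)).
      by apply/funext => k; rewrite scalerA mulrC half_pow scale1r.
    apply: (squeeze_cvg (b := fun k => (`|Z| + 1) * (2^-1 : R) ^+ k)).
      apply: filterS (tangent_small gZ ltr01) => k [_ _].
      by rewrite sub0r normrN mulrC.
    exact: half_cvg0.
  apply: (near_cvg (g := fun k => point1 G (chart1 (g k)))).
    by apply: filterS gU => k Uk; rewrite chart1K.
  apply: (@cvg_comp _ _ _ (fun k => chart1 (g k)) (point1 G) _ (nbhs (0 : E))) => //.
  exact: point1_cvg0.
have f1 : f 1%g = 1%g := morph1 fM.
split.
  have : (f \o g) @ \oo --> (1%g : H).
    rewrite -f1; apply: (@cvg_comp _ _ _ g f _ (nbhs (1%g : G))) => //.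
    exact: fd.1.
  by move=> /(_ _ (dom_nbhs (lg_proper H) (dom1 H))).
have LZ : (fun k => lie_diff f ((2 ^ k)%:R *: chart1 (g k))) @ \oo --> lie_diff f Z.
  apply: (@cvg_comp _ _ _ (fun k => (2 ^ k)%:R *: chart1 (g k)) (lie_diff f) _ (nbhs Z)) => //.
  exact: tdiff_continuous fd Z.
apply/cvgrPdist_le => e e0.
have e20 : 0 < e / 2 by rewrite divr_gt0.
have c0 : 0 < e / 2 / (`|Z| + 1) by rewrite !divr_gt0 // ltr_wpDl.
have [d d0 Hd] := lie_diff_eps fM fd c0.
have d20 : 0 < d / 2 by rewrite divr_gt0.
have /cvgrPdist_le/(_ _ e20) := LZ.
apply: filterS2 (tangent_small gZ d20) => k [Uk kd kh] Lk.
have kd' : `|chart1 (g k)| < d.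
  by apply: le_lt_trans kd _; rewrite ltr_pdivrMr // ltr_pMr // ltr1n.
have := Hd _ kd'; rewrite chart1K // => Hk.
apply: le_trans (ler_distD (lie_diff f ((2 ^ k)%:R *: chart1 (g k))) _ _) _.
rewrite [leRHS]splitr; apply: lerD => //.
have -> : lie_diff f ((2 ^ k)%:R *: chart1 (g k)) =
    (2 ^ k)%:R *: lie_diff f (chart1 (g k)) by rewrite /lie_diff linearZ.
rewrite -scalerBr normrZ normr_nat distrC /=.
apply: le_trans (ler_wpM2l _ Hk) _ => //.
apply: (@le_trans _ _ ((2 ^ k)%:R * (e / 2 / (`|Z| + 1) * ((2^-1 : R) ^+ k * (`|Z| + 1))))).
  by apply: ler_wpM2l => //; apply: ler_wpM2l => //; exact: ltW.
have -> : (2 ^ k)%:R * (e / 2 / (`|Z| + 1) * ((2^-1 : R) ^+ k * (`|Z| + 1))) =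
  e / 2 * ((2 ^ k)%:R * (2^-1 : R) ^+ k) by field; rewrite lt0r_neq0 // ltr_wpDl.
by rewrite half_pow mulr1.
Qed.

End BracketMorphism.

(** * Invariance of the bracket under Ad and the Jacobi identity *)

Section BracketIdentities.
Context {R : realType} {E : normedModType R} (G : lieGroup E).
Hypothesis cplt : geom_complete E.
Local Notation ch := (@chart1 R E G).
Local Notation ex := (@point1 R E G).
Local Notation h k := ((2^-1 : R) ^+ k).
Local Notation "[ X , Y ]" := (bracket G X Y).

(** Conjugating a sequence of velocity [X] by [g] gives one of velocity Ad(g) X, and Ad of the
    conjugates is the conjugate of Ad. *)
Lemma bracket_Ad (g : G) X Y : Ad g [X, Y] = [Ad g X, Ad g Y].
Proof.
have tX := tangent_morph (@conj_byM _ _ G g) (conj_by_mdiff g 1%g) (tangent_point G X).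
apply/esym; apply: (cvg_unique _ (tangent_Ad cplt (Ad g Y) tX)) => //.
have -> : (fun k => (2 ^ k)%:R *: (Ad ((conj_by g \o (fun k => ex (h k *: X))) k)
    (Ad g Y) - Ad g Y)) =
  Ad g \o (fun k => (2 ^ k)%:R *: (Ad (ex (h k *: X)) Y - Y)).
  apply/funext => k; rewrite /= AdZ AdB; congr (_ *: (_ - _)).
  by rewrite /conj_by !AdM AdVK.
apply: (@cvg_comp _ _ _ (fun k => (2 ^ k)%:R *: (Ad (ex (h k *: X)) Y - Y)) (Ad g) _
  (nbhs [X, Y])); last exact: Ad_continuous.
by apply: tangent_Ad => //; exact: tangent_point.
Qed.

(** The product rule for Ad(g)[X, Y] = [Ad(g) X, Ad(g) Y] along a sequence [g] of velocity [Z]. *)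
Lemma bracket_jacobi X Y Z : [Z, [X, Y]] = [[Z, X], Y] + [X, [Z, Y]].
Proof.
have tZ := tangent_point G Z.
have cX := tangent_Ad cplt X tZ; have cY := tangent_Ad cplt Y tZ.
apply: (cvg_unique _ (tangent_Ad cplt [X, Y] tZ)) => //.
pose a k := (2 ^ k)%:R *: (Ad (ex (h k *: Z)) X - X).
pose b k := (2 ^ k)%:R *: (Ad (ex (h k *: Z)) Y - Y).
have -> : (fun k => (2 ^ k)%:R *: (Ad (ex (h k *: Z)) [X, Y] - [X, Y])) =
   (fun k => [a k, Y + h k *: b k]) + (fun k => [X, b k]).
  apply/funext => k; rewrite !fctE bracket_Ad /a /b scalerA [h k * _]mulrC half_pow scale1r.
  rewrite (addrC Y) subrK bracketZl // bracketZr // -scalerDr; congr (_ *: _).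
  by rewrite bracketBl // bracketBr // addrA subrK.
have [K K0 BK] := bracket_bound G cplt.
apply: cvgD.
  have b0 : (fun k => h k *: b k) @ \oo --> (0 : E).
    apply: (squeeze_cvg (b := fun k => (`|[Z, Y]| + 1) * h k)); last exact: half_cvg0.
    have /cvgrPdist_le/(_ 1 ltr01) := cY; apply: filterS => k bk.
    rewrite sub0r normrN normrZ ger0_norm ?half_ge0 // mulrC.
    apply: ler_wpM2r; first exact: half_ge0.
    rewrite -[b k](subKr [Z, Y]); apply: le_trans (ler_normB _ _) _.
    by rewrite lerD2l.
  pose c k := K * `|[Z, X] - a k| * (`|Y| + 1) + K * `|[Z, X]| * `|h k *: b k|.
  apply: (squeeze_cvg (b := c)).
    have /cvgrPdist_le/(_ 1 ltr01) := b0; apply: filterS => k.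
    rewrite sub0r normrN => bk.
    have -> : [[Z, X], Y] - [a k, Y + h k *: b k] =
      [[Z, X] - a k, Y + h k *: b k] - [[Z, X], h k *: b k].
      by rewrite bracketBl // [in RHS]bracketDr // addrAC addrK.
    apply: le_trans (ler_normB _ _) _; apply: lerD; last exact: BK.
    apply: le_trans (BK _ _) _; apply: ler_wpM2l; first by rewrite mulr_ge0 // ltW.
    by apply: le_trans (ler_normD _ _) _; rewrite lerD2l.
  rewrite -[X in _ --> X]addr0; apply: cvgD.
    rewrite -[X in _ --> X](mul0r (`|Y| + 1)); apply: cvgMl.
    rewrite -[X in _ --> X](mulr0 K); apply: cvgMr.
    apply/norm_cvg0P; rewrite -(subrr [Z, X]).
    by apply: seq_cvgB; [exact: cvg_cst|exact: cX].
  rewrite -[X in _ --> X](mulr0 (K * `|[Z, X]|)); apply: cvgMr.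
  by apply/norm_cvg0P.
pose c k := K * `|X| * `|[Z, Y] - b k|.
apply: (squeeze_cvg (b := c)).
  by apply: nearW => k; rewrite -bracketBr //; exact: BK.
rewrite -[X in _ --> X](mulr0 (K * `|X|)); apply: cvgMr.
apply/norm_cvg0P; rewrite -(subrr [Z, Y]).
by apply: seq_cvgB; [exact: cvg_cst|exact: cY].
Qed.

End BracketIdentities.

(** * Matrices of linear maps and the Killing form *)

Section LinearMaps.
Context {R : realType} {n : nat}.
Local Notation V := 'rV[R]_n.

Lemma mul_lin1 m (f : V -> 'rV[R]_m) u : linear f -> u *m lin1_mx f = f u.
Proof.
move=> fl.
pose F : {linear V -> 'rV[R]_m} := HB.pack f (GRing.isLinear.Build _ _ _ _ _ fl).
exact: (mul_rV_lin1 F u).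
Qed.

Lemma linear_add (m : lmodType R) (f : V -> m) u v : linear f -> f (u + v) = f u + f v.
Proof. by move=> fl; have := fl 1 u v; rewrite !scale1r. Qed.

Lemma linear_zero (m : lmodType R) (f : V -> m) : linear f -> f 0 = 0.
Proof.
move=> fl; have := linear_add 0 0 fl; rewrite addr0 => e.
by apply: (@addrI _ (f 0)); rewrite addr0 -e.
Qed.

Lemma linear_scale (m : lmodType R) (f : V -> m) c u : linear f -> f (c *: u) = c *: f u.
Proof. by move=> fl; have := fl c u 0; rewrite (linear_zero fl) !addr0. Qed.

Lemma linear_opp (m : lmodType R) (f : V -> m) u : linear f -> f (- u) = - f u.
Proof. by move=> fl; rewrite -[- u]scaleN1r (linear_scale _ _ fl) scaleN1r. Qed.

Lemma linear_sub (m : lmodType R) (f : V -> m) u v : linear f -> f (u - v) = f u - f v.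
Proof. by move=> fl; rewrite (linear_add _ _ fl) (linear_opp _ fl). Qed.

Lemma lin1_comp (f g : V -> V) : linear f -> linear g ->
  lin1_mx (f \o g) = lin1_mx g *m lin1_mx f.
Proof.
move=> fl gl.
have fgl : linear (f \o g) by move=> c u v; rewrite /= gl fl.
apply/row_matrixP => i; rewrite !rowE mulmxA !mul_lin1 //.
Qed.

Lemma lin1_inj (f g : V -> V) : linear f -> linear g ->
  (lin1_mx f = lin1_mx g) -> f =1 g.
Proof. by move=> fl gl e u; rewrite -!mul_lin1 // e. Qed.

(* A nondegenerate bilinear form represents every linear form. *)
Lemma bilinear_represent (b : V -> V -> R) (lam : V -> R) :
  (forall Y, linear (b ^~ Y : V -> R^o)) -> (forall X, linear (b X : V -> R^o)) ->
  (forall X, (forall Y, b X Y = 0) -> X = 0) ->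
  linear (lam : V -> R^o) -> exists Z, forall Y, b Z Y = lam Y.
Proof.
move=> bl br nd lamL.
pose B : 'M[R]_n := \matrix_(i, j) b (delta_mx 0 i) (delta_mx 0 j).
have expand (f : V -> R^o) Y : linear f -> f Y = \sum_j Y 0 j * f (delta_mx 0 j).
  move=> fl; rewrite {1}[Y]row_sum_delta.
  elim/big_rec2: _ => [|j y1 y2 _ <-]; first exact: linear_zero.
  by rewrite fl.
have BE X Y : b X Y = \sum_j (X *m B) 0 j * Y 0 j.
  rewrite (expand _ Y (br X)); apply: eq_bigr => j _; rewrite mulrC; congr (_ * _).
  rewrite (expand (b ^~ (delta_mx 0 j)) X (bl _)) mxE.
  by apply: eq_bigr => i _; rewrite !mxE.
have Bu : B \in unitmx.
  rewrite -row_free_unit -kermx_eq0; apply/eqP/row_matrixP => i; rewrite row0.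
  apply: nd => Y; rewrite BE (_ : row i (kermx B) *m B = 0) //.
    by apply: big1 => j _; rewrite mxE mul0r.
  by rewrite -row_mul mulmx_ker row0.
exists ((\row_j lam (delta_mx 0 j)) *m invmx B) => Y.
rewrite BE mulmxKV // (expand lam Y lamL).
by apply: eq_bigr => j _; rewrite mxE mulrC.
Qed.

End LinearMaps.

(** The algebra is carried out for an abstract bracket on row vectors; for [bracket G] the form
    [kform] is [killing]. Matrices act from the right, so composites of maps become products in
    reverse order. *)
Definition lie_bracket (R : realType) (n : nat)
    (br : 'rV[R]_n -> 'rV[R]_n -> 'rV[R]_n) :=
  [/\ forall Y, linear (br ^~ Y), forall X, linear (br X), forall X, br X X = 0
    & forall X Y Z, br Z (br X Y) = br (br Z X) Y + br X (br Z Y)].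

Definition kform (R : realType) (n : nat)
    (br : 'rV[R]_n -> 'rV[R]_n -> 'rV[R]_n) (X Y : 'rV[R]_n) : R :=
  \tr (lin1_mx (br X \o br Y)).

Section Killing.
Context {R : realType} {n : nat}.
Local Notation V := 'rV[R]_n.
Variable br : V -> V -> V.
Hypothesis br_lie : lie_bracket br.
Local Notation "[ X , Y ]" := (br X Y).
Local Notation B := (kform br).

Lemma brDl X Y Z : [X + Y, Z] = [X, Z] + [Y, Z].
Proof. by case: br_lie => L _ _ _; exact: linear_add (L Z). Qed.
Lemma brDr X Y Z : [X, Y + Z] = [X, Y] + [X, Z].
Proof. by case: br_lie => _ L _ _; exact: linear_add (L X). Qed.
Lemma brZl c X Y : [c *: X, Y] = c *: [X, Y].
Proof. by case: br_lie => L _ _ _; exact: linear_scale (L Y). Qed.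
Lemma brZr c X Y : [X, c *: Y] = c *: [X, Y].
Proof. by case: br_lie => _ L _ _; exact: linear_scale (L X). Qed.
Lemma brNl X Y : [- X, Y] = - [X, Y].
Proof. by case: br_lie => L _ _ _; exact: linear_opp (L Y). Qed.
Lemma brNr X Y : [X, - Y] = - [X, Y].
Proof. by case: br_lie => _ L _ _; exact: linear_opp (L X). Qed.
Lemma brBl X Y Z : [X - Y, Z] = [X, Z] - [Y, Z].
Proof. by rewrite brDl brNl. Qed.
Lemma brBr X Y Z : [X, Y - Z] = [X, Y] - [X, Z].
Proof. by rewrite brDr brNr. Qed.
Lemma br0l X : [0, X] = 0.
Proof. by case: br_lie => L _ _ _; exact: linear_zero (L X). Qed.
Lemma br0r X : [X, 0] = 0.
Proof. by case: br_lie => _ L _ _; exact: linear_zero (L X). Qed.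
Lemma brXX X : [X, X] = 0. Proof. by case: br_lie. Qed.
Lemma brC X Y : [X, Y] = - [Y, X].
Proof.
have := brXX (X + Y); rewrite brDl !brDr !brXX addr0 add0r => /eqP.
by rewrite addr_eq0 => /eqP.
Qed.
Lemma brJ X Y Z : [Z, [X, Y]] = [[Z, X], Y] + [X, [Z, Y]].
Proof. by case: br_lie. Qed.

Lemma br_linear X : linear (br X). Proof. by case: br_lie. Qed.

Definition adm X : 'M[R]_n := lin1_mx (br X).

Lemma mul_adm u X : u *m adm X = [X, u].
Proof. exact: mul_lin1 (br_linear X). Qed.

Lemma kformE X Y : B X Y = \tr (adm Y *m adm X).
Proof. by rewrite /kform lin1_comp //; exact: br_linear. Qed.

Lemma kformC X Y : B X Y = B Y X.
Proof. by rewrite (kformE X Y) (kformE Y X); exact: mxtrace_mulC. Qed.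

Lemma adm_linear : linear adm.
Proof.
move=> c X Y; apply/row_matrixP => i.
by rewrite !rowE mulmxDr -scalemxAr !mul_adm brDl brZl.
Qed.

Lemma kform_linear_l Y : linear (B ^~ Y : V -> R^o).
Proof.
move=> c X X'; rewrite !kformE adm_linear mulmxDr -scalemxAr mxtraceD mxtraceZ.
by [].
Qed.

Lemma kform_linear_r X : linear (B X : V -> R^o).
Proof. by move=> c Y Y'; rewrite ![B X _]kformC kform_linear_l. Qed.

Definition automorphism (A : 'M[R]_n) :=
  A \in unitmx /\ forall U W, [U, W] *m A = [U *m A, W *m A].

Lemma kform_automorphism (A : 'M[R]_n) X Y : automorphism A ->
  B (X *m A) (Y *m A) = B X Y.
Proof.
move=> [uA hA].
have adA Z : adm (Z *m A) = invmx A *m adm Z *m A.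
  apply/row_matrixP => i; rewrite !rowE !mulmxA mul_adm.
  set u := delta_mx _ _; rewrite -{1}[u](mulmxKV uA u) -hA.
  by rewrite -mul_adm.
rewrite !kformE !adA.
have -> : invmx A *m adm Y *m A *m (invmx A *m adm X *m A) =
    invmx A *m (adm Y *m adm X *m A) by rewrite !mulmxA mulmxK.
by rewrite mxtrace_mulC mulmxK.
Qed.

Lemma adm_bracket W T : adm [W, T] = adm T *m adm W - adm W *m adm T.
Proof.
apply/row_matrixP => i; rewrite !rowE mulmxBr !mulmxA !mul_adm.
by rewrite brJ addrK.
Qed.

Lemma kform_bracket Z X Y : B [Z, X] Y = - B X [Z, Y].
Proof.
have trB (P Q : 'M[R]_n) : \tr (P - Q) = \tr P - \tr Q by rewrite raddfB.
rewrite !kformE !adm_bracket mulmxBr mulmxBl !trB opprB !mulmxA; congr (_ - _).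
by rewrite mxtrace_mulC mulmxA.
Qed.

End Killing.

(** * Compactness in finite dimension and symmetric eigenvectors *)

Lemma closed_preimage (T U : topologicalType) (f : T -> U) (D : set U) :
  continuous f -> closed D -> closed (f @^-1` D).
Proof. by move=> /continuous_closedP; apply. Qed.

Section FiniteDimension.
Context {R : realType} {n : nat}.
Local Notation V := 'rV[R]_n.

Lemma linear_continuous_rV (F : normedModType R) (f : V -> F) :
  linear f -> continuous f.
Proof.
move=> fl.
pose L : {linear V -> F} := HB.pack f (GRing.isLinear.Build _ _ _ _ _ fl).
have -> : f = L by [].
apply: bounded_linear_continuous; apply/linear_boundedP.
pose K := \sum_j `|f (delta_mx 0 j)|.
apply: filterS (nbhs_pinfty_ge (num_real K)) => c Kc X.
apply: (@le_trans _ _ (K * `|X|)); last exact: ler_wpM2r.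
rewrite {1}[X]row_sum_delta linear_sum; apply: le_trans (ler_norm_sum _ _ _) _.
rewrite mulr_suml; apply: ler_sum => j _.
by rewrite linearZ normrZ mulrC; apply: ler_wpM2l => //; exact: coord_norm_le.
Qed.

Lemma quadratic_continuous (b : V -> V -> R) :
  (forall X, linear (b X : V -> R^o)) -> (forall Y, linear (b ^~ Y : V -> R^o)) ->
  continuous (fun X => b X X).
Proof.
move=> br bl.
have e : (fun X => b X X) = (fun X => \sum_j X 0 j * b (delta_mx 0 j) X).
  apply/funext => X; rewrite {1}[X in b X]row_sum_delta.
  elim/big_rec2: _ => [|j y1 y2 _ <-]; first exact: (linear_zero (bl X)).
  by rewrite bl.
rewrite e; apply: (continuous_big (op := +%R) (U := R^o)) => [|j _].
  exact: add_continuous.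
move=> X; apply: continuousM; first exact: (@coord_continuous R 1 n 0 j X).
exact: (linear_continuous_rV (F := R^o) (br _)).
Qed.

(** The constant is the minimum of [q] on the compact unit sphere, when there is a nonzero vector at
    all. *)
Lemma sphere_bound (q : V -> R) (d : nat) : continuous q ->
  (forall X, X != 0 -> 0 < q X) -> (forall t X, q (t *: X) = `|t| ^+ d.+1 * q X) ->
  exists2 c : R, 0 < c & forall X, c * `|X| ^+ d.+1 <= q X.
Proof.
move=> qc qpos qZ.
have q0 : q 0 = 0 by rewrite -(scale0r 0) qZ normr0 expr0n mul0r.
have [[X0 X00]|H] := pselect (exists X : V, X != 0); last first.
  exists 1 => // X; have -> : X = 0.
    by apply/eqP; apply/negPn/negP => X0; apply: H; exists X.
  by rewrite normr0 expr0n mulr0 q0.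
pose S := [set X : V | `|X| = 1].
have nc : continuous (fun X : V => `|X|) by move=> X; exact: norm_continuous.
have cS : compact S.
  apply: bounded_closed_compact.
    by exists 1; split; rewrite ?num_real // => x x1 X /= ->; exact: ltW.
  have -> : S = (fun X : V => `|X|) @^-1` [set 1] by [].
  by apply: closed_preimage; [exact: nc|exact: closed_eq].
have S0 : S !=set0.
  exists (`|X0|^-1 *: X0); rewrite /S /= normrZ normfV normr_id mulVf //.
  by rewrite normr_eq0.
have [Y YS Ymin] := EVT_min_rV S0 cS (continuous_subspaceT qc).
rewrite inE /S /= in YS.
have Y0 : Y != 0 by rewrite -normr_eq0 YS oner_eq0.
exists (q Y); first exact: qpos.
move=> X; have [->|X1] := eqVneq X 0; first by rewrite normr0 expr0n mulr0 q0.
have nX : 0 < `|X| by rewrite normr_gt0.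
have e : X = `|X| *: (`|X|^-1 *: X) by rewrite scalerA mulfV ?scale1r // lt0r_neq0.
rewrite {2}e qZ normr_id mulrC; apply: ler_wpM2l; first by rewrite exprn_ge0.
apply: Ymin; rewrite inE /S /= normrZ normfV normr_id mulVf // lt0r_neq0 //.
Qed.

Lemma vspace_closed (W : {vspace V}) : closed [set X | X \in W].
Proof.
have -> : [set X | X \in W] = (fun X => X - projv W X) @^-1` [set 0].
  apply/seteqP; split=> X /=; first by move=> XW; rewrite projv_id ?subrr.
  by move=> /eqP; rewrite subr_eq0 => /eqP ->; exact: memv_proj.
apply: closed_preimage; last exact: (compact_closed (@norm_hausdorff _ _) (@compact_set1 _ _)).
apply: linear_continuous_rV => c X Y.
by rewrite linearP scalerBr opprD addrACA.
Qed.

End FiniteDimension.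

Section Rayleigh.
Context {R : realType} {n : nat}.
Local Notation V := 'rV[R]_n.
Variable ip : V -> V -> R.
Hypothesis ipr : forall X, linear (ip X : V -> R^o).
Hypothesis ipC : forall X Y, ip X Y = ip Y X.
Hypothesis ip_gt0 : forall X, X != 0 -> 0 < ip X X.

Let ipl Y : linear (ip ^~ Y : V -> R^o).
Proof. by move=> c X X'; rewrite ![ip _ Y]ipC ipr. Qed.

Lemma ip_bound : exists2 c : R, 0 < c & forall X, c * `|X| ^+ 2 <= ip X X.
Proof.
apply: (@sphere_bound _ _ (fun X => ip X X) 1) => //.
  exact: quadratic_continuous.
move=> t X; rewrite (linear_scale t X (ipr _)) (linear_scale t X (ipl _)).
by rewrite -normrX ger0_norm ?sqr_ge0 // expr2 -mulrA.
Qed.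

(* Maximise the Rayleigh quotient. *)
Lemma symmetric_eigenvector (S : V -> V) (W : {vspace V}) : linear S ->
  (forall X Y, ip (S X) Y = ip X (S Y)) -> (forall X, X \in W -> S X \in W) ->
  W != 0%VS -> exists l X, [/\ X \in W, X != 0 & S X = l *: X].
Proof.
move=> Sl Ss SW W0; have [c c0 Hc] := ip_bound.
pose T := [set X | X \in W] `&` [set X | ip X X = 1].
have bl2 X : linear (fun Y => ip (S X) Y : R^o) by exact: ipr.
have cf : continuous (fun X => ip (S X) X).
  apply: (quadratic_continuous (b := fun X Y => ip (S X) Y)) => // Y t X X'.
  by rewrite Sl ipl.
have cT : compact T.
  apply: bounded_closed_compact.
    exists (1 + c^-1); split; first by rewrite num_real.
    move=> x x1 X [_ /= X1]; apply: ltW; apply: le_lt_trans x1.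
    have := Hc X; rewrite X1 mulrC -ler_pdivlMr // div1r => X2.
    have [X3|X3] := leP `|X| 1; first by rewrite (le_trans X3) // lerDl invr_ge0 ltW.
    apply: (@le_trans _ _ (`|X| ^+ 2)); first by rewrite expr2 ler_peMl // ltW.
    by apply: le_trans X2 _; rewrite lerDr.
  apply: closedI; first exact: vspace_closed.
  have -> : [set X | ip X X = 1] = (fun X => ip X X) @^-1` [set 1] by [].
  by apply: closed_preimage; [exact: quadratic_continuous|exact: closed_eq].
have w0 : vpick W != 0 by rewrite vpick0.
have T0 : T !=set0.
  pose s := (Num.sqrt (ip (vpick W) (vpick W)))^-1.
  exists (s *: vpick W); split=> /=; first by rewrite memvZ // memv_pick.
  rewrite (linear_scale s _ (ipr _)) (linear_scale s _ (ipl _)) -[LHS]/(s * (s * _)) mulrA -expr2 exprVn.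
  by rewrite sqr_sqrtr ?ltW ?ip_gt0 // mulVf // lt0r_neq0 // ip_gt0.
have [X XT Xmax] := EVT_max_rV T0 cT (continuous_subspaceT cf).
rewrite inE in XT; have [/= XW X1] := XT.
have X0 : X != 0.
  apply/eqP => X0; have := X1; rewrite X0 (linear_zero (ipr _)) => /eqP.
  by rewrite eq_sym oner_eq0.
pose l := ip (S X) X; exists l, X; split=> //.
have pos Y : Y \in W -> ip (S Y) Y <= l * ip Y Y.
  move=> YW; have [->|Y0] := eqVneq Y 0.
    by rewrite !(linear_zero (ipr _)) mulr0.
  have iY : 0 < ip Y Y := ip_gt0 Y0.
  pose s := (Num.sqrt (ip Y Y))^-1.
  have s2 : s ^+ 2 * ip Y Y = 1.
    by rewrite exprVn sqr_sqrtr ?ltW // mulVf // lt0r_neq0.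
  have YT : T (s *: Y).
    split=> /=; first by rewrite memvZ.
    by rewrite (linear_scale s _ (ipr _)) (linear_scale s _ (ipl _)) -[LHS]/(s * (s * _)) mulrA -expr2.
  have := Xmax (s *: Y) ltac:(by rewrite inE).
  rewrite (linear_scale s _ Sl) (linear_scale s _ (ipr _)) (linear_scale s _ (ipl _)).
  rewrite -[X in X <= _]/(s * (s * _)) mulrA -expr2 -/l => H.
  have sp : 0 < s ^+ 2 by rewrite exprn_gt0 // invr_gt0 sqrtr_gt0.
  by rewrite -(ler_pM2l sp) mulrCA s2 mulr1.
have orth Y : Y \in W -> ip (S X - l *: X) Y = 0.
  move=> YW.
  have exp_ t : ip (S (X + t *: Y)) (X + t *: Y) =
      l + 2 * t * ip (S X) Y + t ^+ 2 * ip (S Y) Y.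
    rewrite (linear_add _ _ Sl) (linear_scale _ _ Sl).
    rewrite !(linear_add _ _ (ipr _)) !(linear_add _ _ (ipl _)).
    rewrite !(linear_scale _ _ (ipr _)) !(linear_scale _ _ (ipl _)).
    have -> : ip (S Y) X = ip (S X) Y by rewrite Ss ipC.
    rewrite -/l; set A := ip (S X) Y; set D := ip (S Y) Y.
    rewrite -[t *: A]/(t * A) -[t *: (t *: D)]/(t * (t * D)); ring.
  have exp2_ t : ip (X + t *: Y) (X + t *: Y) = 1 + 2 * t * ip X Y + t ^+ 2 * ip Y Y.
    rewrite !(linear_add _ _ (ipr _)) !(linear_add _ _ (ipl _)).
    rewrite !(linear_scale _ _ (ipr _)) !(linear_scale _ _ (ipl _)).
    have -> : ip Y X = ip X Y by rewrite ipC.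
    rewrite X1; set A := ip X Y; set D := ip Y Y.
    rewrite -[t *: A]/(t * A) -[t *: (t *: D)]/(t * (t * D)); ring.
  pose u := ip (S X) Y - l * ip X Y; pose v := l * ip Y Y - ip (S Y) Y.
  have v0 : 0 <= v by rewrite subr_ge0 pos.
  have H t : 0 <= t ^+ 2 * v - 2 * t * u.
    have := pos (X + t *: Y) ltac:(by rewrite memvD // memvZ).
    rewrite exp_ exp2_ -subr_ge0; congr (0 <= _); rewrite /u /v; ring.
  have -> : ip (S X - l *: X) Y = u.
    by rewrite (linear_sub _ _ (ipl _)) (linear_scale _ _ (ipl _)).
  have w0' : 0 < v + 1 by rewrite ltr_wpDl.
  (* This value of t makes t^2 v - 2 t u negative unless u = 0; the added 1 covers the case v =
     0. *)
  have := H (u / (v + 1)).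
  have -> : (u / (v + 1)) ^+ 2 * v - 2 * (u / (v + 1)) * u =
      - (u ^+ 2 * ((v + 2) / (v + 1) ^+ 2)) by field; rewrite lt0r_neq0.
  rewrite oppr_ge0 pmulr_lle0 ?divr_gt0 ?exprn_gt0 // ?ltr_wpDl //.
  move=> H2; apply/eqP; rewrite -sqrf_eq0 eq_le H2 sqr_ge0.
  by [].
apply/eqP; rewrite -subr_eq0; apply/eqP; apply: contraTeq isT => ne.
have := ip_gt0 ne; rewrite orth ?ltxx //.
by rewrite memvB ?SW // memvZ.
Qed.

End Rayleigh.

(** * Cartan decompositions and restricted roots *)

Section Cartan.
Context {R : realType} {n : nat}.
Local Notation V := 'rV[R]_n.
Variable br : V -> V -> V.
Hypothesis br_lie : lie_bracket br.
Local Notation "[ X , Y ]" := (br X Y).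
Local Notation B := (kform br).
Variables (k p : {vspace V}).

Definition cartan :=
  [/\ (k + p)%VS = fullv /\ (k :&: p)%VS = 0%VS,
      forall X Y, X \in k -> Y \in k -> [X, Y] \in k,
      forall X Y, X \in k -> Y \in p -> [X, Y] \in p,
      forall X Y, X \in p -> Y \in p -> [X, Y] \in k
    & (forall X, X \in k -> X != 0 -> B X X < 0) /\
      (forall X, X \in p -> X != 0 -> 0 < B X X)].

Hypothesis HC : cartan.
Local Notation kp := (kpart k p).
Local Notation pp := (ppart k p).

Lemma direct_sum : (k + p)%VS = fullv /\ (k :&: p)%VS = 0%VS.
Proof. by case: HC. Qed.

Lemma brkk X Y : X \in k -> Y \in k -> [X, Y] \in k. Proof. by case: HC => _ H _ _ _; exact: H. Qed.
Lemma brkp X Y : X \in k -> Y \in p -> [X, Y] \in p. Proof. by case: HC => _ _ H _ _; exact: H. Qed.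
Lemma brpp X Y : X \in p -> Y \in p -> [X, Y] \in k. Proof. by case: HC => _ _ _ H _; exact: H. Qed.
Lemma brpk X Y : X \in p -> Y \in k -> [X, Y] \in p.
Proof. by move=> Xp Yk; rewrite brC // memvN brkp. Qed.

Lemma kpart_mem X : kp X \in k. Proof. exact: memv_pi. Qed.
Lemma ppart_mem X : pp X \in p. Proof. exact: memv_pi. Qed.

Lemma kpart_add X : kp X + pp X = X.
Proof.
have [kpf kp0] := direct_sum.
by apply: daddv_pi_add => //; rewrite kpf memvf.
Qed.

Lemma kpart_id X : X \in k -> kp X = X.
Proof. by move=> Xk; apply: daddv_pi_id => //; case: direct_sum. Qed.

Lemma ppart_id X : X \in p -> pp X = X.
Proof. by move=> Xp; apply: daddv_pi_id => //; rewrite capvC; case: direct_sum. Qed.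

Lemma kpart_linear : linear kp. Proof. by move=> c X Y; rewrite /kpart linearP. Qed.
Lemma ppart_linear : linear pp. Proof. by move=> c X Y; rewrite /ppart linearP. Qed.

Lemma ppart_k X : X \in k -> pp X = 0.
Proof.
move=> Xk; have := kpart_add X; rewrite (kpart_id Xk) => e.
by apply: (@addrI _ X); rewrite e addr0.
Qed.

Lemma kpart_p X : X \in p -> kp X = 0.
Proof.
move=> Xp; have := kpart_add X; rewrite (ppart_id Xp) => e.
by apply: (@addIr _ X); rewrite e add0r.
Qed.

Lemma split_unique X Y : X \in k -> Y \in p -> kp (X + Y) = X /\ pp (X + Y) = Y.
Proof.
move=> Xk Yp; rewrite (linear_add _ _ kpart_linear) (linear_add _ _ ppart_linear).
by rewrite (kpart_id Xk) (ppart_k Xk) (kpart_p Yp) (ppart_id Yp) addr0 add0r.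
Qed.

Lemma kp_disjoint X : X \in k -> X \in p -> X = 0.
Proof. by move=> Xk Xp; rewrite -(kpart_id Xk) kpart_p. Qed.

(** In block form for k + p, such a map has zero diagonal blocks. *)
Lemma swap_trace0 (f : V -> V) : linear f ->
  (forall X, X \in k -> f X \in p) -> (forall X, X \in p -> f X \in k) ->
  \tr (lin1_mx f) = 0.
Proof.
move=> fl fk fp.
pose Mk := lin1_mx kp; pose Mp := lin1_mx pp; pose M := lin1_mx f.
have mk u : u *m Mk = kp u by exact: mul_lin1 kpart_linear.
have mp u : u *m Mp = pp u by exact: mul_lin1 ppart_linear.
have m u : u *m M = f u by exact: mul_lin1.
have ek : Mk *m M *m Mk = 0.
  apply/row_matrixP => i; rewrite !rowE mulmx0 !mulmxA mk m mk kpart_p //.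
  exact/fk/kpart_mem.
have ep : Mp *m M *m Mp = 0.
  apply/row_matrixP => i; rewrite !rowE mulmx0 !mulmxA mp m mp ppart_k //.
  exact/fp/ppart_mem.
have kk : Mk *m Mk = Mk.
  by apply/row_matrixP => i; rewrite !rowE !mulmxA !mk kpart_id // kpart_mem.
have pp2 : Mp *m Mp = Mp.
  by apply/row_matrixP => i; rewrite !rowE !mulmxA !mp ppart_id // ppart_mem.
have e1 : Mk + Mp = 1%:M.
  by apply/row_matrixP => i; rewrite !rowE mulmxDr mk mp mulmx1 kpart_add.
rewrite -[lin1_mx f]mulmx1 -e1 mulmxDr mxtraceD -{1}kk -pp2 -/M.
rewrite !mulmxA -[\tr (M *m Mk *m Mk)]mxtrace_mulC -[\tr (M *m Mp *m Mp)]mxtrace_mulC.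
by rewrite !mulmxA ek ep mxtrace0 addr0.
Qed.

Lemma kform_kp X Y : X \in k -> Y \in p -> B X Y = 0.
Proof.
move=> Xk Yp; apply: swap_trace0.
- by move=> c U W; rewrite /= !(br_linear br_lie).
- by move=> Z Zk; rewrite /= brkp // brpk.
- by move=> Z Zp; rewrite /= brkk // brpp.
Qed.

Lemma kform_pk X Y : X \in p -> Y \in k -> B X Y = 0.
Proof. by move=> Xp Yk; rewrite kformC // kform_kp. Qed.

(** The inner product -B(X, theta Y), where theta is the Cartan involution, equal to 1 on k and -1
    on p. *)
Definition ip X Y : R := B (pp X) (pp Y) - B (kp X) (kp Y).

Lemma ipC X Y : ip X Y = ip Y X.
Proof. by rewrite /ip kformC // [B (kp X) _]kformC. Qed.

Lemma ipr X : linear (ip X : V -> R^o).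
Proof.
move=> c Y Z; rewrite /ip ppart_linear kpart_linear.
rewrite (kform_linear_r br_lie) (kform_linear_r br_lie (kp X)).
by rewrite scalerBr opprD addrACA.
Qed.

Lemma ipl Y : linear (ip ^~ Y : V -> R^o).
Proof. by move=> c X X'; rewrite ![ip _ Y]ipC ipr. Qed.

Lemma ip_gt0 X : X != 0 -> 0 < ip X X.
Proof.
move=> X0; have [_ _ _ _ [Bk Bp]] := HC; rewrite /ip subr_gt0.
have B0 : B 0 0 = 0 by exact: (linear_zero (kform_linear_r br_lie 0)).
have [k0|k0] := eqVneq (kp X) 0.
  rewrite k0 B0; apply: Bp; first exact: ppart_mem.
  by apply: contraNneq X0 => p0; rewrite -(kpart_add X) k0 p0 addr0.
apply: (@lt_le_trans _ _ 0); first by apply: Bk => //; exact: kpart_mem.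
have [->|p0] := eqVneq (pp X) 0; first by rewrite B0.
by apply/ltW/Bp => //; exact: ppart_mem.
Qed.

Lemma ip_eq0 X : ip X X = 0 -> X = 0.
Proof.
by move=> X0; apply/eqP/negPn/negP => /ip_gt0; rewrite X0 ltxx.
Qed.

Lemma ip_p X Y : X \in p -> Y \in p -> ip X Y = B X Y.
Proof.
move=> Xp Yp; rewrite /ip !ppart_id // !kpart_p //.
by rewrite (linear_zero (kform_linear_r br_lie 0)) subr0.
Qed.

Lemma kform_nondeg X : (forall Y, B X Y = 0) -> X = 0.
Proof.
move=> H; apply: ip_eq0; rewrite /ip.
(* The test vector is -theta X, and pairing with it recovers [ip X X]. *)
have e : B X (pp X - kp X) = B (pp X) (pp X) - B (kp X) (kp X).
  rewrite -{1}(kpart_add X) (linear_add _ _ (kform_linear_l br_lie _)).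
  rewrite !(linear_sub _ _ (kform_linear_r br_lie _)).
  rewrite (kform_kp (kpart_mem X) (ppart_mem X)) (kform_pk (ppart_mem X) (kpart_mem X)).
  by rewrite sub0r subr0 addrC.
by rewrite -e.
Qed.

(* [ad H] is symmetric for [H] in [p], although the Killing form makes it skew:
   the inner product changes sign between [k] and [p], which [ad H] exchanges. *)
Lemma ip_adp H X Y : H \in p -> ip [H, X] Y = ip X [H, Y].
Proof.
move=> Hp.
have parts Z : kp [H, Z] = [H, pp Z] /\ pp [H, Z] = [H, kp Z].
  rewrite -{1 3}(kpart_add Z) brDr // addrC; apply: split_unique.
    by rewrite brpp // ppart_mem.
  by rewrite brpk // kpart_mem.
have [a1 a2] := parts X; have [b1 b2] := parts Y.
rewrite /ip a1 a2 b1 b2 !(kform_bracket br_lie) opprK addrC; congr (_ + _).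
Qed.

Definition derivation (D : V -> V) :=
  linear D /\ forall X Y, D [X, Y] = [D X, Y] + [X, D Y].

(** Nondegeneracy of the Killing form represents the functional Y |-> tr(D ad Y) by some [Z], and D
    - ad Z is shown to vanish. As [D] preserves k and p, the functional vanishes on p, which puts
    [Z] in k. *)
Lemma derivation_inner (D : V -> V) : derivation D ->
  (forall X, X \in k -> D X \in k) -> (forall X, X \in p -> D X \in p) ->
  exists2 Z, Z \in k & forall X, D X = [Z, X].
Proof.
move=> [Dl DD] Dk Dp.
pose lam X : R := \tr (lin1_mx (D \o br X)).
have trl : linear (lam : V -> R^o).
  have e X : lin1_mx (D \o br X) = adm br X *m lin1_mx D.
    exact: lin1_comp Dl (br_linear br_lie X).
  move=> c X Y; rewrite /lam !e (adm_linear br_lie).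
  by rewrite mulmxDl -scalemxAl mxtraceD mxtraceZ.
have [Z HZ] := bilinear_represent (kform_linear_l br_lie) (kform_linear_r br_lie)
  kform_nondeg trl.
have Zk : Z \in k.
  have pZ : pp Z = 0.
    have := HZ (pp Z).
    have -> : lam (pp Z) = 0.
      apply: swap_trace0.
      - by move=> c U W; rewrite /= (br_linear br_lie) Dl.
      - by move=> U Uk; rewrite /= Dp // brpk // ppart_mem.
      - by move=> U Up; rewrite /= Dk // brpp // ppart_mem.
    rewrite -{1}(kpart_add Z) (linear_add _ _ (kform_linear_l br_lie _)).
    rewrite (kform_kp (kpart_mem Z) (ppart_mem Z)) add0r => e.
    by apply: ip_eq0; rewrite ip_p ?ppart_mem.
  by rewrite -(kpart_add Z) pZ addr0 kpart_mem.
exists Z => // X; apply/eqP; rewrite -subr_eq0; apply/eqP.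
pose E Y := D Y - [Z, Y].
have El : linear E.
  move=> c U W; rewrite /E Dl (br_linear br_lie) scalerBr opprD addrACA.
  by [].
have ED U W : E [U, W] = [E U, W] + [U, E W].
  rewrite /E DD brJ // brBl // brBr // opprD addrACA.
  by [].
have trE Y : \tr (lin1_mx (E \o br Y)) = 0.
  have -> : lin1_mx (E \o br Y) = lin1_mx (D \o br Y) - lin1_mx (br Z \o br Y).
    by apply/matrixP => i j; rewrite !mxE.
  by rewrite raddfB /= -/(lam Y) -/(kform br Z Y) HZ subrr.
apply: kform_nondeg => Y; rewrite -/(E X).
(* [ad (E X)] is the commutator of [E] and [ad X], and [E] is orthogonal to all
   [ad Y] for the trace form. *)
pose M := lin1_mx E.
have aE : adm br (E X) = adm br X *m M - M *m adm br X.
  apply/row_matrixP => i; rewrite !rowE mulmxBr !mulmxA !mul_adm // !mul_lin1 //.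
  by rewrite ED addrK.
have tM W : \tr (adm br W *m M) = 0.
  rewrite -(trE W); congr (\tr _).
  by rewrite (lin1_comp El (br_linear br_lie W)).
have trB (P Q : 'M[R]_n) : \tr (P - Q) = \tr P - \tr Q by rewrite raddfB.
rewrite kformE // aE mulmxBr trB !mulmxA.
have -> : \tr (adm br Y *m M *m adm br X) = \tr (adm br X *m adm br Y *m M).
  by rewrite mxtrace_mulC mulmxA.
by rewrite -trB -mulmxBl -adm_bracket // tM.
Qed.

Lemma automorphism_parts (A : 'M[R]_n) X :
  (forall X, X \in k -> X *m A \in k) -> (forall X, X \in p -> X *m A \in p) ->
  kp (X *m A) = kp X *m A /\ pp (X *m A) = pp X *m A.
Proof.
move=> Ak Ap; rewrite -{1 3}(kpart_add X) mulmxDl.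
by apply: split_unique; [apply/Ak/kpart_mem|apply/Ap/ppart_mem].
Qed.

Lemma ip_automorphism (A : 'M[R]_n) X Y : automorphism br A ->
  (forall X, X \in k -> X *m A \in k) -> (forall X, X \in p -> X *m A \in p) ->
  ip (X *m A) (Y *m A) = ip X Y.
Proof.
move=> hA Ak Ap; rewrite /ip.
have [-> ->] := automorphism_parts X Ak Ap.
have [-> ->] := automorphism_parts Y Ak Ap.
by rewrite !(kform_automorphism br_lie).
Qed.

Section Roots.
Variable a : {vspace V}.

Definition abelian_sub (b : {vspace V}) := forall X Y, X \in b -> Y \in b -> [X, Y] = 0.

Hypothesis a_p : (a <= p)%VS.
Hypothesis a_ab : abelian_sub a.
Hypothesis a_max : forall b, (a <= b)%VS -> (b <= p)%VS -> abelian_sub b -> b = a.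

(** Adjoining [Y] to [a] leaves it abelian and inside p, so maximality applies. *)
Lemma centralizer_a Y : Y \in p -> (forall H, H \in a -> [H, Y] = 0) -> Y \in a.
Proof.
move=> Yp HY.
have e : (a + <[Y]>)%VS = a.
  apply: a_max; first exact: addvSl.
    by rewrite subv_add a_p -memvE.
  move=> _ _ /memv_addP[H1 H1a [_ /vlineP[c1 ->] ->]]
    /memv_addP[H2 H2a [_ /vlineP[c2 ->] ->]].
  rewrite !(brDl br_lie) !(brDr br_lie) !(brZl br_lie) !(brZr br_lie).
  rewrite (a_ab H1a H2a) (HY _ H1a) [br Y H2]brC // (HY _ H2a) (brXX br_lie).
  by rewrite oppr0 !scaler0 !addr0.
by rewrite -e memvE addvSr.
Qed.

Definition rroot (alpha : V -> R) :=
  (exists2 H, H \in a & alpha H != 0) /\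
  (exists2 X, X != 0 & forall H, H \in a -> [H, X] = alpha H *: X).

(** In a nonzero invariant subspace of least dimension every ad H, being symmetric for [ip], has an
    eigenvector. Its eigenspace is again invariant, since [a] is abelian, and so is everything: each
    ad H acts there as a scalar. *)
Lemma joint_eigenvector (W : {vspace V}) : W != 0%VS ->
  (forall H X, H \in a -> X \in W -> [H, X] \in W) ->
  exists2 X, X \in W & X != 0 /\
    exists alpha : V -> R, forall H, H \in a -> [H, X] = alpha H *: X.
Proof.
move=> W0 WI.
pose P d := `[< exists W' : {vspace V}, [/\ (W' <= W)%VS, W' != 0%VS,
   forall H X, H \in a -> X \in W' -> [H, X] \in W' & \dim W' = d] >].
have Pex : exists d, P d by exists (\dim W); apply/asboolP; exists W.
case: (ex_minnP Pex) => d /asboolP[W' [W'W W'0 W'I dW']] dmin.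
have scal H : H \in a -> exists l, forall X, X \in W' -> [H, X] = l *: X.
  move=> Ha; have Hp : H \in p by apply: (subvP a_p).
  have [l [X [XW X0 HX]]] := symmetric_eigenvector ipr ipC ip_gt0 (br_linear br_lie H)
    (fun X Y => ip_adp X Y Hp) (fun X => W'I H X Ha) W'0.
  exists l.
  have Sl : linear (fun X => [H, X] - l *: X).
    move=> c U W1; rewrite (br_linear br_lie) scalerDr scalerBr opprD addrACA.
    by rewrite !scalerA mulrC.
  pose S : {linear V -> V} := HB.pack (fun X => [H, X] - l *: X)
    (GRing.isLinear.Build _ _ _ _ _ Sl).
  pose W2 := (W' :&: lker (linfun S))%VS.
  have memW2 Y : (Y \in W2) = (Y \in W') && ([H, Y] == l *: Y).
    by rewrite memv_cap memv_ker lfunE /= subr_eq0.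
  have W2W : (W2 <= W')%VS by exact: capvSl.
  have e : W2 = W'.
    apply/eqP; rewrite eqEdim W2W dW'; apply: dmin; apply/asboolP; exists W2; split=> //.
    - exact: subv_trans W2W W'W.
    - apply: contraNneq X0 => W20; have : X \in W2 by rewrite memW2 XW HX eqxx.
      by rewrite W20 memv0.
    - move=> H' Y H'a; rewrite !memW2 => /andP[YW /eqP HY]; rewrite W'I //=.
      by rewrite brJ // (a_ab Ha H'a) (br0l br_lie) add0r HY (brZr br_lie).
  by move=> Y YW; apply/eqP; have := memW2 Y; rewrite e YW /= => <-.
exists (vpick W'); first by apply: (subvP W'W); exact: memv_pick.
split; first by rewrite vpick0.
exists (fun H => ip [H, vpick W'] (vpick W') / ip (vpick W') (vpick W')) => H Ha.
have [l Hl] := scal H Ha; rewrite (Hl _ (memv_pick _)).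
rewrite (linear_scale l _ (ipl _)) -[X in (X / _) *: _]/(l * _) mulfK //.
by rewrite lt0r_neq0 // ip_gt0 // vpick0.
Qed.

Definition regular (H : V) := H \in a /\ forall alpha, rroot alpha -> alpha H != 0.

Lemma regular_centralizer H0 Y : regular H0 -> Y \in p -> [H0, Y] = 0 -> Y \in a.
Proof.
move=> [H0a H0r] Yp H0Y; apply: centralizer_a => // H Ha.
apply/eqP/negPn/negP => HY0.
(* On the image of [ad H] inside the kernel of [ad H0], [ad H] is injective, so
   a joint eigenvector there has a rroot that vanishes at [H0] but not at [H]. *)
pose aH : {linear V -> V} := HB.pack (br H) (GRing.isLinear.Build _ _ _ _ _ (br_linear br_lie H)).
pose aH0 : {linear V -> V} := HB.pack (br H0) (GRing.isLinear.Build _ _ _ _ _ (br_linear br_lie H0)).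
pose W := (linfun aH @: lker (linfun aH0))%VS.
have memK X : (X \in lker (linfun aH0)) = ([H0, X] == 0) by rewrite memv_ker lfunE.
have comm H1 H2 X : H1 \in a -> H2 \in a -> [H1, [H2, X]] = [H2, [H1, X]].
  by move=> h1 h2; rewrite brJ // (a_ab h1 h2) (br0l br_lie) add0r.
have memW X : X \in W -> exists2 T, [H0, T] = 0 & X = [H, T].
  move=> /memv_imgP[T]; rewrite memK => /eqP T0 ->; exists T => //.
  by rewrite lfunE.
have inW T : [H0, T] = 0 -> [H, T] \in W.
  move=> T0; have -> : [H, T] = linfun aH T by rewrite lfunE.
  by apply: memv_img; rewrite memK T0.
have W0 : W != 0%VS.
  by apply: contraNneq HY0 => W0; have := inW Y H0Y; rewrite W0 memv0.
have WI H' X : H' \in a -> X \in W -> [H', X] \in W.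
  move=> H'a /memW[T T0 ->]; rewrite comm //; apply: inW.
  by rewrite comm // T0 (br0r br_lie).
have [X XW [X0 [alpha Hal]]] := joint_eigenvector W0 WI.
have [T T0 XT] := memW X XW.
have HX : [H, X] != 0.
  apply/eqP => HX0; have Hp : H \in p by apply: (subvP a_p).
  have : ip X X = 0 by rewrite {1}XT ip_adp // HX0 (linear_zero (ipr _)).
  by move/ip_eq0 => X00; rewrite X00 eqxx in X0.
have rt : rroot alpha.
  split; last by exists X.
  exists H => //; apply: contraNneq HX; rewrite (Hal _ Ha) => ->.
  by rewrite scale0r.
have := H0r _ rt; apply/negP; rewrite negbK.
have e : [H0, X] = 0 by rewrite XT comm // T0 (br0r br_lie).
have := Hal _ H0a; rewrite e => /esym/eqP.
by rewrite scaler_eq0 (negbTE X0) orbF.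
Qed.

(** The closed chamber of [H0] described by weak signs of roots, which makes convexity and
    closedness accessible; [weyl_closure] identifies it with the closure of a component of the
    regular set. *)
Definition weyl (H0 : V) : set V :=
  [set H | H \in a /\ forall alpha, rroot alpha -> 0 <= alpha H * alpha H0].

End Roots.

End Cartan.

(** * Convergence and compactness of matrices *)

Section MatrixTopology.
Context {R : realType}.

Lemma mx_cvg (T : Type) (F : set_system T) {FF : Filter F} m n
    (f : T -> 'M[R]_(m, n)) (l : 'M[R]_(m, n)) :
  (forall i j, (fun t => f t i j) @ F --> l i j) -> f @ F --> l.
Proof.
move=> H; apply/cvgrPdist_le => e e0.
have : \forall t \near F, forall ij : 'I_m * 'I_n, `|l ij.1 ij.2 - f t ij.1 ij.2| <= e.
  apply: filter_forall => -[i j] /=.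
  by have /cvgrPdist_le := H i j; apply.
apply: filterS => t Ht; apply/mx_norm_leP => [|i j]; first exact: ltW.
by rewrite !mxE; exact: (Ht (i, j)).
Qed.

Lemma mx_cvg_coord (T : Type) (F : set_system T) {FF : Filter F} m n
    (f : T -> 'M[R]_(m, n)) (l : 'M[R]_(m, n)) i j :
  f @ F --> l -> (fun t => f t i j) @ F --> l i j.
Proof.
move=> /cvgrPdist_le H; apply/cvgrPdist_le => e e0.
apply: filterS (H e e0) => t; apply: le_trans.
by have := coord_norm_le (l - f t) i j; rewrite !mxE.
Qed.

Lemma cvg_mulmx (T : Type) (F : set_system T) {FF : Filter F} m n p
    (f : T -> 'M[R]_(m, n)) (g : T -> 'M[R]_(n, p))
    (a : 'M[R]_(m, n)) (b : 'M[R]_(n, p)) :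
  f @ F --> a -> g @ F --> b -> (fun t => f t *m g t) @ F --> a *m b.
Proof.
move=> fa gb; apply: mx_cvg => i j; rewrite mxE.
under eq_fun do rewrite mxE.
apply: (cvg_big (op := +%R) (U := R^o)) => [|l _]; first exact: add_continuous.
by apply: cvgM; apply: mx_cvg_coord.
Qed.

Lemma mulmxl_continuous m n p (A : 'M[R]_(m, n)) :
  continuous (fun B : 'M[R]_(n, p) => A *m B).
Proof.
move=> B; have := @cvg_mulmx _ _ (nbhs_filter B) m n p (fun=> A) id A B.
by apply; [exact: cvg_cst|exact: cvg_id].
Qed.

Lemma seq_lim_le (u : nat -> R) (l c : R) :
  u @ \oo --> l -> (forall j, u j <= c) -> l <= c.
Proof.
move=> cu H; rewrite -(cvg_lim (@Rhausdorff R) cu).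
by apply: limr_le; [exact: cvgP cu|exact: nearW].
Qed.

Lemma mulmx_norm_le m n p (A : 'M[R]_(m, n)) (B : 'M[R]_(n, p)) :
  `|A *m B| <= n%:R * (`|A| * `|B|).
Proof.
apply/mx_norm_leP => [|i j]; first by rewrite !mulr_ge0.
rewrite mxE; apply: le_trans (ler_norm_sum _ _ _) _.
have -> : n%:R * (`|A| * `|B|) = \sum_(l < n) (`|A| * `|B|).
  by rewrite sumr_const card_ord mulr_natl.
by apply: ler_sum => l _; rewrite normrM ler_pM // coord_norm_le.
Qed.

Lemma bounded_closed_compact_mx m n (A : set 'M[R]_(m, n)) :
  bounded_set A -> closed A -> compact A.
Proof.
move=> bA cA.
have vl : linear (vec_mx : 'rV[R]_(m * n) -> 'M[R]_(m, n)) by exact: linearP.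
have vc := linear_continuous_rV vl.
have -> : A = vec_mx @` (vec_mx @^-1` A).
  apply/seteqP; split=> [M AM|M [v Av <-]] //.
  by exists (mxvec M); rewrite /= ?mxvecK.
apply: continuous_compact; first exact: continuous_subspaceT.
apply: bounded_closed_compact; last exact: closed_preimage.
case: bA => M [Mr HM]; exists M; split=> // x Mx v Av.
apply: le_trans (HM x Mx _ Av); apply/mx_norm_leP => // i j.
rewrite (ord1 i) -[v]vec_mxK; case/mxvec_indexP: j => i' j'.
by rewrite mxvecE mxvecK; exact: coord_norm_le.
Qed.

End MatrixTopology.

(** * Compact groups of automorphisms and Hunt's argument *)

Section Slice.
Context {R : realType} {n : nat}.
Local Notation V := 'rV[R]_n.
Local Notation h k := ((2^-1 : R) ^+ k).
Variable br : V -> V -> V.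
Hypothesis br_lie : lie_bracket br.
Local Notation "[ X , Y ]" := (br X Y).
Local Notation B := (kform br).
Variables (k p : {vspace V}).
Hypothesis HC : cartan br k p.
Local Notation kp := (kpart k p).
Local Notation pp := (ppart k p).

Definition preserves (A : 'M[R]_n) := [/\ automorphism br A,
  forall X, X \in k -> X *m A \in k & forall X, X \in p -> X *m A \in p].

(** The velocity is recorded along dyadic sequences, the form in which the first and second
    variations are taken. *)
Definition one_parameter_mx (Gam : set 'M[R]_n) (Z : V) (c : R -> 'M[R]_n) :=
  [/\ continuous c, forall t, Gam (c t), forall s t, c (s + t) = c s *m c t
    & forall s, (fun j => (2 ^ j)%:R *: (c (s * h j) - 1%:M)) @ \oo --> s *: adm br Z].

(** An abstract stand-in for Ad(K), acting on row vectors from the right. *)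
Variable Gam : set 'M[R]_n.
Hypothesis G1 : Gam 1%:M.
Hypothesis GM : forall A D, Gam A -> Gam D -> Gam (A *m D).
Hypothesis GV : forall A, Gam A -> Gam (invmx A).
Hypothesis GP : forall A, Gam A -> preserves A.
Hypothesis Gexp : forall Z, Z \in k -> exists c, one_parameter_mx Gam Z c.
Hypothesis Gcl : closed Gam.

(** Automorphisms that preserve k and p are isometries of [ip], so the images of the basis vectors
    are bounded. *)
Lemma Gam_bounded : exists2 M : R, 0 < M & forall A, Gam A -> `|A| <= M.
Proof.
have [c c0 Hc] := ip_bound (ipr br_lie k p) (ipC br_lie k p) (ip_gt0 br_lie HC).
pose K := \sum_(i < n) ip br k p (delta_mx 0 i) (delta_mx 0 i).
have K0 : 0 <= K.
  apply: sumr_ge0 => i _; have [->|/(ip_gt0 br_lie HC)/ltW //] := eqVneq (delta_mx 0 i : V) 0.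
  by rewrite (linear_zero (ipr br_lie k p _)).
exists (1 + K / c); first by rewrite ltr_wpDr // divr_ge0 // ltW.
move=> A GA; have [hA Ak Ap] := GP GA.
have Kc0 : 0 <= 1 + K / c by rewrite addr_ge0 // divr_ge0 // ltW.
apply/mx_norm_leP => // i j.
have e : A i j = (delta_mx 0 i *m A : V) 0 j by rewrite -rowE mxE.
rewrite e; apply: le_trans (coord_norm_le _ _ _) _.
set x := _ *m A.
have x2 : `|x| ^+ 2 <= K / c.
  rewrite ler_pdivlMr // mulrC; apply: le_trans (Hc x) _.
  rewrite /x (ip_automorphism br_lie HC) // /K (bigD1 i) //= lerDl.
  apply: sumr_ge0 => l _; have [->|/(ip_gt0 br_lie HC)/ltW //] := eqVneq (delta_mx 0 l : V) 0.
  by rewrite (linear_zero (ipr br_lie k p _)).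
have [x1|x1] := leP `|x| 1; first by rewrite (le_trans x1) // lerDl divr_ge0 // ltW.
apply: (@le_trans _ _ (`|x| ^+ 2)); first by rewrite expr2 ler_peMl // ltW.
by apply: le_trans x2 _; rewrite lerDr.
Qed.

Lemma Gam_compact : compact Gam.
Proof.
have [M M0 HM] := Gam_bounded; apply: bounded_closed_compact_mx => //.
by exists M; split; rewrite ?num_real // => x Mx A /HM /le_trans; apply; exact: ltW.
Qed.

Lemma Gam_act : exists2 K : R, 0 < K & forall A (x : V), Gam A -> `|x *m A| <= K * `|x|.
Proof.
have [M M0 HM] := Gam_bounded; exists (n%:R * M + 1); first by rewrite ltr_wpDl // mulr_ge0 // ltW.
move=> A x GA; apply: le_trans (mulmx_norm_le _ _) _.
rewrite mulrDl mul1r -mulrA [`|x| * _]mulrC.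
apply: (@le_trans _ _ (n%:R * (M * `|x|))); last by rewrite lerDl.
by apply: ler_wpM2l => //; apply: ler_wpM2r => //; exact: HM.
Qed.

Lemma GamK A : Gam A -> A \in unitmx.
Proof. by move=> /GP [[]]. Qed.

Lemma one_parameter_mx0 Z c : one_parameter_mx Gam Z c -> c 0 = 1%:M.
Proof.
case=> _ cG cD _; have := cD 0 0; rewrite addr0 => e.
have u := GamK (cG 0); apply: (can_inj (mulKmx u)).
by rewrite -e mulmx1.
Qed.

(** Split the time t into 2^j equal steps. Each moves [X] by o(2^-j), the velocity [Z, X] being 0,
    and the uniform bound on [Gam] keeps the total at o(1). *)
Lemma one_parameter_fix Z c (X : V) : one_parameter_mx Gam Z c -> [Z, X] = 0 ->
  forall t, X *m c t = X.
Proof.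
move=> oc ZX t; have [cc cG cD cT] := oc; have [K K0 HK] := Gam_act.
pose x j := (2 ^ j)%:R *: (X *m (c (t * h j) - 1%:M)).
have x0 : x @ \oo --> (0 : V).
  have -> : (0 : V) = X *m (t *: adm br Z) by rewrite -scalemxAr mul_adm // ZX scaler0.
  have -> : x = (fun j => X *m ((2 ^ j)%:R *: (c (t * h j) - 1%:M))).
    by apply/funext => j; rewrite /x scalemxAr.
  by apply: cvg_mulmx => //; exact: cvg_cst.
have cn m s : c (m%:R * s) = iter m (mulmx (c s)) 1%:M.
  elim: m => [|m IH]; first by rewrite mul0r (one_parameter_mx0 oc).
  by rewrite -natr1 mulrDl mul1r addrC cD IH.
have Gi m s : Gam (iter m (mulmx (c s)) 1%:M).
  by rewrite -cn.
have step m s : `|X *m iter m (mulmx (c s)) 1%:M - X| <=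
    m%:R * (K * `|X *m (c s - 1%:M)|).
  elim: m => [|m IH]; first by rewrite mulmx1 subrr normr0 mul0r.
  have -> : X *m iter m.+1 (mulmx (c s)) 1%:M - X =
     (X *m (c s - 1%:M)) *m iter m (mulmx (c s)) 1%:M + (X *m iter m (mulmx (c s)) 1%:M - X).
    by rewrite /= mulmxBr mulmx1 mulmxBl mulmxA addrA subrK.
  apply: le_trans (ler_normD _ _) _; rewrite -natr1 mulrDl mul1r addrC.
  by apply: lerD => //; exact: HK.
apply/eqP; rewrite -subr_eq0 -normr_le0.
have nx0 : (fun j => K * `|x j|) @ \oo --> (0 : R).
  rewrite -[X in _ --> X](mulr0 K); apply: cvgMr; exact/norm_cvg0P.
have := limr_ge (cvgP _ nx0); rewrite (cvg_lim _ nx0) //; apply.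
apply: nearW => j.
have := step (2 ^ j)%N (t * h j); rewrite -cn.
have -> : (2 ^ j)%:R * (t * h j) = t by rewrite mulrCA half_pow mulr1.
by rewrite /x normrZ normr_nat mulrCA.
Qed.

Variable a : {vspace V}.
Hypothesis a_p : (a <= p)%VS.
Hypothesis a_ab : abelian_sub br a.
Hypothesis a_max : forall b, (a <= b)%VS -> (b <= p)%VS -> abelian_sub br b -> b = a.
Variable R0 : V.
Hypothesis R0reg : regular br a R0.

Let aP X : X \in a -> X \in p. Proof. exact: (subvP a_p). Qed.

Lemma rroot_linear alpha X Y c : rroot br a alpha -> X \in a -> Y \in a ->
  alpha (c *: X + Y) = c * alpha X + alpha Y.
Proof.
move=> [_ [W W0 HW]] Xa Ya.
have := HW (c *: X + Y) ltac:(by rewrite memvD // memvZ).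
rewrite (brDl br_lie) (brZl br_lie) !HW // scalerA -scalerDl => /eqP.
rewrite -subr_eq0 -scalerBl scaler_eq0 (negbTE W0) orbF subr_eq0 => /eqP.
by [].
Qed.

Lemma rroot0 alpha : rroot br a alpha -> alpha 0 = 0.
Proof.
move=> ra; have a0 : 0 \in a by exact: mem0v.
have := rroot_linear 1 ra a0 a0; rewrite scaler0 addr0 mul1r => /eqP.
by rewrite -subr_eq0 opprD addrA subrr sub0r oppr_eq0 => /eqP.
Qed.

Lemma ap0 : weyl br a R0 0.
Proof. by split=> [|al ra]; [exact: mem0v|rewrite rroot0 // mul0r]. Qed.

(** The component of 1 is taken, rather than the whole stabilizer, because its orbits are later used
    as connected sets inside the slice. *)
Definition stab_component (H : V) : set 'M[R]_n :=
  connected_component (Gam `&` [set A | H *m A = H]) 1%:M.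

Lemma stab_component_sub H A : stab_component H A -> Gam A /\ H *m A = H.
Proof. by move=> /connected_component_sub. Qed.

Lemma stab_component1 H : stab_component H 1%:M.
Proof. by apply: connected_component_refl; split=> //=; rewrite mulmx1. Qed.

Lemma stab_component_compact H : compact (stab_component H).
Proof.
suff cl : closed (stab_component H).
  by apply: (subclosed_compact cl Gam_compact) => A /stab_component_sub[].
suff c : closed (Gam `&` [set A | H *m A = H]) by exact: component_closed c.
apply: closedI; first exact: Gcl.
have -> : [set A | H *m A = H] = (fun A : 'M[R]_n => H *m A) @^-1` [set H] by [].
apply: closed_preimage; last exact/accessible_closed_set1/hausdorff_accessible/norm_hausdorff.
exact: mulmxl_continuous.
Qed.

Lemma stab_component_mul H A Z c : stab_component H A -> Z \in k -> [Z, H] = 0 ->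
  one_parameter_mx Gam Z c -> forall t, stab_component H (A *m c t).
Proof.
move=> QA Zk ZH oc t; have [cc cG cD _] := oc.
have [GA HA] := stab_component_sub QA.
have -> : stab_component H = connected_component (Gam `&` [set A | H *m A = H]) A.
  exact: same_connected_component.
apply: (@connected_component_max _ _ ((fun t => A *m c t) @` setT)).
- by exists 0 => //; rewrite (one_parameter_mx0 oc) mulmx1.
- move=> _ [s _ <-]; split; first exact: GM.
  by rewrite /= mulmxA HA (one_parameter_fix oc).
- apply: connected_continuous_connected; first exact/connected_intervalP.
  apply: continuous_subspaceT => s.
  by apply: cvg_mulmx; [exact: cvg_cst|exact: cc].
- by exists t.
Qed.

(* Hunt's argument: maximise z |-> B(Y z, R0); the first variation puts Y z in
   the centralizer of R0, the second one fixes the signs of the roots. *)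
Lemma hunt H' Y : H' \in a -> Y \in p ->
  (forall A, Gam A -> H' *m A = H' -> [Y *m A, H'] = 0) ->
  exists2 z, stab_component H' z & Y *m z \in a /\
    forall beta, rroot br a beta -> beta H' = 0 -> 0 <= beta (Y *m z) * beta R0.
Proof.
move=> H'a Yp HY.
pose f (z : 'M[R]_n) : R := B (Y *m z) R0.
have Blin := kform_linear_l br_lie R0.
have Bc : continuous (B ^~ R0 : V -> R^o) := linear_continuous_rV Blin.
have fc : continuous f.
  move=> z; apply: (@cvg_comp _ _ _ (fun z => Y *m z) (B ^~ R0) _ (nbhs (Y *m z))).
    exact: mulmxl_continuous.
  exact: Bc.
have [z zQ zmax] := compact_EVT_max (ex_intro _ _ (stab_component1 H'))
  (@stab_component_compact H') (continuous_subspaceT fc).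
rewrite inE in zQ; have [Gz H'z] := stab_component_sub zQ.
set Y' := Y *m z.
have Y'p : Y' \in p by have [_ _ Ap] := GP Gz; exact: Ap.
have Y'H : [Y', H'] = 0 by exact: HY.
have R0a : R0 \in a := R0reg.1.
have max c Z t : Z \in k -> [Z, H'] = 0 -> one_parameter_mx Gam Z c ->
    B (Y' *m c t) R0 <= B Y' R0.
  move=> Zk ZH oc; rewrite /Y' -mulmxA; apply: zmax; rewrite inE.
  exact: stab_component_mul zQ Zk ZH oc t.
have first_le Z : Z \in k -> [Z, H'] = 0 -> B [Z, Y'] R0 <= 0.
  move=> Zk ZH; have [c oc] := Gexp Zk; have [cc cG cD cT] := oc.
  have := cT 1; rewrite scale1r => cT1.
  have cv : (fun j => B ((2 ^ j)%:R *: (Y' *m (c (1 * h j) - 1%:M))) R0) @ \oo -->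
      B [Z, Y'] R0.
    have cw : (fun j => (2 ^ j)%:R *: (Y' *m (c (1 * h j) - 1%:M))) @ \oo --> [Z, Y'].
      rewrite -(mul_adm br_lie); under eq_fun do rewrite scalemxAr.
      by apply: cvg_mulmx => //; exact: cvg_cst.
    exact: (cvg_comp _ _ cw (Bc _)).
  apply: (seq_lim_le cv) => j; rewrite (linear_scale _ _ Blin) mulmxBr mulmx1.
  rewrite (linear_sub _ _ Blin); apply: mulr_ge0_le0 => //.
  by rewrite subr_le0; exact: (max c Z).
have first0 Z : Z \in k -> [Z, H'] = 0 -> B [Z, Y'] R0 = 0.
  move=> Zk ZH; apply/eqP; rewrite eq_le first_le //=.
  have := first_le (- Z); rewrite memvN !(brNl br_lie) ZH oppr0 => /(_ Zk erefl).
  by rewrite (linear_opp _ Blin) oppr_le0.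
have Y'a : Y' \in a.
  have Wk : [Y', R0] \in k by apply: (brpp HC) => //; exact: aP.
  have WH : [[Y', R0], H'] = 0.
    rewrite brC // brJ // [br H' Y']brC // Y'H oppr0 (br0l br_lie).
    by rewrite (a_ab H'a R0a) (br0r br_lie) addr0 oppr0.
  (* The direction W = [Y', R0] centralizes H', so the first variation along it vanishes; by
     invariance this says B(W, W) = 0, and B is definite on k. *)
  have W0 : [Y', R0] = 0.
    have := first0 _ Wk WH; rewrite brC // (linear_opp _ Blin).
    rewrite (kform_bracket br_lie) opprK => BW.
    by have [_ _ _ _ [Bk _]] := HC; apply/eqP/negPn/negP => /(Bk _ Wk); rewrite BW ltxx.
  apply: (regular_centralizer br_lie HC a_p a_ab a_max R0reg Y'p).
  by rewrite brC // W0 oppr0.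
exists z => //; split=> // beta rb bH'.
have [[H1 H1a bH1] [X X0 HX]] := rb.
have parts H : H \in a -> [H, kp X] = beta H *: pp X /\ [H, pp X] = beta H *: kp X.
  move=> Ha; have := HX H Ha; rewrite -{1}(kpart_add HC X) brDr // addrC => e.
  have [e1 e2] := split_unique HC (brpp HC (aP Ha) (ppart_mem k p X))
    (brpk br_lie HC (aP Ha) (kpart_mem k p X)).
  have kl := linear_scale (beta H) X (kpart_linear k p).
  have pl := linear_scale (beta H) X (ppart_linear k p).
  by split; [rewrite -e2 e pl|rewrite -e1 e kl].
set Z := kp X; have Zk : Z \in k := kpart_mem k p X.
have brZ H : H \in a -> [Z, H] = - (beta H *: pp X).
  by move=> Ha; rewrite brC // (parts H Ha).1.
have ZH' : [Z, H'] = 0 by rewrite brZ // bH' scale0r oppr0.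
have pX0 : pp X != 0.
  apply/eqP => pX0; have := (parts H1 H1a).2; rewrite pX0 (br0r br_lie) => /esym/eqP.
  rewrite scaler_eq0 (negbTE bH1) /= => /eqP kX0.
  by move/eqP: X0; apply; rewrite -(kpart_add HC X) pX0 kX0 addr0.
have second : B [Z, [Z, Y']] R0 <= 0.
  have [c oc] := Gexp Zk; have [cc cG cD cT] := oc.
  have := cT 1; rewrite scale1r => cT1.
  pose N j := (2 ^ j)%:R *: (c (1 * h j) - 1%:M).
  (* The factor [c (- h j)] turns the square of [c (h j) - 1] into the symmetric second difference
     c(h) - 2 + c(-h), both halves of which are nonpositive by maximality. *)
  have cv : (fun j => B (Y' *m N j *m N j *m c (- h j)) R0) @ \oo --> B [Z, [Z, Y']] R0.
    have c1 : (fun j => c (- h j)) @ \oo --> (1%:M : 'M[R]_n).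
      have h0 : (fun j => - h j : R) @ \oo --> (0 : R).
        rewrite -[X in _ --> X]oppr0; apply: cvgN.
        by have := @half_cvg0 R 1; under eq_fun do rewrite mul1r.
      by rewrite -(one_parameter_mx0 oc); exact: (cvg_comp _ _ h0 (cc 0)).
    have cw : (fun j => Y' *m N j *m N j *m c (- h j)) @ \oo --> [Z, [Z, Y']].
      rewrite -[br Z _]mulmx1 -!(mul_adm br_lie); apply: cvg_mulmx => //.
      by apply: cvg_mulmx => //; apply: cvg_mulmx => //; exact: cvg_cst.
    exact: (cvg_comp _ _ cw (Bc _)).
  apply: (seq_lim_le cv) => j.
  set u := h j; rewrite /N mul1r -/u.
  have cu : c u *m c (- u) = 1%:M by rewrite -cD subrr (one_parameter_mx0 oc).
  have -> : Y' *m ((2 ^ j)%:R *: (c u - 1%:M)) *m ((2 ^ j)%:R *: (c u - 1%:M)) *m c (- u) =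
    (2 ^ j)%:R *: ((2 ^ j)%:R *: ((Y' *m c u - Y') + (Y' *m c (- u) - Y'))).
    rewrite -!scalemxAr -!scalemxAl; congr (_ *: (_ *: _)).
    rewrite !mulmxBr !mulmx1 !mulmxBl -!mulmxA cu !mulmx1.
    by rewrite opprB.
  rewrite !(linear_scale _ _ Blin) (linear_add _ _ Blin) !(linear_sub _ _ Blin).
  apply: mulr_ge0_le0 => //; apply: mulr_ge0_le0 => //.
  by rewrite -(addr0 0); apply: lerD; rewrite subr_le0; exact: (max c Z).
(* For Z = X_k with X a root vector, [Z, H] = - beta(H) X_p on [a], so the second variation is -
   beta(Y') beta(R0) B(X_p, X_p). *)
move: second; rewrite (kform_bracket br_lie) !brZ //.
rewrite (linear_opp _ (kform_linear_l br_lie _)) (linear_opp _ (kform_linear_r br_lie _)) opprK.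
rewrite (linear_scale _ _ (kform_linear_l br_lie _)) (linear_scale _ _ (kform_linear_r br_lie _)).
have [_ _ _ _ [_ Bp]] := HC; have Bpos := Bp _ (ppart_mem k p X) pX0.
rewrite -[X in - X <= _]/(beta Y' * (beta R0 * B (pp X) (pp X))) mulrA oppr_le0.
by rewrite pmulr_lge0.
Qed.

End Slice.

(** * Saturation of the slice over the chamber *)

Section WeylSlice.
Context {R : realType} {n : nat}.
Local Notation V := 'rV[R]_n.
Variable br : V -> V -> V.
Hypothesis br_lie : lie_bracket br.
Local Notation "[ X , Y ]" := (br X Y).
Variables (k p : {vspace V}).
Hypothesis HC : cartan br k p.
Local Notation kp := (kpart k p).
Local Notation pp := (ppart k p).
Variable Gam : set 'M[R]_n.
Hypothesis G1 : Gam 1%:M.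
Hypothesis GM : forall A D, Gam A -> Gam D -> Gam (A *m D).
Hypothesis GV : forall A, Gam A -> Gam (invmx A).
Hypothesis GP : forall A, Gam A -> preserves br k p A.
Hypothesis Gexp : forall Z, Z \in k -> exists c, one_parameter_mx br Gam Z c.
Hypothesis Gcl : closed Gam.
Variable a : {vspace V}.
Hypothesis a_p : (a <= p)%VS.
Hypothesis a_ab : abelian_sub br a.
Hypothesis a_max : forall b, (a <= b)%VS -> (b <= p)%VS -> abelian_sub br b -> b = a.
Variable R0 : V.
Hypothesis R0reg : regular br a R0.
Local Notation ap := (weyl br a R0).

Lemma weyl_convex X Y (t : R) : 0 <= t -> t <= 1 -> ap X -> ap Y ->
  ap (t *: X + (1 - t) *: Y).
Proof.
move=> t0 t1 [Xa HX] [Ya HY]; split=> [|al ral]; first by rewrite memvD // memvZ.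
have Y'a : (1 - t) *: Y \in a by rewrite memvZ.
have a0 : 0 \in a by exact: mem0v.
have := rroot_linear br_lie (1 - t) ral Ya a0.
rewrite addr0 (rroot0 br_lie ral) addr0 (rroot_linear br_lie t ral Xa Y'a) => ->.
rewrite mulrDl -!mulrA; apply: addr_ge0; apply: mulr_ge0 => //; rewrite ?HX ?HY //.
by rewrite subr_ge0.
Qed.

Lemma weyl_closed : closed ap.
Proof.
move=> X clX; have Xa : X \in a.
  by apply: (@vspace_closed _ _ a) => D /clX[Y [[Ya _] DY]]; exists Y.
split=> // al ral; rewrite leNgt; apply/negP => neg.
have [_ [W W0 HW]] := ral.
have ip0 := ip_gt0 br_lie HC W0.
have alE Y : Y \in a -> al Y * ip br k p W W = ip br k p [Y, W] W.
  by move=> Ya; rewrite HW // (linear_scale _ _ (ipl br_lie k p _)).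
(* A root is only meaningful on [a]; up to the positive factor [ip W W] this linear form extends it
   to the whole space, where continuity is available. *)
pose f (Y : V) : R := ip br k p [Y, W] W * al R0.
have fl : linear (f : V -> R^o).
  move=> c Y Z; rewrite /f (brDl br_lie) (brZl br_lie) (ipl br_lie k p W).
  by rewrite -[_ *: _ + _]/(c * ip br k p [Y, W] W + ip br k p [Z, W] W) mulrDl -mulrA.
have fX : f X < 0.
  by rewrite /f -alE // mulrAC pmulr_llt0.
have nb : nbhs (f X) [set x : R | x < 0].
  by apply: open_nbhs_nbhs; split=> //; exact: open_lt.
have [Y [[Ya HY] fY]] := clX _ (linear_continuous_rV fl nb).
by move: fY => /=; rewrite /f -alE // mulrAC pmulr_llt0 // ltNge HY.
Qed.

Section Stability.
Variable U : set V.
Hypothesis U0 : U 0.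
Hypothesis Uinv : forall X A, Gam A -> U X -> U (X *m A).

(** [U] models the fibre of Omega over the identity, and [slice0] the corresponding part of
    Sigma_m. *)
Definition slice : set V := U `&` [set X | ap (pp X)].
Definition slice0 : set V := connected_component slice 0.
Local Notation T := slice.
Local Notation S := slice0.

Lemma slice_0 : T 0.
Proof.
split=> //; rewrite /= (linear_zero (ppart_linear k p)).
exact: ap0.
Qed.

Lemma ppart_mulmx A X : Gam A -> pp (X *m A) = pp X *m A.
Proof. by move=> /GP [_ Ak Ap]; have [] := automorphism_parts HC X Ak Ap. Qed.

Lemma slice0_sub X : S X -> T X. Proof. exact: connected_component_sub. Qed.

(* If [u] maps the regular element [R0] into [a] and fixes [H' = H u], compare
   the signs of the roots at [R0] and [R0 u]: they agree on the roots vanishing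
   at [H'] by assumption, and on the others because [H] and [H'] are dominant. *)
Lemma weyl_stable H H' (u : 'M[R]_n) : Gam u -> ap H -> ap H' -> H *m u = H' ->
  R0 *m u \in a ->
  (forall beta, rroot br a beta -> beta H' = 0 -> 0 <= beta (R0 *m u) * beta R0) ->
  forall W, ap W -> ap (W *m u).
Proof.
move=> Gu apH apH' Hu R0u sgn.
have [[uu hu] uk up] := GP Gu; have [_ _ vp] := GP (GV Gu).
have R0a : R0 \in a := R0reg.1.
have [_ hv] : automorphism br (invmx u) by have [] := GP (GV Gu).
(* Since [R0 u] lies in the abelian [a], the vector [W u^-1] commutes with [R0] and falls back into
   [a]; comparing dimensions, [u] preserves [a] as well. *)
have va W : W \in a -> W *m invmx u \in a.
  move=> Wa; apply: (regular_centralizer br_lie HC a_p a_ab a_max R0reg).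
    by apply: vp; exact: (subvP a_p).
  rewrite -[X in br X _](mulmxK uu) -hv.
  by rewrite (a_ab R0u Wa) mul0mx.
pose f : {linear V -> V} := mulmxr (invmx u).
have fa : (linfun f @: a <= a)%VS.
  by apply/subvP => _ /memv_imgP[W Wa ->]; rewrite lfunE /= va.
have ea : (linfun f @: a)%VS = a.
  apply/eqP; rewrite eqEdim fa /= limg_dim_eq //.
  apply: subv_anti; rewrite sub0v andbT; apply/subvP => W; rewrite memv_cap memv_ker lfunE /= => /andP[_ /eqP e].
  by rewrite memv0 -(mulmxKV uu W) e mul0mx.
have ua W : W \in a -> W *m u \in a.
  rewrite -{1}ea => /memv_imgP[W' W'a ->].
  by rewrite lfunE /= mulmxKV.
have rootu beta : rroot br a beta -> rroot br a (fun W => beta (W *m u)).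
  move=> [[H1 H1a bH1] [X X0 HX]]; split.
    by exists (H1 *m invmx u); [exact: va|rewrite mulmxKV].
  exists (X *m invmx u).
    by apply: contraNneq X0 => e; rewrite -(mulmxKV uu X) e mul0mx.
  move=> W Wa; rewrite -{1}(mulmxK uu W) -hv HX ?ua //.
  by rewrite scalemxAl.
have sq (x : R) : x != 0 -> 0 < x ^+ 2 by move=> x0; rewrite exprn_even_gt0.
have pos beta : rroot br a beta -> 0 < beta (R0 *m u) * beta R0.
  move=> rb; have b0 : beta R0 != 0 by exact: R0reg.2.
  have b1 : beta (R0 *m u) != 0 by exact: (R0reg.2 _ (rootu _ rb)).
  have [bH'|bH'] := eqVneq (beta H') 0.
    by rewrite lt_neqAle sgn // andbT eq_sym mulf_neq0.
  have h1 : 0 <= beta H' * beta (R0 *m u) by rewrite -Hu; exact: (apH.2 _ (rootu _ rb)).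
  have h2 := apH'.2 _ rb.
  rewrite lt_neqAle eq_sym mulf_neq0 //= -(pmulr_rge0 _ (sq _ bH')).
  by have := mulr_ge0 h1 h2; rewrite mulrACA -expr2.
move=> W [Wa HW]; split=> [|beta rb]; first exact: ua.
have h1 := HW _ (rootu _ rb); have h2 := pos _ rb.
have b1 : beta (R0 *m u) != 0 by exact: (R0reg.2 _ (rootu _ rb)).
rewrite -(pmulr_rge0 _ (sq _ b1)).
have -> : beta (R0 *m u) ^+ 2 * (beta (W *m u) * beta R0) =
  (beta (W *m u) * beta (R0 *m u)) * (beta (R0 *m u) * beta R0) by ring.
by rewrite mulr_ge0 // ltW.
Qed.

(** Hunt's argument, applied to [R0 A], yields z in the identity component of the stabilizer of H'
    such that u = A z preserves the chamber ([weyl_stable]). The image of S under [u] is connected,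
    lies in the slice and contains 0, so X u is in S. The orbit of X A under the stabilizer
    component keeps the p-part H', hence stays in the slice, and joins X A to X u. *)
Lemma slice0_stable X A : S X -> Gam A -> T (X *m A) -> S (X *m A).
Proof.
move=> SX GA TXA; have TX := slice0_sub SX.
set H := pp X; set H' := H *m A.
have apH : ap H := TX.2.
have apH' : ap H' by rewrite /H' -ppart_mulmx //; exact: TXA.2.
have R0a : R0 \in a := R0reg.1.
have [] := @hunt _ _ _ br_lie k p HC _ G1 GM GP Gexp Gcl a a_p a_ab a_max _ R0reg
  H' (R0 *m A) apH'.1.
- have [_ _ Ap] := GP GA; exact/Ap/(subvP a_p).
- move=> D GD; rewrite /H' => H'D.
  have [[_ hA] _ _] := GP (GM GA GD).
  by rewrite -H'D -!mulmxA -hA (a_ab R0a apH.1) mul0mx.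
move=> z Qz [Yz sgn]; have [Gz H'z] := stab_component_sub Qz.
pose u := A *m z; have Gu : Gam u := GM GA Gz.
have Hu : H *m u = H' by rewrite /u mulmxA.
have wu : forall W, ap W -> ap (W *m u).
  apply: (weyl_stable Gu apH apH' Hu); first by rewrite mulmxA.
  by move=> beta rb b0; rewrite mulmxA; exact: sgn.
have SXu : S (X *m u).
  have : S `<=` (mulmx^~ u) @^-1` S.
    move=> Y SY; apply: (@connected_component_max _ _ ((mulmx^~ u) @` S)).
    - by exists 0; [exact: connected_component_refl slice_0|rewrite mul0mx].
    - move=> _ [W SW <-]; have [UW apW] := slice0_sub SW.
      by split; [exact: Uinv|rewrite /= ppart_mulmx //; exact: wu].
    - apply: connected_continuous_connected; first exact: component_connected.
      by apply/continuous_subspaceT/linear_continuous_rV => c W1 W2; rewrite mulmxDl scalemxAl.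
    - by exists Y.
  exact.
have eS : S = connected_component T (X *m u) by exact: same_connected_component.
rewrite eS; apply: (@connected_component_max _ _ ((mulmx (X *m A)) @` stab_component Gam H')).
- by exists z => //; rewrite mulmxA.
- move=> _ [w /stab_component_sub[Gw H'w] <-]; split.
    by apply: Uinv => //; exact: TXA.1.
  by rewrite /= ppart_mulmx // ppart_mulmx // -/H H'w.
- apply: connected_continuous_connected; first exact: component_connected.
  by apply: continuous_subspaceT; exact: mulmxl_continuous.
- by exists 1%:M; [exact: stab_component1|rewrite mulmx1].
Qed.

Hypothesis U_open : open U.

(** Nearby points of the slice are joined by a segment: [U] contains a ball and the chamber is
    convex. *)
Lemma slice_locally_connected X : T X ->
  \forall Y \near X, T Y -> connected_component T X Y.
Proof.
move=> [UX apX]; have [r /= r0 Hr] := (nbhs_ballP _ _).1 (open_nbhs_nbhs (conj U_open UX)).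
apply/nbhs_ballP; exists r => //= Y XY [UY apY].
pose c (t : R) : V := t *: Y + (1 - t) *: X.
apply: (@connected_component_max _ _ (c @` `[0, 1])).
- by exists 0; rewrite /= ?in_itv /= ?lexx ?ler01 // /c scale0r add0r subr0 scale1r.
- move=> _ [t ht <-]; have {ht} /andP[t0 t1] : 0 <= t <= 1 by have := ht; rewrite /= in_itv.
  split.
    apply: Hr; rewrite -ball_normE /= /c in XY *.
    have -> : X - (t *: Y + (1 - t) *: X) = t *: (X - Y).
      by apply/rowP => i; rewrite !mxE; ring.
    rewrite normrZ ger0_norm //; apply: le_lt_trans XY.
    by rewrite ler_piMl.
  rewrite /= (linear_add _ _ (ppart_linear k p)) !(linear_scale _ _ (ppart_linear k p)).
  exact: weyl_convex.
- apply: connected_continuous_connected; first exact: segment_connected.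
  have lc (Z : V) : continuous (fun t : R => t *: Z).
    by move=> t; apply: cvgZr_tmp; exact: cvg_id.
  apply: continuous_subspaceT => t; apply: cvgD; first exact: lc.
  have -> : (fun t : R => (1 - t) *: X) = (fun t => X - t *: X).
    by apply/funext => s; rewrite scalerBl scale1r.
  by rewrite scalerBl scale1r; apply: cvgB; [exact: cvg_cst|exact: lc].
- by exists 1; rewrite /= ?in_itv /= ?lexx ?ler01 // /c subrr scale0r addr0 scale1r.
Qed.

(** A tube-lemma argument over the compact group [Gam]. *)
Lemma saturation_closed (F : set V) : closed F ->
  closed [set X | exists2 A, Gam A & F (X *m A)].
Proof.
move=> Fcl; rewrite -openC openE => X nX.
have cvr := (compact_near_coveringP _).1 (Gam_compact br_lie HC GP Gcl).
have H0 := cvr _ (nbhs X) (fun (X : V) A => ~ F (X *m A)) (nbhs_filter X).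
apply: filterS (H0 _) => [Y HY [D GD FYD]|A GA]; first exact: (HY D GD FYD).
have nF : (~` F) (X *m A) by move=> FXA; apply: nX; exists A.
have FF : Filter (filter_prod (nbhs A) (nbhs X)) by exact: filter_prod_filter.
have cv : (fun q : 'M[R]_n * V => q.2 *m q.1) @ (filter_prod (nbhs A) (nbhs X)) --> X *m A.
  by apply: cvg_mulmx; [exact: cvg_snd|exact: cvg_fst].
exact: (cv _ (open_nbhs_nbhs (conj (closed_openC Fcl) nF))).
Qed.

Hypothesis U_connected : connected U.

(** Hunt's argument with H' = 0, which commutes with everything and on which all roots vanish, so
    all sign conditions are obtained. *)
Lemma slice_move X : U X -> exists2 A, Gam A & T (X *m A).
Proof.
move=> UX; have R0a : R0 \in a := R0reg.1.
have [] := @hunt _ _ _ br_lie k p HC _ G1 GM GP Gexp Gcl a a_p a_ab a_max _ R0reg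
  0 (pp X) (mem0v _) (ppart_mem k p X).
  by move=> A _ _; rewrite (br0r br_lie).
move=> z /stab_component_sub[Gz _] [za sgn]; exists z => //; split; first exact: Uinv.
rewrite /= ppart_mulmx //; split=> // al ral; apply: sgn => //.
exact: (rroot0 br_lie ral).
Qed.

(** The saturation of S is open and closed in the connected set [U]. Its complement in [U] is the
    saturation of the closure of T \ S: [slice_move] covers [U] by the two, while [slice0_stable]
    and [slice_locally_connected] keep them apart. Both are closed by [saturation_closed]. *)
Theorem slice0_saturation X : U X -> exists2 A, Gam A & S (X *m A).
Proof.
pose C1 := [set X | U X /\ exists2 A, Gam A & S (X *m A)].
suff -> : U = C1 by case.
have S0 : S 0 by exact: connected_component_refl slice_0.
apply/esym/U_connected.
- by exists 0; split=> //; exists 1%:M => //; rewrite mulmx1.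
- exists (~` [set X | exists2 A, Gam A & closure (T `\` S) (X *m A)]).
    by apply: closed_openC; apply: saturation_closed; exact: closed_closure.
  apply/seteqP; split=> Y [UY].
    move=> [A GA SYA]; split=> // -[D GD clD].
    have apYD : ap (pp (Y *m D)).
      have cl : closed (pp @^-1` ap).
        apply: closed_preimage weyl_closed.
        exact: (linear_continuous_rV (ppart_linear k p)).
      apply: cl.
      by apply: closure_subset clD => Z [[_ apZ] _].
    have TYD : T (Y *m D) by split=> //; exact: Uinv.
    have SYD : S (Y *m D).
      have e : Y *m D = Y *m A *m (invmx A *m D).
        by rewrite mulmxA mulmxK //; exact: GamK GP _ GA.
      rewrite e; apply: slice0_stable => //; last by rewrite -e.
      by apply: GM => //; exact: GV.
    have [Z [[TZ nSZ] ]] := clD _ (slice_locally_connected TYD).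
    move=> /(_ TZ) cZ; apply: nSZ.
    exact: connected_component_trans SYD cZ.
  move=> nC; split=> //; have [A GA TYA] := slice_move UY.
  exists A => //; apply: contrapT => nS; apply: nC; exists A => //.
  exact: subset_closure.
- exists [set X | exists2 A, Gam A & closure S (X *m A)].
    by apply: saturation_closed; exact: closed_closure.
  apply/seteqP; split=> Y [UY [A GA]].
    by move=> SYA; split=> //; exists A => //; exact: subset_closure.
  move=> clA; split=> //; exists A => //.
  have apYA : ap (pp (Y *m A)).
    have cl : closed (pp @^-1` ap).
      apply: closed_preimage weyl_closed.
      exact: (linear_continuous_rV (ppart_linear k p)).
    apply: cl.
    by apply: closure_subset clA => Z /slice0_sub[].
  have TYA : T (Y *m A) by split=> //; exact: Uinv.
  have [Z [SZ]] := clA _ (slice_locally_connected TYA).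
  move=> /(_ (slice0_sub SZ)) cZ.
  exact: connected_component_trans SZ (connected_component_sym cZ).
Qed.

End Stability.
End WeylSlice.

(** * The Hilbert-Schmidt form and closedness of the group *)

Section HilbertSchmidt.
Context {R : realType} {n : nat}.
Implicit Types A E F : 'M[R]_n.

Definition hs E F : R := \tr (E *m F^T).

Lemma hsE E F : hs E F = \sum_i \sum_j E i j * F i j.
Proof.
by apply: eq_bigr => i _; rewrite mxE; apply: eq_bigr => j _; rewrite mxE.
Qed.

Lemma hsC E F : hs E F = hs F E.
Proof. by rewrite !hsE; apply: eq_bigr => i _; apply: eq_bigr => j _; rewrite mulrC. Qed.

Lemma hsDr E F F' : hs E (F + F') = hs E F + hs E F'.
Proof. by rewrite /hs linearD mulmxDr mxtraceD. Qed.

Lemma hsZr c E F : hs E (c *: F) = c * hs E F.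
Proof. by rewrite /hs linearZ /= -scalemxAr mxtraceZ. Qed.

Lemma hsDl E E' F : hs (E + E') F = hs E F + hs E' F.
Proof. by rewrite !(hsC _ F) hsDr. Qed.

Lemma hsZl c E F : hs (c *: E) F = c * hs E F.
Proof. by rewrite !(hsC _ F) hsZr. Qed.

Lemma hs_ge0 E : 0 <= hs E E.
Proof. by rewrite hsE; apply: sumr_ge0 => i _; apply: sumr_ge0 => j _; exact: sqr_ge0. Qed.

Lemma norm_le_hs E : `|E| <= Num.sqrt (hs E E).
Proof.
apply/mx_norm_leP => [|i j]; first exact: sqrtr_ge0.
rewrite -sqrtr_sqr ler_wsqrtr // hsE (bigD1 i) //= (bigD1 j) //= -expr2 -addrA lerDl.
apply: addr_ge0; first by apply: sumr_ge0 => j' _; exact: sqr_ge0.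
by apply: sumr_ge0 => i' _; apply: sumr_ge0 => j' _; exact: sqr_ge0.
Qed.

Lemma hs_le E F : `|hs E F| <= n%:R ^+ 2 * (`|E| * `|F|).
Proof.
rewrite hsE; apply: le_trans (ler_norm_sum _ _ _) _.
have -> : n%:R ^+ 2 * (`|E| * `|F|) = \sum_(i < n) (n%:R * (`|E| * `|F|)).
  by rewrite sumr_const card_ord -[RHS]mulr_natl expr2 -mulrA.
apply: ler_sum => i _; apply: le_trans (ler_norm_sum _ _ _) _.
have -> : n%:R * (`|E| * `|F|) = \sum_(i < n) (`|E| * `|F|).
  by rewrite sumr_const card_ord mulr_natl.
by apply: ler_sum => j _; rewrite normrM ler_pM // coord_norm_le.
Qed.

Lemma sqrt_hs_le E : Num.sqrt (hs E E) <= n%:R * `|E|.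
Proof.
have nE : 0 <= n%:R * `|E| by rewrite mulr_ge0.
rewrite -[X in _ <= X](ger0_norm nE) -sqrtr_sqr ler_wsqrtr //.
rewrite exprMn [`|E| ^+ 2]expr2; apply: le_trans (hs_le E E); exact: ler_norm.
Qed.

Lemma hs_eq0 E : hs E E = 0 -> E = 0.
Proof.
move=> e; apply/eqP; rewrite -normr_le0; apply: le_trans (norm_le_hs E) _.
by rewrite e sqrtr0.
Qed.

Lemma cvg_hs (T : Type) (F : set_system T) {FF : Filter F}
    (f g : T -> 'M[R]_n) (a b : 'M[R]_n) :
  f @ F --> a -> g @ F --> b -> (fun t => hs (f t) (g t)) @ F --> hs a b.
Proof.
move=> fa gb; rewrite hsE; under eq_fun do rewrite hsE.
apply: (cvg_big (op := +%R) (U := R^o)) => [|i _]; first exact: add_continuous.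
apply: (cvg_big (op := +%R) (U := R^o)) => [|l _]; first exact: add_continuous.
by apply: cvgM; apply: mx_cvg_coord.
Qed.

End HilbertSchmidt.

Lemma family_bound (R : realType) (I : finType) (N : nat) (psi : I -> 'rV[R]_N -> R) :
  (forall i, continuous (psi i)) -> (forall i x, 0 <= psi i x) ->
  (forall i t x, psi i (t *: x) = `|t| * psi i x) ->
  (forall x, (forall i, psi i x = 0) -> x = 0) ->
  exists2 c : R, 0 < c & forall x, c * `|x| <= \sum_i psi i x.
Proof.
move=> pc p0 pZ pinj.
apply: (@sphere_bound _ _ (fun x => \sum_i psi i x) 0).
- apply: (continuous_big (op := +%R) (U := R^o)) => [|l _]; first exact: add_continuous.
  exact: pc.
- move=> x x0; rewrite lt_neqAle sumr_ge0 // andbT eq_sym.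
  apply: contraNneq x0 => s0; apply/eqP/pinj => i.
  by apply: (psumr_eq0P _ s0).
- move=> t x; rewrite mulr_sumr; apply: eq_bigr => i _; exact: pZ.
Qed.

Section Closedness.
Context {R : realType} {n : nat}.
Local Notation V := 'rV[R]_n.
Local Notation h k := ((2^-1 : R) ^+ k).
Variable br : V -> V -> V.
Hypothesis br_lie : lie_bracket br.
Local Notation "[ X , Y ]" := (br X Y).
Variables (k p : {vspace V}).
Hypothesis HC : cartan br k p.
Local Notation kp := (kpart k p).
Local Notation pp := (ppart k p).
Local Notation b i := (delta_mx 0 i : V).

(** The closed conditions in [preserves]: without invertibility they pass to limits of elements of
    [Gam]. *)
Definition premorphism (A : 'M[R]_n) := [/\ forall U W, [U, W] *m A = [U *m A, W *m A],
  forall X, X \in k -> X *m A \in k & forall X, X \in p -> X *m A \in p].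

Lemma row_basis (X : V) : X = \sum_i X 0 i *: b i.
Proof. exact: row_sum_delta. Qed.

(** The failure of [E] to be a derivation. *)
Definition dev (E : 'M[R]_n) X Y : V := [X, Y] *m E - [X *m E, Y] - [X, Y *m E].

Lemma dev_linear_l E Y : linear ((dev E) ^~ Y).
Proof.
move=> c X X'; rewrite /dev mulmxDl -scalemxAl !(brDl br_lie) !(brZl br_lie).
rewrite mulmxDl -scalemxAl !scalerBr; apply/rowP => i; rewrite !mxE; ring.
Qed.

Lemma dev_linear_r E X : linear (dev E X).
Proof.
move=> c Y Y'; rewrite /dev mulmxDl -scalemxAl !(brDr br_lie) !(brZr br_lie).
rewrite mulmxDl -scalemxAl !scalerBr; apply/rowP => i; rewrite !mxE; ring.
Qed.

Lemma dev_linear X Y : linear (fun E => dev E X Y).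
Proof.
move=> c E F; rewrite /dev !mulmxDr -!scalemxAr (brDl br_lie) (brZl br_lie).
rewrite (brDr br_lie) (brZr br_lie).
rewrite !scalerBr; apply/rowP => i; rewrite !mxE; ring.
Qed.

Lemma devZ c E X Y : dev (c *: E) X Y = c *: dev E X Y.
Proof. by rewrite /dev -!scalemxAr (brZl br_lie) (brZr br_lie) -!scalerBr. Qed.

(** Joint vanishing makes [E] a derivation that preserves k and p and is orthogonal to ad k; by
    [derivation_inner] it belongs to ad k, so it is 0. By compactness the sum of the defects then
    controls the norm of [E]. *)
Definition defect (ij : 'I_n * 'I_n) (E : 'M[R]_n) : R :=
  `|dev E (b ij.1) (b ij.2)| + `|hs E (adm br (kp (b ij.1)))| +
  (`|pp (kp (b ij.1) *m E)| + `|kp (pp (b ij.1) *m E)|).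

Lemma linear_vanish (W : normedModType R) (f : V -> W) : linear f ->
  (forall i, f (b i) = 0) -> forall X, f X = 0.
Proof.
move=> fl f0 X; pose L : {linear V -> W} := HB.pack f (GRing.isLinear.Build _ _ _ _ _ fl).
rewrite (row_basis X) -[f _]/(L _) linear_sum big1 // => i _.
by rewrite linearZ /= f0 scaler0.
Qed.

Lemma defect_eq0 E : (forall ij, defect ij E = 0) -> E = 0.
Proof.
move=> d0.
have parts i j : [/\ dev E (b i) (b j) = 0, hs E (adm br (kp (b i))) = 0,
    pp (kp (b i) *m E) = 0 & kp (pp (b i) *m E) = 0].
  have := d0 (i, j); rewrite /defect /= => /eqP.
  rewrite !paddr_eq0 ?addr_ge0 // !normr_eq0.
  by move=> /andP[/andP[/eqP ? /eqP ?] /andP[/eqP ? /eqP ?]].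
have kl := kpart_linear k p; have pl := ppart_linear k p.
have dev0 X Y : dev E X Y = 0.
  apply: (linear_vanish (dev_linear_l E Y)) => i.
  by apply: (linear_vanish (dev_linear_r E (b i))) => j; case: (parts i j).
have Ek X : X \in k -> X *m E \in k.
  move=> Xk; have : pp (kp X *m E) = 0.
    apply: (linear_vanish (f := fun X => pp (kp X *m E))) => [c Y Z|i].
      by rewrite kl mulmxDl -scalemxAl pl.
    by case: (parts i i).
  rewrite (kpart_id HC Xk) => p0; rewrite -(kpart_add HC (X *m E)) p0 addr0.
  exact: kpart_mem.
have Ep X : X \in p -> X *m E \in p.
  move=> Xp; have : kp (pp X *m E) = 0.
    apply: (linear_vanish (f := fun X => kp (pp X *m E))) => [c Y Z|i].
      by rewrite pl mulmxDl -scalemxAl kl.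
    by case: (parts i i).
  rewrite (ppart_id HC Xp) => k0; rewrite -(kpart_add HC (X *m E)) k0 add0r.
  exact: ppart_mem.
have [|Z Zk EZ] := @derivation_inner _ _ _ br_lie k p HC (mulmx^~ E) _ Ek Ep.
  split=> [c X Y|X Y]; first by rewrite mulmxDl scalemxAl.
  have /eqP := dev0 X Y; rewrite /dev -addrA -opprD subr_eq0 => /eqP.
  by [].
have eE : E = adm br Z.
  by apply/row_matrixP => i; rewrite !rowE mul_adm // EZ.
have h0 X : hs E (adm br (kp X)) = 0.
  apply: (linear_vanish (f := fun X => hs E (adm br (kp X)) : R^o)) => [c X1 X2|i].
    by rewrite kl adm_linear // hsDr hsZr.
  by case: (parts i i).
by apply: hs_eq0; rewrite {2}eE -(kpart_id HC Zk) h0.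
Qed.

Lemma defect_bound : exists2 c : R, 0 < c & forall E, c * `|E| <= \sum_ij defect ij E.
Proof.
have kl := kpart_linear k p; have pl := ppart_linear k p.
have [|||x x0|c c0 Hc] := @family_bound R _ (n * n) (fun ij x => defect ij (vec_mx x)).
- move=> ij x; rewrite /defect.
  have nc (W : normedModType R) (f : 'rV[R]_(n * n) -> W) : linear f ->
      {for x, continuous (fun x => `|f x|)}.
    by move=> fl; have fc : continuous f := linear_continuous_rV fl; exact: (cvg_norm (fc x)).
  have fd (f g : 'rV[R]_(n * n) -> R) : {for x, continuous f} -> {for x, continuous g} ->
      {for x, continuous (fun y => f y + g y)}.
    by move=> fx gx; exact: (cvgD fx gx).
  apply: (fd); apply: (fd); apply: (nc) => c u v; rewrite linearP /=.
  + exact: dev_linear.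
  + by rewrite hsDl hsZl.
  + by rewrite mulmxDr -scalemxAr pl.
  + by rewrite mulmxDr -scalemxAr kl.
- by move=> ij x; rewrite /defect !addr_ge0.
- move=> ij t x; rewrite linearZ /= /defect.
  rewrite devZ hsZl -!scalemxAr (linear_scale _ _ pl) (linear_scale _ _ kl) !normrZ.
  by rewrite !mulrDr.
- by rewrite -[x]vec_mxK (defect_eq0 x0) linear0.
exists c => // E; have := Hc (mxvec E); rewrite mxvecK; apply: le_trans.
apply: ler_wpM2l; first exact: ltW.
apply/mx_norm_leP => // i j; apply: le_trans (coord_norm_le _ 0 (mxvec_index i j)).
by rewrite mxvecE.
Qed.

Lemma adm_bound : exists2 C : R, 0 <= C & forall X, `|adm br X| <= C * `|X|.
Proof.
exists (\sum_i `|adm br (b i)|) => [|X]; first by apply: sumr_ge0.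
pose L : {linear V -> 'M[R]_n} := HB.pack (adm br) (GRing.isLinear.Build _ _ _ _ _ (adm_linear br_lie)).
rewrite [X in adm br X](row_basis X) -[adm br _]/(L _) linear_sum mulr_suml.
apply: le_trans (ler_norm_sum _ _ _) _; apply: ler_sum => i _.
rewrite linearZ normrZ mulrC; apply: ler_wpM2l => //; exact: coord_norm_le.
Qed.

Variable Gam : set 'M[R]_n.
Hypothesis GM : forall A D, Gam A -> Gam D -> Gam (A *m D).
Hypothesis GV : forall A, Gam A -> Gam (invmx A).
Hypothesis GP : forall A, Gam A -> preserves br k p A.

(* [N] plays the role of the image of a compact neighbourhood of 1 in K. *)
Hypothesis Gnbhd : exists (N : set 'M[R]_n) (d : R),
  [/\ compact N, N `<=` Gam, N 1%:M, 0 < d & forall D, N D -> `|D - 1%:M| < d ->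
    forall Z, Z \in k -> exists2 c, one_parameter_mx br Gam Z c &
      \forall t \near 0, N (D *m c t)].

Lemma premorphism_mul A D : premorphism A -> Gam D -> premorphism (A *m D).
Proof.
move=> [hA Ak Ap] /GP[[_ hD] Dk Dp]; split=> [U W|X Xk|X Xp].
- by rewrite !mulmxA hA hD.
- by rewrite mulmxA; apply/Dk/Ak.
- by rewrite mulmxA; apply/Dp/Ap.
Qed.

(** When 1 + E is multiplicative, the deviation of [E] from a derivation is [b_i E, b_j E]. The
    terms testing k and p vanish, and the orthogonality hypothesis replaces the pairing of [E] with
    ad Z by minus its pairing with E ad Z. Everything left is quadratic. *)
Lemma defect_quadratic : exists2 C : R, 0 <= C & forall E, premorphism (1%:M + E) ->
  (forall Z, Z \in k -> hs E ((1%:M + E) *m adm br Z) = 0) ->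
  \sum_ij defect ij E <= C * `|E| ^+ 2.
Proof.
have [Ca Ca0 HCa] := adm_bound.
pose S := \sum_i `|adm br (kp (b i))|.
have S0 : 0 <= S by exact: sumr_ge0.
pose C := n%:R * Ca + n%:R ^+ 2 * (n%:R * S).
have C0 : 0 <= C by rewrite /C addr_ge0 ?mulr_ge0 // exprn_ge0.
exists (\sum_(ij : 'I_n * 'I_n) C); first exact: sumr_ge0.
move=> E [hE Ek Ep] vE; rewrite mulr_suml; apply: ler_sum => -[i j] _.
have bE l : `|b l *m E| <= `|E|.
  by rewrite -rowE; apply/mx_norm_leP => // i' j'; rewrite mxE; exact: coord_norm_le.
have mE X : X *m (1%:M + E) = X + X *m E by rewrite mulmxDr mulmx1.
have -> : defect (i, j) E = `|dev E (b i) (b j)| + `|hs E (adm br (kp (b i)))|.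
  rewrite /defect /=.
  have hk X : X \in k -> X *m E \in k.
    by move=> Xk; have := Ek X Xk; rewrite mE rpredDl.
  have hp X : X \in p -> X *m E \in p.
    by move=> Xp; have := Ep X Xp; rewrite mE rpredDl.
  rewrite (ppart_k HC (hk _ (kpart_mem k p _))) (kpart_p HC (hp _ (ppart_mem k p _))).
  by rewrite normr0 !addr0.
have devE : dev E (b i) (b j) = [b i *m E, b j *m E].
  rewrite /dev; have := hE (b i) (b j); rewrite !mE !(brDl br_lie) !(brDr br_lie).
  move=> e; rewrite -[br (b i) (b j) *m E](addKr [b i, b j]) e.
  apply/rowP => l; rewrite !mxE; ring.
rewrite /C mulrDl; apply: lerD.
  rewrite devE -(mul_adm br_lie); apply: le_trans (mulmx_norm_le _ _) _.
  have -> : n%:R * Ca * `|E| ^+ 2 = n%:R * (`|E| * (Ca * `|E|)) by ring.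
  apply: ler_wpM2l => //; apply: ler_pM => //; apply: le_trans (HCa _) _.
  by apply: ler_wpM2l.
have := vE _ (kpart_mem k p (b i)); rewrite mulmxDl mul1mx hsDr => /eqP.
rewrite addr_eq0 => /eqP ->; rewrite normrN; apply: le_trans (hs_le _ _) _.
have -> : n%:R ^+ 2 * (n%:R * S) * `|E| ^+ 2 = n%:R ^+ 2 * (`|E| * (n%:R * (`|E| * S))) by ring.
apply: ler_wpM2l; first exact: exprn_ge0.
apply: ler_wpM2l => //; apply: le_trans (mulmx_norm_le _ _) _.
do 2!apply: ler_wpM2l => //.
by rewrite /S (bigD1 i) //= lerDl sumr_ge0.
Qed.

Lemma first_variation A D Z (N : set 'M[R]_n) c : one_parameter_mx br Gam Z c ->
  (forall D', N D' -> hs (A *m D - 1%:M) (A *m D - 1%:M) <=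
                      hs (A *m D' - 1%:M) (A *m D' - 1%:M)) ->
  (\forall t \near 0, N (D *m c t)) ->
  0 <= hs (A *m D - 1%:M) (A *m D *m adm br Z).
Proof.
move=> oc Dmin near; have [cc cG cD cT] := oc.
set E := A *m D - 1%:M; set F := A *m D.
have := cT 1; rewrite scale1r => cT1.
pose x j := (2 ^ j)%:R *: (c (1 * h j) - 1%:M).
have Fx : (fun j => F *m x j) @ \oo --> F *m adm br Z.
  by apply: cvg_mulmx => //; exact: cvg_cst.
(* This is 2^j times the increment of the squared distance along the curve at time 2^-j. *)
pose u j : R := 2 * hs E (F *m x j) + h j * hs (F *m x j) (F *m x j).
have cu : u @ \oo --> 2 * hs E (F *m adm br Z).
  rewrite -[X in _ --> X]addr0; apply: cvgD.
    by apply: cvgMr; apply: cvg_hs => //; exact: cvg_cst.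
  rewrite -(mul0r (hs (F *m adm br Z) (F *m adm br Z))); apply: cvgM.
    by have := @half_cvg0 R 1; under eq_fun do rewrite mul1r.
  exact: cvg_hs.
rewrite -(pmulr_rge0 _ (ltr0n R 2)); rewrite -(cvg_lim (@Rhausdorff R) cu).
apply: limr_ge; first exact: cvgP cu.
have hj : (fun j => 1 * h j : R) @ \oo --> (0 : R) := half_cvg0 1.
have Hj : \forall j \near \oo, N (D *m c (1 * h j)) := hj _ near.
apply: filterS Hj => j Nj; have := Dmin _ Nj; rewrite -/E.
have -> : A *m (D *m c (1 * h j)) - 1%:M = E + h j *: (F *m x j).
  rewrite /x -scalemxAr scalerA [h j * _]mulrC half_pow scale1r mulmxBr mulmx1.
  by rewrite /E [RHS]addrC subrKA mulmxA.
clearbody E; rewrite hsDr !hsDl !hsZr !hsZl [hs (F *m _) E]hsC => H.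
have h0 : 0 < h j by rewrite exprn_gt0.
rewrite -(pmulr_rge0 _ h0); move: H; rewrite /u; set s := hs E E; set t := hs E _; set w := hs _ _.
by rewrite -subr_ge0; congr (0 <= _); ring.
Qed.

(** Correct [A] by the [D] in the compact set [N] that brings A D closest to 1. For [A] near 1 the
    minimiser is near 1, where motions in all directions of k stay in [N], so it is critical. The
    error E = A D - 1 then satisfies c |E| <= C |E|^2, which forces E = 0 once |E| is small, and A
    is the inverse of D. *)
Lemma near1_Gam : exists2 eps : R, 0 < eps &
  forall A, premorphism A -> `|A - 1%:M| < eps -> Gam A.
Proof.
have [M M0 HM] := Gam_bounded br_lie HC GP.
have [c c0 Hc] := defect_bound; have [C C0 HCq] := defect_quadratic.
have [N [d [Ncpt NG N1 d0 HN]]] := Gnbhd.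
(* Chosen to bound both |E| <= n |A - 1| and |D - 1| <= |E| + n |A - 1| M. *)
pose K : R := n%:R * (1 + M) + 1.
have K0 : 0 < K by rewrite ltr_wpDl // mulr_ge0 // addr_ge0 // ltW.
exists (Num.min d (c / (C + 1)) / K).
  by rewrite divr_gt0 // lt_min d0 divr_gt0 // ltr_wpDl.
move=> A PA; rewrite ltr_pdivlMr // => small.
pose f (D : 'M[R]_n) := hs (A *m D - 1%:M) (A *m D - 1%:M).
have fc : continuous f.
  move=> D; have AD : (fun D : 'M[R]_n => A *m D - 1%:M) @ D --> A *m D - 1%:M.
    have c1 : continuous (fun B : 'M[R]_n => A *m B) by exact: mulmxl_continuous.
    have := @cvgB R 'M[R]_n _ (nbhs D) (nbhs_filter D) _ (fun=> 1%:M) _ _ (c1 D).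
    by apply; exact: cvg_cst.
  exact: (cvg_hs AD AD).
have [D ND0 Dmin] := compact_EVT_min (ex_intro _ _ N1) Ncpt (continuous_subspaceT fc).
have ND : N D by rewrite inE in ND0.
have {}Dmin D' : N D' -> f D <= f D' by move=> ND'; apply: Dmin; rewrite inE.
have GD := NG _ ND.
set E := A *m D - 1%:M.
have e1 : A *m D = 1%:M + E by rewrite /E addrC subrK.
have Esmall : `|E| <= n%:R * `|A - 1%:M|.
  apply: le_trans (norm_le_hs E) _.
  have := Dmin _ N1; rewrite /f mulmx1 -/E => /ler_wsqrtr /le_trans; apply.
  exact: sqrt_hs_le.
have KE : `|E| < Num.min d (c / (C + 1)).
  apply: le_lt_trans Esmall _; apply: le_lt_trans small; rewrite mulrC.
  apply: ler_wpM2l => //; rewrite /K mulrDr mulr1 -addrA lerDl.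
  by rewrite addr_ge0 // mulr_ge0 // ltW.
have D1 : `|D - 1%:M| < d.
  have -> : D - 1%:M = E - (A - 1%:M) *m D.
    by rewrite mulmxBl mul1mx /E opprB [RHS]addrC subrKA.
  apply: le_lt_trans (ler_normB _ _) _.
  apply: (@le_lt_trans _ _ (`|A - 1%:M| * K)); last first.
    by apply: lt_le_trans small _; rewrite ge_min lexx.
  rewrite /K mulrDr mulr1; apply: ler_wpDr => //.
  rewrite mulrDr mulr1 mulrDr [_ * n%:R]mulrC; apply: lerD => //.
  apply: le_trans (mulmx_norm_le _ _) _; rewrite [X in _ <= X]mulrCA.
  apply: ler_wpM2l => //; apply: ler_wpM2l => //; exact: HM.
have vE Z : Z \in k -> hs E ((1%:M + E) *m adm br Z) = 0.
  move=> Zk; rewrite -e1.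
  have pos Z' : Z' \in k -> 0 <= hs E (A *m D *m adm br Z').
    move=> Z'k; have [c' oc' near] := HN D ND D1 Z' Z'k.
    exact: (first_variation oc' Dmin near).
  apply/eqP; rewrite eq_le pos // andbT.
  have := pos (- Z); rewrite memvN => /(_ Zk).
  have -> : adm br (- Z) = - adm br Z.
    by apply/row_matrixP => i; rewrite !rowE mulmxN !(mul_adm br_lie) (brNl br_lie).
  by rewrite mulmxN -scaleN1r hsZr mulN1r oppr_ge0.
have PE : premorphism (1%:M + E) by rewrite -e1; exact: premorphism_mul.
have E0 : E = 0.
  apply/eqP; rewrite -normr_eq0; apply/negPn/negP => nE.
  have nE0 : 0 < `|E| by rewrite lt_neqAle eq_sym nE /=.
  have := le_trans (Hc E) (HCq E PE vE); rewrite expr2 mulrA ler_pM2r //.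
  apply/negP; rewrite -ltNge; apply: (@le_lt_trans _ _ ((C + 1) * `|E|)).
    by rewrite mulrDl lerDl mul1r.
  rewrite mulrC -ltr_pdivlMr ?ltr_wpDl //.
  by apply: lt_le_trans KE _; rewrite ge_min lexx orbT.
have AD1 : A *m D = 1%:M by rewrite e1 E0 addr0.
have uD := GamK GP GD.
have -> : A = invmx D by rewrite -[A](mulmxK uD) AD1 mul1mx.
exact: GV.
Qed.

(** If [D] in the group is close to the limit point [A], then A D^-1 is a premorphism close to 1, so
    [near1_Gam] applies to it. *)
Theorem Gam_closed : closed Gam.
Proof.
have [eps eps0 Heps] := near1_Gam.
have [M M0 HM] := Gam_bounded br_lie HC GP.
move=> A clA.
have PA : premorphism A.
  split=> [U W|X Xk|X Xp].
  - pose f (A : 'M[R]_n) : V := [U, W] *m A - (W *m A) *m adm br (U *m A).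
    have fc : continuous f.
      move=> D; have mc (Y : V) : (fun A : 'M[R]_n => Y *m A) @ D --> Y *m D.
        exact: mulmxl_continuous.
      have ac : continuous (adm br) := linear_continuous_rV (adm_linear br_lie).
      have c2 : (fun A : 'M[R]_n => (W *m A) *m adm br (U *m A)) @ D -->
          (W *m D) *m adm br (U *m D).
        exact: (cvg_mulmx (mc W) (cvg_comp _ _ (mc U) (ac (U *m D)))).
      have := @cvgB R V _ (nbhs D) (nbhs_filter D) _ _ _ _ (mc [U, W]) c2.
      exact.
    have cl : closed (f @^-1` [set 0]).
      by apply: closed_preimage => //; exact/accessible_closed_set1/hausdorff_accessible/norm_hausdorff.
    have fE D : f D = [U, W] *m D - [U *m D, W *m D] by rewrite /f mul_adm.
    apply/eqP; rewrite -subr_eq0 -fE; apply/eqP; apply: cl.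
    by apply: closure_subset clA => D /GP[[_ hD] _ _] /=; rewrite fE hD subrr.
  - have cl : closed ((fun B : 'M[R]_n => X *m B) @^-1` [set Y : V | Y \in k]).
      apply: closed_preimage; first exact: mulmxl_continuous.
      exact: vspace_closed.
    by apply: cl; apply: closure_subset clA => D /GP[_ Dk _] /=; exact: Dk.
  - have cl : closed ((fun B : 'M[R]_n => X *m B) @^-1` [set Y : V | Y \in p]).
      apply: closed_preimage; first exact: mulmxl_continuous.
      exact: vspace_closed.
    by apply: cl; apply: closure_subset clA => D /GP[_ _ Dp] /=; exact: Dp.
pose r := eps / (n%:R * M + 1).
have q0 : 0 < n%:R * M + 1 by rewrite ltr_wpDl // mulr_ge0 // ltW.
have r0 : 0 < r by rewrite divr_gt0.
have [D [GD AD]] := clA _ (nbhsx_ballx A r r0).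
have uD := GamK GP GD.
rewrite -(mulmxKV uD A); apply: GM => //; apply: Heps.
  by apply: premorphism_mul => //; exact: GV.
have -> : A *m invmx D - 1%:M = (A - D) *m invmx D by rewrite mulmxBl mulmxV.
apply: le_lt_trans (mulmx_norm_le _ _) _.
have AD' : `|A - D| < r by move: AD; rewrite -ball_normE.
apply: (@le_lt_trans _ _ (`|A - D| * (n%:R * M + 1))); last by rewrite -ltr_pdivlMr.
rewrite mulrCA; apply: ler_wpM2l => //; apply: ler_wpDr => //.
apply: ler_wpM2l => //; exact/HM/GV.
Qed.

End Closedness.

(** * The adjoint group Ad(K) as a matrix group *)

Lemma linear_bound (R : realType) (m : nat) (W : normedModType R) (f : 'rV[R]_m -> W) :
  linear f -> exists2 C : R, 0 <= C & forall X, `|f X| <= C * `|X|.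
Proof.
move=> fl; exists (\sum_i `|f (delta_mx 0 i)|) => [|X]; first exact: sumr_ge0.
pose L : {linear 'rV[R]_m -> W} := HB.pack f (GRing.isLinear.Build _ _ _ _ _ fl).
rewrite [X in f X]row_sum_delta -[f _]/(L _) linear_sum mulr_suml.
apply: le_trans (ler_norm_sum _ _ _) _; apply: ler_sum => i _.
rewrite linearZ normrZ mulrC; apply: ler_wpM2l => //; exact: coord_norm_le.
Qed.

(** An automorphism preserves B, and an element B-orthogonal to k has no k-part because B is
    definite on k. *)
Lemma preserves_cartan (R : realType) (n : nat) (br : 'rV[R]_n -> 'rV[R]_n -> 'rV[R]_n)
    (k p : {vspace 'rV[R]_n}) (A : 'M[R]_n) :
  lie_bracket br -> cartan br k p -> automorphism br A ->
  (forall X, X \in k -> X *m A \in k) -> (forall X, X \in k -> X *m invmx A \in k) ->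
  preserves br k p A.
Proof.
move=> br_lie HC hA Ak iAk; split=> // X Xp; have [uA _] := hA.
set Y := X *m A.
have orth Z : Z \in k -> kform br Y Z = 0.
  move=> Zk; rewrite -(mulmxKV uA Z) (kform_automorphism br_lie _ _ hA).
  by rewrite (kform_pk br_lie HC) // iAk.
have k0 : kpart k p Y = 0.
  apply/eqP/negPn/negP => kn; have [_ _ _ _ [Bk _]] := HC.
  have := Bk _ (kpart_mem k p Y) kn.
  have := orth _ (kpart_mem k p Y).
  rewrite -{1}(kpart_add HC Y) (linear_add _ _ (kform_linear_l br_lie _)).
  rewrite (kform_pk br_lie HC (ppart_mem k p Y) (kpart_mem k p Y)) addr0 => ->.
  by rewrite ltxx.
by rewrite -(kpart_add HC Y) k0 add0r ppart_mem.
Qed.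

Section Adjoint.
Context {R : realType} {n : nat} {G : lieGroup 'rV[R]_n}.
Local Notation V := 'rV[R]_n.

(** Acting on row vectors from the right, [Adm] reverses products. The lock keeps the matrix from
    being unfolded. *)
Definition Adm : G -> 'M[R]_n := locked (fun g => lin1_mx (Ad g)).

Lemma mul_Adm (g : G) (u : V) : u *m Adm g = Ad g u.
Proof. by rewrite /Adm -lock; exact: mul_lin1 (Ad_linear g). Qed.

Lemma AdmM (g h : G) : Adm (g * h)%g = Adm h *m Adm g.
Proof. by apply/row_matrixP => i; rewrite !rowE mulmxA !mul_Adm AdM. Qed.

Lemma Adm1 : Adm 1%g = 1%:M.
Proof. by apply/row_matrixP => i; rewrite !rowE mul_Adm Ad1 mulmx1. Qed.

Lemma Adm_unit (g : G) : Adm g \in unitmx.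
Proof.
suff : Adm g *m Adm g^-1%g = 1%:M by move=> /mulmx1_unit[].
by rewrite -AdmM mulVg Adm1.
Qed.

Lemma AdmV (g : G) : Adm g^-1%g = invmx (Adm g).
Proof.
have e : Adm g *m Adm g^-1%g = 1%:M by rewrite -AdmM mulVg Adm1.
by rewrite -[LHS](mulKmx (Adm_unit g)) e mulmx1.
Qed.

Lemma row_norm_le (M : 'M[R]_n) (c : R) : 0 <= c ->
  (forall w : V, `|w *m M| <= c * `|w|) -> `|M| <= c.
Proof.
move=> c0 H; apply/mx_norm_leP => // i j.
have e : M i j = (delta_mx 0 i *m M : V) 0 j by rewrite -rowE mxE.
rewrite e; apply: le_trans (coord_norm_le _ _ _) _; apply: le_trans (H _) _.
rewrite -[X in _ <= X]mulr1; apply: ler_wpM2l => //.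
by apply/mx_norm_leP => // i' j'; rewrite mxE; case: (_ && _); rewrite ?normr1 ?normr0 ?ler01.
Qed.

Lemma Adm_cvg1 : Adm @ (1%g : G) --> (1%:M : 'M[R]_n).
Proof.
have [r [K [r0 K0 HK]]] := @Ad_near1 R _ G.
apply/cvgrPdist_le => e e0.
have d1 := @dom1 R _ G; have c1 := @chart1_cvg R _ G _ d1.
have near1 : \forall g \near (1%g : G), `|chart1 g| <= Num.min r (e / K).
  move: c1; rewrite chart1_1 => /cvgrPdist_le H.
  have m0 : 0 < Num.min r (e / K) by rewrite lt_min r0 divr_gt0.
  apply: filterS (H _ m0) => g; by rewrite sub0r normrN.
apply: filterS2 (dom_nbhs (@lg_proper R _ G) d1) near1 => g dg small.
rewrite distrC; apply: row_norm_le => [|w]; first exact: ltW.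
rewrite mulmxBr mulmx1 mul_Adm -(chart1K dg).
apply: le_trans (HK _ _ _) _; first by apply: le_trans small _; rewrite ge_min lexx.
apply: ler_wpM2r => //; rewrite mulrC -ler_pdivlMr //.
by apply: le_trans small _; rewrite ge_min lexx orbT.
Qed.

Lemma Adm_continuous : continuous Adm.
Proof.
move=> g; have h1 : (fun x : G => (g^-1 * x)%g) @ g --> (1%g : G).
  by rewrite -(mulVg g); apply: cvg_mulg; [exact: cvg_cst|exact: cvg_id].
have c1 : (fun x : G => Adm (g^-1 * x)%g) @ g --> (1%:M : 'M[R]_n).
  exact: (cvg_comp _ _ h1 Adm_cvg1).
have c2 : (fun x : G => Adm (g^-1 * x)%g *m Adm g) @ g --> 1%:M *m Adm g.
  by apply: cvg_mulmx => //; exact: cvg_cst.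
rewrite mul1mx in c2; apply: cvg_trans c2.
by under eq_fun do rewrite -AdmM mulVKg.
Qed.

Variable br : V -> V -> V.
Hypothesis brE : forall X Y, br X Y = bracket G X Y.

Lemma lie_bracketP : lie_bracket br.
Proof.
have cplt := @geom_complete_rV R n.
split=> [Y c X X'|X c Y Y'|X|X Y Z]; rewrite !brE.
- by rewrite (bracketDl G cplt) (bracketZl G cplt).
- by rewrite (bracketDr G cplt) (bracketZr G cplt).
- exact: bracketXX.
- exact: bracket_jacobi.
Qed.

Lemma Adm_automorphism (g : G) : automorphism br (Adm g).
Proof.
split; first exact: Adm_unit.
by move=> U W; rewrite !mul_Adm !brE (bracket_Ad (@geom_complete_rV R n)).
Qed.

Lemma Adm_tangent (g : nat -> G) Z : tangent_seq g Z ->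
  (fun i => (2 ^ i)%:R *: (Adm (g i) - 1%:M)) @ \oo --> adm br Z.
Proof.
move=> tZ; apply: mx_cvg => i l.
have e (M : 'M[R]_n) : M i l = (delta_mx 0 i *m M : V) 0 l by rewrite -rowE mxE.
rewrite e (mul_adm lie_bracketP) brE.
have := mx_cvg_coord (i := 0) (j := l) (tangent_Ad (@geom_complete_rV R n) (delta_mx 0 i) tZ).
have -> : (fun q => ((2 ^ q)%:R *: (Adm (g q) - 1%:M)) i l) =
    (fun q => ((2 ^ q)%:R *: (Ad (g q) (delta_mx 0 i) - delta_mx 0 i) : V) 0 l).
  by apply/funext => q; rewrite e -scalemxAr mulmxBr mulmx1 mul_Adm.
by apply.
Qed.

End Adjoint.

Section AdjointSubgroup.
Context {R : realType} {n l : nat} {G : lieGroup 'rV[R]_n} {K : lieGroup 'rV[R]_l}.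
Local Notation V := 'rV[R]_n.
Local Notation W := 'rV[R]_l.
Local Notation h k := ((2^-1 : R) ^+ k).
Variable br : V -> V -> V.
Hypothesis brE : forall X Y, br X Y = bracket G X Y.
Variables (k p : {vspace V}) (j : K -> G).
Hypothesis HC : cartan br k p.
Hypothesis jM : forall x y, j (x * y)%g = (j x * j y)%g.
Hypothesis jc : continuous j.
Hypothesis jd : mdiff (lg_atlas K) (lg_atlas G) j 1%g.
Hypothesis jinj : injective (lie_diff j).
Hypothesis jk : range (lie_diff j) = [set X | X \in k].

Definition adjoint_group : set 'M[R]_n := range (Adm \o j).
Local Notation Gam := adjoint_group.
Let br_lie := lie_bracketP brE.

Lemma adjoint_group1 : Gam 1%:M.
Proof. by exists 1%g => //=; rewrite (morph1 jM) Adm1. Qed.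

Lemma adjoint_groupM A D : Gam A -> Gam D -> Gam (A *m D).
Proof.
by move=> [x _ <-] [y _ <-]; exists (y * x)%g => //=; rewrite jM AdmM.
Qed.

Lemma adjoint_groupV A : Gam A -> Gam (invmx A).
Proof. by move=> [x _ <-]; exists x^-1%g => //=; rewrite (morphV jM) AdmV. Qed.

Lemma lie_diff_linear : linear (lie_diff j). Proof. exact: tdiff_linear. Qed.

Lemma lie_diff_mem Y : lie_diff j Y \in k.
Proof. by have : [set X | X \in k] (lie_diff j Y) by rewrite -jk; exists Y. Qed.

Lemma mem_lie_diff X : X \in k -> exists Y, lie_diff j Y = X.
Proof. by move=> Xk; have : range (lie_diff j) X; [rewrite jk|move=> [Y _ <-]; exists Y]. Qed.

Lemma adjoint_group_preserves A : Gam A -> preserves br k p A.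
Proof.
have pk x X : X \in k -> X *m Adm (j x) \in k.
  move=> /mem_lie_diff[Y <-]; rewrite mul_Adm -(lie_diff_Ad jM jd).
  exact: lie_diff_mem.
move=> [x _ <-]; apply: preserves_cartan => //; first exact: Adm_automorphism.
  exact: pk.
by move=> X Xk; rewrite /= -AdmV -(morphV jM) pk.
Qed.

Definition adjoint_curve (Z : W) (t : R) : 'M[R]_n := Adm (j (lie_exp K (t *: Z))).

Lemma adjoint_curve_one_parameter Z :
  one_parameter_mx br Gam (lie_diff j Z) (adjoint_curve Z).
Proof.
have cplt := @geom_complete_rV R l.
have [ec eone _] := lie_exp_map K cplt.
have [c_c cD _] := eone Z.
split.
- move=> t; have c2 := cvg_comp _ _ (c_c t) (@jc (lie_exp K (t *: Z))).
  have Ac : continuous (@Adm R n G) := @Adm_continuous R n G.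
  by have := cvg_comp _ _ c2 (Ac _); apply.
- by move=> t; exists (lie_exp K (t *: Z)).
- by move=> s t; rewrite /adjoint_curve addrC cD jM AdmM.
- move=> s; have <- : adm br (lie_diff j (s *: Z)) = s *: adm br (lie_diff j Z).
    rewrite (linear_scale _ _ lie_diff_linear).
    apply/row_matrixP => i; rewrite !rowE -scalemxAr !(mul_adm br_lie).
    exact: brZl.
  have := Adm_tangent brE (tangent_morph jM jd (tangent_one_parameter (eone (s *: Z)))).
  have -> : (fun i => (2 ^ i)%:R *: (adjoint_curve Z (s * h i) - 1%:M)) =
     (fun i => (2 ^ i)%:R *: (Adm ((j \o (fun i => lie_exp K (h i *: (s *: Z)))) i) - 1%:M)).
    by apply/funext => i; rewrite /adjoint_curve /= scalerA [h i * s]mulrC.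
  by apply.
Qed.

(** A central element of k would be isotropic for B, which is definite there. *)
Lemma adm_injective v : adm br (lie_diff j v) = 0 -> v = 0.
Proof.
move=> ad0; apply: jinj.
have <- : lie_diff j v = lie_diff j 0; last by [].
rewrite [RHS](linear_zero lie_diff_linear).
have [_ _ _ _ [Bk _]] := HC; apply/eqP/negPn/negP => n0.
have := Bk _ (lie_diff_mem v) n0.
by rewrite kformE // ad0 mulmx0 mxtrace0 ltxx.
Qed.

(** The derivative at 0 of v |-> Ad(j(ex v)) is ad composed with the differential of [j]. It is
    injective, so it is bounded below on the unit sphere, and near 0 the remainders use up at most
    half of this bound. *)
Lemma Adm_lower_bound : exists r c : R, [/\ 0 < r, 0 < c &
  forall v : W, `|v| <= r -> c * `|v| <= `|Adm (j (point1 K v)) - 1%:M|].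
Proof.
have Ll := lie_diff_linear.
have [CL CL0 HCL] := linear_bound Ll.
have [Ca Ca0 HCa] := linear_bound (adm_linear br_lie).
have [r1 [K1 [Q [r10 K10 Q0 _ [_ HQ]]]]] := bracket_taylor G (@geom_complete_rV R n).
have [|||c0 c00 Hc0] := @sphere_bound R l (fun v => `|adm br (lie_diff j v)|) 0.
- move=> v; have Lc : continuous (fun v => adm br (lie_diff j v)).
    apply: linear_continuous_rV => c u w; rewrite Ll; exact: (adm_linear br_lie).
  exact: (cvg_norm (Lc v)).
- move=> v v0; rewrite normr_gt0; apply: contraNneq v0 => /adm_injective ->.
  by rewrite eqxx.
- move=> t v; rewrite (linear_scale _ _ Ll).
  have -> : adm br (t *: lie_diff j v) = t *: adm br (lie_diff j v).
    by apply/row_matrixP => i; rewrite !rowE -scalemxAr !(mul_adm br_lie) brZl.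
  by rewrite normrZ.
(* This [eps] and the last bound in [r] make the error of linearising [j] and the quadratic
   remainder of Ad each at most c0/4 |v|. *)
pose eps := c0 / (4 * (Ca + 1)).
have Ca1 : 0 < Ca + 1 by rewrite ltr_wpDl.
have eps0 : 0 < eps by rewrite divr_gt0 // mulr_gt0.
have [d d0 Hd] := lie_diff_eps jM jd eps0.
have domj : \forall v \near (0 : W), dom (lg_atlas G) 1%g (j (point1 K v)).
  have d1 := @dom1 R _ G.
  have jp := cvg_comp _ _ (@point1_cvg0 R _ K) (@jc 1%g).
  rewrite (morph1 jM) in jp.
  exact: (jp _ (dom_nbhs (@lg_proper R _ G) d1)).
have [d2 /= d20 Hd2] := (nbhs_ballP _ _).1 domj.
pose M := CL + eps; have M0 : 0 < M by rewrite ltr_wpDl.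
pose r := Num.min (Num.min (d / 2) (d2 / 2)) (Num.min (r1 / M) (c0 / (4 * Q * M ^+ 2))).
exists r, (c0 / 2).
have r0 : 0 < r.
  by rewrite !lt_min !divr_gt0 // ?mulr_gt0 // ?exprn_gt0 // mulr_gt0.
split; [exact: r0|by rewrite divr_gt0|].
move=> v; rewrite !le_min => /andP[/andP[vd vd2] /andP[vr1 vq]].
have v_d : `|v| < d by apply: le_lt_trans vd _; rewrite ltr_pdivrMr // ltr_pMr // ltr1n.
have dv : dom (lg_atlas G) 1%g (j (point1 K v)).
  apply: Hd2; rewrite -ball_normE /= sub0r normrN; apply: le_lt_trans vd2 _.
  by rewrite ltr_pdivrMr // ltr_pMr // ltr1n.
set X := chart1 (j (point1 K v)).
have XL : `|X - lie_diff j v| <= eps * `|v| by exact: Hd.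
have XM : `|X| <= M * `|v|.
  have -> : X = lie_diff j v + (X - lie_diff j v) by rewrite addrC subrK.
  by apply: le_trans (ler_normD _ _) _; rewrite mulrDl; apply: lerD.
have tay : `|Adm (j (point1 K v)) - 1%:M - adm br X| <= Q * `|X| ^+ 2.
  apply: row_norm_le => [|w]; first by rewrite mulr_ge0 // ?exprn_ge0 // ltW.
  rewrite !mulmxBr mulmx1 mul_Adm (mul_adm br_lie) brE.
  rewrite -{1}(chart1K dv) -/X; apply: HQ.
  by apply: le_trans XM _; rewrite mulrC -ler_pdivlMr.
have adX : `|adm br X - adm br (lie_diff j v)| <= Ca * (eps * `|v|).
  have -> : adm br X - adm br (lie_diff j v) = adm br (X - lie_diff j v).
    by apply/row_matrixP => i; rewrite !rowE mulmxBr !(mul_adm br_lie) [RHS](brBl br_lie).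
  by apply: le_trans (HCa _) _; apply: ler_wpM2l.
have low : c0 * `|v| <= `|adm br (lie_diff j v)| by have := Hc0 v; rewrite expr1.
have q1 : Ca * (eps * `|v|) <= c0 / 4 * `|v|.
  rewrite mulrA; apply: ler_wpM2r => //.
  have <- : (Ca + 1) * eps = c0 / 4 by rewrite /eps; field; rewrite lt0r_neq0.
  by rewrite mulrDl mul1r lerDl ltW.
have q2 : Q * `|X| ^+ 2 <= c0 / 4 * `|v|.
  apply: (@le_trans _ _ (Q * (M * `|v|) ^+ 2)).
    apply: ler_wpM2l; first exact: ltW.
    by rewrite ler_pXn2r // nnegrE // mulr_ge0 // ltW.
  have -> : Q * (M * `|v|) ^+ 2 = (Q * M ^+ 2 * `|v|) * `|v| by ring.
  apply: ler_wpM2r => //; move: vq; rewrite ler_pdivlMr ?mulr_gt0 // ?exprn_gt0 //.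
  by rewrite ler_pdivlMr // => vq; apply: le_trans vq; rewrite le_eqVlt; apply/orP; left; apply/eqP; ring.
have tri : `|adm br (lie_diff j v)| <= `|Adm (j (point1 K v)) - 1%:M| +
   `|Adm (j (point1 K v)) - 1%:M - adm br X| + `|adm br X - adm br (lie_diff j v)|.
  set A := _ - 1%:M; set B := adm br X; set D := adm br (lie_diff j v).
  have e : D = A - (A - B) - (B - D) by rewrite !subKr.
  rewrite {1}e.
  by apply: le_trans (ler_normB _ _) _; apply: lerD => //; exact: ler_normB.
lra.
Qed.

(** [N] is the image of a closed ball of K. By [Adm_lower_bound] an element of [N] close enough to 1
    comes from a point of the ball of half the radius, and multiplying such a point by exp(tZ) for
    small t stays in the ball. *)
Lemma adjoint_group_nbhd : exists (N : set 'M[R]_n) (d : R),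
  [/\ compact N, N `<=` Gam, N 1%:M, 0 < d & forall D, N D -> `|D - 1%:M| < d ->
    forall Z, Z \in k -> exists2 c, one_parameter_mx br Gam Z c &
      \forall t \near 0, N (D *m c t)].
Proof.
have [rho [C [rho0 C1 Hpt Htr Hlaw]]] := local_group K.
have [r1 [c [r10 c0 Hlow]]] := Adm_lower_bound.
pose r := Num.min r1 (rho / 2).
have r0 : 0 < r by rewrite lt_min r10 divr_gt0.
have rrho : r < rho.
  rewrite gt_min; apply/orP; right.
  by rewrite ltr_pdivrMr // ltr_pMr // ltr1n.
pose ball_r : set W := [set v | `|v| <= r].
pose F (v : W) : 'M[R]_n := Adm (j (point1 K v)).
exists (F @` ball_r), (c * (r / 2)); split.
- apply: continuous_compact; last first.
    apply: bounded_closed_compact.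
      by exists r; split; rewrite ?num_real // => x rx y /le_trans; apply; exact: ltW.
    have -> : ball_r = (fun v => `|v|) @^-1` [set x | x <= r] by [].
    apply: closed_preimage (@closed_le _ r); exact: norm_continuous.
  apply: continuous_in_subspaceT => v; rewrite inE => vr.
  have [dv chv] := Hpt v (le_trans vr (ltW rrho)).
  have pv := point1_cvg dv; rewrite chv in pv.
  have c2 := cvg_comp _ _ pv (@jc (point1 K v)).
  have Ac : continuous (@Adm R n G) := @Adm_continuous R n G.
  by have := cvg_comp _ _ c2 (Ac _); apply.
- by move=> _ [v _ <-]; exists (point1 K v).
- by exists 0; rewrite /ball_r /= ?normr0 ?ltW // /F point1_0 (morph1 jM) Adm1.
- by rewrite mulr_gt0 // divr_gt0.
move=> _ [v vr <-] small Z /mem_lie_diff[Z' eZ].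
exists (adjoint_curve Z'); first by rewrite -eZ; exact: adjoint_curve_one_parameter.
have vr2 : `|v| < r / 2.
  rewrite -(ltr_pM2l c0); apply: le_lt_trans small; apply: Hlow.
  by apply: le_trans vr _; rewrite ge_min lexx.
have [ec eone _] := lie_exp_map K (@geom_complete_rV R l).
have [cc _ _] := eone Z'.
have c0' : (fun t : R => lie_exp K (t *: Z')) @ (0 : R) --> (1%g : K).
  have e0 : lie_exp K (0 *: Z') = 1%g := one_parameter0 (eone Z').
  by rewrite -e0; exact: cc.
have d1 := @dom1 R _ K; have ch0 := @chart1_cvg R _ K _ d1; rewrite chart1_1 in ch0.
have nearU : \forall t \near (0 : R), dom (lg_atlas K) 1%g (lie_exp K (t *: Z')) :=
  c0' _ (dom_nbhs (@lg_proper R _ K) d1).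
have m0 : 0 < r / (2 * (1 + C * r)) by rewrite divr_gt0 // mulr_gt0 // addr_gt0 // mulr_gt0 // (lt_le_trans _ C1).
have chs := cvg_comp _ _ c0' ch0.
have nearS : \forall t \near (0 : R), `|chart1 (lie_exp K (t *: Z'))| <= Num.min (r / (2 * (1 + C * r))) r.
  have /cvgrPdist_le H := chs.
  have m1 : 0 < Num.min (r / (2 * (1 + C * r))) r by rewrite lt_min m0.
  by apply: filterS (H _ m1) => t /=; rewrite sub0r normrN.
apply: filterS2 nearU nearS => t dt; rewrite le_min => /andP[w1 w2].
set w := chart1 (lie_exp K (t *: Z')) in w1 w2.
have ew : point1 K w = lie_exp K (t *: Z') := chart1K dt.
have vrho : `|v| <= rho by apply: le_trans vr _; exact: ltW.
have wrho : `|w| <= rho by apply: le_trans w2 _; exact: ltW.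
have r00 : `|0 : W| <= rho by rewrite normr0 ltW.
have [dm _] := Htr _ _ _ _ wrho vrho vrho r00.
rewrite point1_0 mulg1 in dm.
have law := Hlaw _ _ wrho vrho.
exists (chart1 (point1 K w * point1 K v)%g).
  set x := chart1 _ in law *; rewrite /ball_r /=.
  have -> : x = (x - w - v) + (w + v) by rewrite -[x - w - v]addrA -opprD subrK.
  apply: le_trans (ler_normD _ _) _.
  have := ler_normD w v.
  have C0 : 0 < C by exact: lt_le_trans C1.
  have h1 : (1 + C * r) * `|w| <= r / 2.
    have q0 : 0 < 1 + C * r by rewrite addr_gt0 // mulr_gt0.
    rewrite mulrC -ler_pdivlMr //; apply: le_trans w1 _.
    by rewrite le_eqVlt; apply/orP; left; apply/eqP; field; rewrite lt0r_neq0.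
  have h2 : C * (`|w| * `|v|) <= C * r * `|w|.
    rewrite [`|w| * _]mulrC mulrA; apply: ler_wpM2r => //.
    by apply: ler_wpM2l => //; exact: ltW.
  rewrite mulrDl mul1r in h1; lra.
by rewrite /F chart1K // jM AdmM ew.
Qed.

End AdjointSubgroup.

(** * Closed Weyl chambers and signs of roots *)

Section Chamber.
Context {R : realType} {n : nat}.
Local Notation V := 'rV[R]_n.
Variable br : V -> V -> V.
Hypothesis br_lie : lie_bracket br.
Local Notation "[ X , Y ]" := (br X Y).
Variables (k p : {vspace V}).
Hypothesis HC : cartan br k p.
Variable a : {vspace V}.
Variable H0 : V.
Hypothesis H0reg : regular br a H0.
Local Notation C := (connected_component (regular br a) H0).

Lemma rroot_extends alpha : rroot br a alpha ->
  exists2 f : V -> R, continuous f & forall H, H \in a -> f H = alpha H.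
Proof.
move=> [_ [W W0 HW]].
pose f (Y : V) : R := ip br k p [Y, W] W / ip br k p W W.
have fl : linear (f : V -> R^o).
  move=> c Y Z; rewrite /f (brDl br_lie) (brZl br_lie) (ipl br_lie k p W).
  by rewrite -[_ *: _ + _]/(c * ip br k p [Y, W] W + ip br k p [Z, W] W) mulrDl -mulrA.
exists f; first exact: (linear_continuous_rV fl).
move=> H Ha; rewrite /f HW // (linear_scale _ _ (ipl br_lie k p W)).
rewrite -[X in X / _ = _]/(alpha H * ip br k p W W) mulfK //.
exact/lt0r_neq0/(ip_gt0 br_lie HC W0).
Qed.

(** A root does not vanish on the connected component, so by the intermediate value theorem its sign
    is constant there. *)
Lemma component_sign H alpha : C H -> rroot br a alpha -> 0 < alpha H * alpha H0.
Proof.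
move=> CH ra; have [f fc fE] := rroot_extends ra.
have Ca X : C X -> X \in a by move=> /connected_component_sub[].
have CH0 : C H0 by exact: connected_component_refl.
have /connected_intervalP itv : connected (f @` C).
  apply: connected_continuous_connected; first exact: component_connected.
  exact: continuous_subspaceT.
have nz X : C X -> f X != 0.
  by move=> CX; rewrite fE ?Ca //; have [_] := connected_component_sub CX; exact.
have pos X Y : C X -> C Y -> f X < 0 -> 0 < f Y -> False.
  move=> CX CY fX fY; have [Z CZ fZ] : (f @` C) 0.
    by apply: (itv (f X) (f Y)); [exists X|exists Y|rewrite !ltW].
  by have := nz Z CZ; rewrite fZ eqxx.
rewrite -!fE ?Ca //; have := nz _ CH; have := nz _ CH0.
rewrite !neq_lt => /orP[h0|h0] /orP[h1|h1].
- by rewrite nmulr_rgt0.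
- by case: (pos H0 H).
- by case: (pos H H0).
- exact: mulr_gt0.
Qed.

(** Moving any distance from a weakly dominant [H] towards [H0] makes every root nonzero with its
    sign at [H0], so [H] is a limit of points of the component. The converse combines
    [component_sign] with closedness. *)
Lemma weyl_closure : weyl br a H0 = closure C.
Proof.
apply/seteqP; split=> [H [Ha wH]|].
  have H0a := H0reg.1.
  pose c (t : R) : V := t *: H0 + (1 - t) *: H.
  have cc : continuous c.
    have lc (Z : V) : continuous (fun t : R => t *: Z).
      by move=> t; apply: cvgZr_tmp; exact: cvg_id.
    move=> t; apply: cvgD; first exact: lc.
    have -> : (fun t : R => (1 - t) *: H) = (fun t => H - t *: H).
      by apply/funext => s; rewrite scalerBl scale1r.
    by rewrite scalerBl scale1r; apply: cvgB; [exact: cvg_cst|exact: lc].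
  have c_reg t : 0 < t -> t <= 1 -> regular br a (c t).
    move=> t0 t1; split=> [|al ra]; first by rewrite memvD // memvZ.
    have Ya : (1 - t) *: H \in a by rewrite memvZ.
    have := rroot_linear br_lie (1 - t) ra Ha (mem0v a).
    rewrite addr0 (rroot0 br_lie ra) addr0 => e.
    rewrite (rroot_linear br_lie t ra H0a Ya) e.
    have h0 : al H0 != 0 by exact: H0reg.2.
    have : 0 < (t * al H0 + (1 - t) * al H) * al H0.
      rewrite mulrDl -!mulrA; apply: ltr_pwDl.
        by rewrite mulr_gt0 // -expr2 exprn_even_gt0.
      by rewrite mulr_ge0 ?subr_ge0 // wH.
    by apply: contraTneq => ->; rewrite mul0r ltxx.
  have c_C t : 0 < t -> t <= 1 -> C (c t).
    move=> t0 t1; apply: (@connected_component_max _ _ (c @` `[t, 1])).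
    - by exists 1; rewrite /= ?in_itv /= ?lexx ?t1 // /c subrr scale0r addr0 scale1r.
    - move=> _ [s hs <-]; have {hs} /andP[ts s1] : t <= s <= 1 by have := hs; rewrite /= in_itv.
      by apply: c_reg => //; exact: lt_le_trans ts.
    - apply: connected_continuous_connected; first exact: segment_connected.
      exact: continuous_subspaceT.
    - by exists t; rewrite /= ?in_itv /= ?lexx.
  move=> B nB; have cH : c 0 = H by rewrite /c scale0r add0r subr0 scale1r.
  have nc : nbhs (0 : R) (c @^-1` B) by apply: cc; rewrite cH.
  have [e /= e0 He] := (nbhs_ballP _ _).1 nc.
  pose t := Num.min (e / 2) 1; have t0 : 0 < t by rewrite lt_min divr_gt0 // ltr01.
  exists (c t); split; first by apply: c_C => //; rewrite ge_min lexx orbT.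
  apply: He; rewrite -ball_normE /= sub0r normrN gtr0_norm // gt_min; apply/orP; left.
  by rewrite ltr_pdivrMr // ltr_pMr // ltr1n.
have wc : closed (weyl br a H0) := @weyl_closed R n br br_lie k p HC a H0.
move=> H clH; apply: wc; apply: closure_subset clH => Y CY; split.
  by have [] := connected_component_sub CY.
by move=> al ra; apply/ltW/component_sign.
Qed.

End Chamber.

(** * Saturation of invariant open sets under Ad(K) *)

Section Saturation.
Context {R : realType} {n l : nat} {G : lieGroup 'rV[R]_n} {K : lieGroup 'rV[R]_l}.
Variables (k p a : {vspace 'rV[R]_n}) (j : K -> G).
Hypothesis K_subgroup : is_connected_subgroup j k.
Variable U : set 'rV[R]_n.
Hypothesis U_open : open U.
Hypothesis U_connected : connected U.
Hypothesis U0 : U 0.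
Hypothesis U_inv : forall h X, U X -> U (Ad (j h) X).

Lemma abstract_saturation (br : 'rV[R]_n -> 'rV[R]_n -> 'rV[R]_n) (H0 : 'rV[R]_n) :
  (forall X Y, br X Y = bracket G X Y) -> cartan br k p ->
  (a <= p)%VS -> abelian_sub br a ->
  (forall b, (a <= b)%VS -> (b <= p)%VS -> abelian_sub br b -> b = a) ->
  regular br a H0 -> forall X, U X -> exists h, connected_component
    (U `&` [set X | closure (connected_component (regular br a) H0) (ppart k p X)]) 0
    (Ad (j h) X).
Proof.
move=> brE HC a_p a_ab a_max H0reg X UX.
have [_ [jM jreg] _ jinj jk] := K_subgroup.
have jc : continuous j by move=> x; exact: (jreg x I).1.
have jd := regular_mdiff jreg 1%g.
have br_lie := lie_bracketP brE.
have G1 := adjoint_group1 jM.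
have GM := adjoint_groupM jM.
have GV := adjoint_groupV jM.
have GP := @adjoint_group_preserves _ _ _ _ _ br brE k p j HC jM jd jk.
have Gexp Z : Z \in k -> exists c, one_parameter_mx br (adjoint_group j) Z c.
  move=> /(mem_lie_diff jk)[Z' <-]; exists (adjoint_curve j Z').
  exact: adjoint_curve_one_parameter.
have Gn := adjoint_group_nbhd brE HC jM jc jd jinj jk.
have Gcl := Gam_closed br_lie HC GM GV GP Gn.
have Uinv (Y : 'rV[R]_n) A : adjoint_group j A -> U Y -> U (Y *m A).
  by move=> [h _ <-] UY; rewrite /= mul_Adm; exact: U_inv.
have [A [h _ <-]] := slice0_saturation br_lie HC G1 GM GV GP Gexp Gcl a_p a_ab a_max
  H0reg U0 Uinv U_open U_connected UX.
rewrite /slice0 /slice (weyl_closure br_lie HC H0reg) /= mul_Adm => S.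
by exists h.
Qed.

Lemma chamber_saturation (ap : set 'rV[R]_n) :
  cartan_decomposition G k p -> maximal_abelian G p a -> closed_weyl_chamber G a ap ->
  forall X, U X -> exists h, connected_component
    (U `&` [set X | ap (ppart k p X)]) 0 (Ad (j h) X).
Proof.
move=> HC [a_p a_ab a_max] [H0 H0reg ->] X UX.
exact: (@abstract_saturation (bracket G) H0 (fun _ _ => erefl) HC a_p a_ab a_max H0reg X UX).
Qed.

End Saturation.

(** * Complex linearity of Ad and transfer of nonsingularity *)

Section ComplexGroups.
Context {R : realType} {d : nat} (H : complexLieGroup R d).
Local Notation A := (lg_atlas H).
Local Notation E := (@cvec R d).
Local Notation J := (@mulI R 'rV[R]_d : E -> E).

Lemma cvec_complete : geom_complete E.
Proof. exact: (@geom_complete_prod R _ _ (@geom_complete_rV R d) (@geom_complete_rV R d)). Qed.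

Lemma mulI_continuous : continuous J.
Proof.
move=> z; have c2 : (fun z : E => z.2) @ z --> z.2 by exact: cvg_snd.
have c1 : (fun z : E => z.1) @ z --> z.1 by exact: cvg_fst.
exact: (cvg_pair (cvgN c2) c1).
Qed.

Lemma tdiff_mulg_mulI (q : H * H) (v : E * E) :
  tdiff (prod_atlas A A) A (fun q => (q.1 * q.2)%g) q (J v.1, J v.2) =
  J (tdiff (prod_atlas A A) A (fun q => (q.1 * q.2)%g) q v).
Proof.
have [_ hol] := clg_mul_holomorphic (c := H) (I : setT q).
by have [_] := nbhs_singleton hol; exact.
Qed.

Lemma tdiff_lmul_mulI (g x : H) v :
  tdiff A A (fun h => g * h)%g x (J v) = J (tdiff A A (fun h => g * h)%g x v).
Proof.
have [m1 t1] := mdiff_cst A A g x.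
have [m2 t2] := mdiff_id x (lg_proper H).
have [m3 t3] := mdiff_pair m1 m2.
have [_ ->] := mdiff_comp (lg_proper H) (prod_atlas_proper (lg_proper H) (lg_proper H))
  m3 (mulg_mdiff (g, x)).
rewrite t3 /= t1 t2 /= -tdiff_mulg_mulI /=.
by congr (tdiff _ _ _ _ (_, _)); rewrite /mulI /= oppr0.
Qed.

Lemma tdiff_rmul_mulI (g x : H) v :
  tdiff A A (fun h => h * g)%g x (J v) = J (tdiff A A (fun h => h * g)%g x v).
Proof.
have [m1 t1] := mdiff_cst A A g x.
have [m2 t2] := mdiff_id x (lg_proper H).
have [m3 t3] := mdiff_pair m2 m1.
have [_ ->] := mdiff_comp (lg_proper H) (prod_atlas_proper (lg_proper H) (lg_proper H))
  m3 (mulg_mdiff (x, g)).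
rewrite t3 /= t1 t2 /= -tdiff_mulg_mulI /=.
by congr (tdiff _ _ _ _ (_, _)); rewrite /mulI /= oppr0.
Qed.

(** Translations are holomorphic, so Ad is complex linear; this lets Ad pass through the factor i
    inside the exponentials of [P_]. *)
Lemma Ad_mulI (g : H) v : Ad g (J v) = J (Ad g v).
Proof.
have [_ e] := mdiff_comp (lg_proper H) (lg_proper H) (lmul_mdiff g 1%g)
  (rmul_mdiff g^-1%g (g * 1)%g).
have {}e : Ad g = tdiff A A (fun h => h * g^-1)%g (g * 1)%g \o tdiff A A (fun h => g * h)%g 1%g.
  by rewrite -e.
by rewrite e /= tdiff_lmul_mulI tdiff_rmul_mulI.
Qed.

End ComplexGroups.

Section ExpConjugation.
Context {R : realType} {E : normedModType R} (G : lieGroup E).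

Lemma lie_exp_Ad (cplt : geom_complete E) (g : G) X :
  lie_exp G (Ad g X) = (g * lie_exp G X * g^-1)%g.
Proof.
have := lie_exp_morph (conj_byM g) (@conj_by_continuous R E G g) (conj_by_mdiff g 1%g) cplt X.
by move=> e; rewrite -[RHS]/(conj_by g (lie_exp G X)) e.
Qed.

End ExpConjugation.

Lemma not_differentiable (R : realType) (E F : normedModType R) (f : E -> F) (x : E) :
  ~ differentiable f x -> 'd f x = point.
Proof.
move=> nd; rewrite /diff; case: xgetP => [df e Hdf|] //; case: nd; apply/diffP.
by rewrite /diff -e.
Qed.

(* At a point where [f] is continuous but not differentiable, ['d] is a default
   value independent of [f] and of the point. *)
Lemma tdiff_bijective_transfer (R : realType) (T U : topologicalType) (E F : normedModType R)
    (A : atlas T E) (B : atlas U F) (f : T -> U) (s s' : T -> T) (t t' : U -> U) :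
  proper_atlas A -> proper_atlas B ->
  (forall x, mdiff A A s x) -> (forall x, mdiff A A s' x) -> cancel s s' -> cancel s' s ->
  (forall y, mdiff B B t y) -> (forall y, mdiff B B t' y) -> cancel t t' -> cancel t' t ->
  (forall x, f (s x) = t (f x)) -> continuous f ->
  forall x, bijective (tdiff A B f x) -> bijective (tdiff A B f (s x)).
Proof.
move=> pA pB sd s'd sK s'K td t'd tK t'K fs fc x bx.
have iso (V : topologicalType) (D : normedModType R) (C : atlas V D) (u u' : V -> V) :
    proper_atlas C -> (forall x, mdiff C C u x) -> (forall x, mdiff C C u' x) ->
    cancel u u' -> cancel u' u -> forall x, bijective (tdiff C C u x).
  move=> pC ud u'd uK u'K y.
  have [_ e1] := mdiff_comp pC pC (ud y) (u'd (u y)).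
  have [_ e2] := mdiff_comp pC pC (u'd (u y)) (ud (u' (u y))).
  have i1 : u' \o u = id by apply/funext => z; exact: uK.
  have i2 : u \o u' = id by apply/funext => z; exact: u'K.
  have [_ d1] := mdiff_id y pC; have [_ d2] := mdiff_id (u y) pC.
  exists (tdiff C C u' (u y)) => v.
    by have := congr1 (fun g => g v) e1; rewrite i1 d1.
  by have := congr1 (fun g => g v) e2; rewrite i2 d2 uK.
have fs' : f = t \o f \o s' by apply/funext => y; rewrite /= -fs s'K.
have fs2 : f = t' \o f \o s by apply/funext => y; rewrite /= fs tK.
have tr (g : T -> U) (w w' : T -> T) (r : U -> U) y : (forall x, mdiff A A w' x) ->
    (forall x, mdiff B B r x) -> cancel w w' -> g = r \o g \o w' ->
    mdiff A B g y -> mdiff A B g (w y) /\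
    tdiff A B g (w y) = tdiff B B r (g y) \o tdiff A B g y \o tdiff A A w' (w y) :> (E -> F).
  move=> w'd rd wK ge gd.
  have gd' : mdiff A B g (w' (w y)) by rewrite wK.
  have [m1 e1] := mdiff_comp pA pA (w'd (w y)) gd'.
  have [m2 e2] := mdiff_comp pA pB m1 (rd _).
  have e3 : r \o (g \o w') = g by rewrite [RHS]ge.
  rewrite e3 in m2 e2; split=> //.
  by rewrite e2 e1 /= wK.
have [fx|nfx] := pselect (mdiff A B f x).
  have [_ ->] := tr f s s' t x s'd td sK fs' fx.
  by apply: bij_comp; [apply: bij_comp => //; exact: iso pB td t'd tK t'K _|
    exact: iso pA s'd sd s'K sK _].
have nfsx : ~ mdiff A B f (s x).
  move=> fsx; apply: nfx; rewrite -(sK x).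
  by have [] := tr f s' s t' (s x) sd t'd s'K fs2 fsx.
have dflt y : ~ mdiff A B f y -> tdiff A B f y = (point : {linear E -> F}) :> (E -> F).
  move=> nd; rewrite /tdiff not_differentiable // => df; apply: (nd).
  by split; first exact: fc.
by rewrite dflt // -(dflt x).
Qed.

(** * Equivariance of P_m and the slice of the component *)

Section Polar.
Context {R : realType} {n l d e : nat} {G : lieGroup 'rV[R]_n} {K : lieGroup 'rV[R]_l}.
Variables (m : R) (k p : {vspace 'rV[R]_n}) (j : K -> G).
Variables (GC : complexLieGroup R d) (eta : G -> GC).
Variables (KC : complexLieGroup R e) (kappa : K -> KC) (iota : KC -> GC).
Hypothesis kp_cartan : cartan_decomposition G k p.
Hypothesis K_subgroup : is_connected_subgroup j k.
Hypothesis eta_hom : lie_hom eta.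
Hypothesis kappa_hom : lie_hom kappa.
Hypothesis iota_hom : hol_hom iota.
Hypothesis iota_kappa : forall h : K, iota (kappa h) = eta (j h).
Local Notation V := 'rV[R]_n.
Local Notation kp := (kpart k p).
Local Notation pp := (ppart k p).
Local Notation P := (P_ k p j eta kappa iota m).
Local Notation NS := (nonsingular k p j eta kappa iota m).

Lemma lie_hom_morphism (E F : normedModType R) (G1 : lieGroup E) (H1 : lieGroup F)
    (f : G1 -> H1) : lie_hom f ->
  [/\ forall x y, f (x * y)%g = (f x * f y)%g, continuous f
    & forall x, mdiff (lg_atlas G1) (lg_atlas H1) f x].
Proof.
move=> [fM freg]; split=> //; first by move=> x; exact: (freg x I).1.
exact: regular_mdiff.
Qed.

Let j_hom : lie_hom j. Proof. by case: K_subgroup. Qed.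

Lemma Ad_parts (h : K) X : kp (Ad (j h) X) = Ad (j h) (kp X) /\ pp (Ad (j h) X) = Ad (j h) (pp X).
Proof.
have [jM jc jd] := lie_hom_morphism j_hom; have [_ _ _ _ jk] := K_subgroup.
have [_ Ak Ap] := adjoint_group_preserves (br := bracket G) (fun _ _ => erefl) kp_cartan jM (jd 1%g) jk
  (ex_intro2 _ _ h I erefl : adjoint_group j (Adm (j h))).
have [e1 e2] := automorphism_parts kp_cartan X Ak Ap.
by rewrite !mul_Adm in e1 e2.
Qed.

Lemma lie_liftK X : X \in k -> lie_diff j (lie_lift j X) = X.
Proof.
have [_ _ _ _ jk] := K_subgroup; move=> /(mem_lie_diff jk)[Y YX].
by rewrite /lie_lift; case: xgetP => [Z _ //|/(_ Y)]; case.
Qed.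

Lemma lie_lift_linear : linear (fun X => lie_lift j (kp X)).
Proof.
have [_ _ _ jinj _] := K_subgroup; have jl : linear (lie_diff j) by exact: tdiff_linear.
move=> c X Y; apply: jinj; rewrite jl !lie_liftK ?kpart_mem //.
exact: kpart_linear.
Qed.

Lemma lie_lift_Ad (h : K) X : lie_lift j (kp (Ad (j h) X)) = Ad h (lie_lift j (kp X)).
Proof.
have [_ _ _ jinj _] := K_subgroup; have [jM _ jd] := lie_hom_morphism j_hom.
apply: jinj; rewrite (lie_diff_Ad jM (jd 1%g)) !lie_liftK ?kpart_mem //.
by rewrite (Ad_parts h X).1.
Qed.

(** Each exponential is conjugated: the first by eta(j h), the second by kappa(h), whose image under
    [iota] is again eta(j h). The inner factors then cancel. *)
Lemma polar_equivariant (g : G) (h : K) q :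
  P (L_act j g h q) = (eta g * P q * (eta (j h))^-1)%g.
Proof.
have [eM _ ed] := lie_hom_morphism eta_hom.
have [kM _ kd] := lie_hom_morphism kappa_hom.
have iM := iota_hom.1.
have [e1 e2] := Ad_parts h q.2.
rewrite /P_ /L_act /= lie_lift_Ad e1 e2 -!AdZ -AdD.
rewrite (lie_diff_Ad eM (ed 1%g)) (lie_diff_Ad kM (kd 1%g)).
rewrite -!Ad_mulI !(lie_exp_Ad (@cvec_complete R _)) !eM (morphV eM).
rewrite !iM (morphV iM) iota_kappa.
by rewrite !mulgA !mulgVK.
Qed.

(** [tdiff_bijective_transfer] requires continuity at every point, in order to recognise the default
    value of the differential. *)
Lemma polar_continuous : continuous P.
Proof.
have [eM ec ed] := lie_hom_morphism eta_hom.
have [kM kc kd] := lie_hom_morphism kappa_hom.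
have [gexp _ _] := lie_exp_map GC (@cvec_complete R d).
have [kexp _ _] := lie_exp_map KC (@cvec_complete R e).
have ic : continuous iota by move=> x; exact: (iota_hom.2 x I).1.
move=> q.
pose A1 (X : V) := lie_diff eta (- m *: kp X + pp X).
pose A2 (X : V) := lie_diff kappa ((1 + m) *: lie_lift j (kp X)).
have el : linear (lie_diff eta) by exact: tdiff_linear.
have kl : linear (lie_diff kappa) by exact: tdiff_linear.
have A1c : continuous A1.
  apply: linear_continuous_rV => c X Y; rewrite /A1 kpart_linear ppart_linear -el.
  by congr (lie_diff eta _); apply/rowP => i; rewrite !mxE; ring.
have A2c : continuous A2.
  apply: linear_continuous_rV => c X Y; rewrite /A2 lie_lift_linear -kl.
  by congr (lie_diff kappa _); apply/rowP => i; rewrite !mxE; ring.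
have q2 : (fun q : TG G => q.2) @ q --> q.2 by exact: cvg_snd.
have q1 : (fun q : TG G => q.1) @ q --> q.1 by exact: cvg_fst.
have c1 := cvg_comp _ _ (cvg_comp _ _ (cvg_comp _ _ q2 (A1c _)) (@mulI_continuous R d (A1 q.2))) (gexp _).
have c2 := cvg_comp _ _ (cvg_comp _ _ (cvg_comp _ _ (cvg_comp _ _ q2 (A2c _)) (@mulI_continuous R e (A2 q.2))) (kexp _)) (ic _).
have c0 := cvg_comp _ _ q1 (ec q.1).
exact: (cvg_mulg (cvg_mulg c0 c1) c2).
Qed.

Lemma L_act_mdiff (g : G) (h : K) q : mdiff (TG_atlas G) (TG_atlas G) (L_act j g h) q.
Proof.
have pG := @lg_proper R _ G; have pV := vec_atlas_proper V.
have m1 := mdiff_fst q pG pV; have m2 := mdiff_snd q pG pV.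
have [m3 _] := mdiff_comp (prod_atlas_proper pG pV) pG m1 (lmul_mdiff g q.1).
have [m4 _] := mdiff_comp (prod_atlas_proper pG pV) pG m3 (rmul_mdiff (j h)^-1%g (g * q.1)%g).
have mA : mdiff (vec_atlas V) (vec_atlas V) (Ad (j h)) q.2.
  split; first exact: Ad_continuous.
  pose L : {linear V -> V} := HB.pack (Ad (j h)) (GRing.isLinear.Build _ _ _ _ _ (Ad_linear (j h))).
  by apply: (@linear_differentiable _ _ _ L) => y; exact: Ad_continuous.
have [m5 _] := mdiff_comp (prod_atlas_proper pG pV) pV m2 mA.
exact: (mdiff_pair m4 m5).1.
Qed.

Lemma L_actK (g : G) (h : K) : cancel (L_act j g h) (L_act j g^-1%g h^-1%g).
Proof.
have [jM _ _] := lie_hom_morphism j_hom.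
move=> [x X]; rewrite /L_act /= (morphV jM) AdVK invgK.
by rewrite !mulgA mulVg mul1g mulgVK.
Qed.

(** By equivariance [P_] intertwines a diffeomorphism of TG with a two-sided translation of G^C. *)
Lemma nonsingular_L_act (g : G) (h : K) q : NS q -> NS (L_act j g h q).
Proof.
have pG := @lg_proper R _ G; have pV := vec_atlas_proper V.
have pC := lg_proper GC.
pose a := eta g; pose b := ((eta (j h))^-1)%g.
pose t (y : GC) := (a * y * b)%g; pose t' (y : GC) := (a^-1 * y * b^-1)%g.
have td (c c' y : GC) : mdiff (lg_atlas GC) (lg_atlas GC) (fun y => (c * y * c')%g) y.
  exact: (mdiff_comp pC pC (lmul_mdiff c y) (rmul_mdiff c' (c * y)%g)).1.
apply: (tdiff_bijective_transfer (A := TG_atlas G) (B := lg_atlas GC) (f := P) (s := L_act j g h) (s' := L_act j g^-1%g h^-1%g)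
  (t := t) (t' := t')).
- exact: prod_atlas_proper.
- exact: pC.
- exact: L_act_mdiff.
- exact: L_act_mdiff.
- exact: L_actK.
- by have := L_actK g^-1%g h^-1%g; rewrite !invgK.
- exact: td.
- exact: td.
- by move=> y; rewrite /t /t' !mulgA mulVg mul1g mulgK.
- by move=> y; rewrite /t /t' !mulgA mulgV mul1g mulgVK.
- by move=> x; rewrite polar_equivariant.
- exact: polar_continuous.
Qed.

Local Notation Om := (connected_component NS (1%g, 0)).

Lemma component_orbit (T : topologicalType) (s : T -> TG G) q : connected [set: T] ->
  continuous s -> (forall t, NS (s t)) -> (exists t, s t = q) -> Om q -> forall t, Om (s t).
Proof.
move=> cT cs NSs [t0 st0] Omq t.
rewrite (same_connected_component Omq).
apply: (@connected_component_max _ _ (s @` setT)).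
- by exists t0.
- by move=> _ [u _ <-].
- by apply: connected_continuous_connected => //; exact: continuous_subspaceT.
- by exists t.
Qed.

Hypothesis G_connected : connected [set: G].

(** K and G are connected and orbits stay in the nonsingular set, so moving first along K and then
    along G does not leave the component. *)
Lemma component_L_act (g : G) (h : K) q : Om q -> Om (L_act j g h q).
Proof.
have [jM jc _] := lie_hom_morphism j_hom; have [K_connected _ _ _ _] := K_subgroup.
have L1 q' : L_act j 1%g 1%g q' = q'.
  by case: q' => x X; rewrite /L_act /= (morph1 jM) Ad1 invg1 mulg1 mul1g.
move=> Omq.
have Omh : Om (L_act j 1%g h q).
  apply: (component_orbit (T := K) (s := fun h => L_act j 1%g h q) (q := q)) => //.
  - move=> h'; have c1 : (fun h : K => (1 * q.1 * (j h)^-1)%g) @ h' --> (1 * q.1 * (j h')^-1)%g.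
      by apply: cvg_mulg; [exact: cvg_cst|apply: cvg_invg; exact: jc].
    have Ac : (fun h : K => Adm (j h)) @ h' --> Adm (j h').
      exact: (cvg_comp _ _ (jc h') (@Adm_continuous R n G (j h'))).
    have c2 : (fun h : K => Ad (j h) q.2) @ h' --> Ad (j h') q.2.
      have eA x : Ad (j x) q.2 = (q.2 : V) *m Adm (j x) by rewrite mul_Adm.
      rewrite eA; under eq_fun do rewrite eA.
      by apply: cvg_mulmx => //; exact: cvg_cst.
    exact: (cvg_pair c1 c2).
  - by move=> h'; apply: nonsingular_L_act; exact: connected_component_sub Omq.
  - by exists 1%g.
apply: (component_orbit (T := G) (s := fun g => L_act j g h q) (q := L_act j 1%g h q)) => //.
- move=> g'; have c1 : (fun g : G => (g * q.1 * (j h)^-1)%g) @ g' --> (g' * q.1 * (j h)^-1)%g.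
    by apply: cvg_mulg; [apply: cvg_mulg; [exact: cvg_id|exact: cvg_cst]|exact: cvg_cst].
  have c2 : (fun g : G => Ad (j h) q.2) @ g' --> Ad (j h) q.2 by exact: cvg_cst.
  exact: (cvg_pair c1 c2).
- by move=> g'; apply: nonsingular_L_act; exact: connected_component_sub Omq.
- by exists 1%g.
Qed.

Variables (a : {vspace V}) (ap : set V).
Hypothesis a_maximal : maximal_abelian G p a.
Hypothesis ap_chamber : closed_weyl_chamber G a ap.
Hypothesis Om_open : open Om.
Hypothesis Om0 : Om (1%g, 0).
Local Notation Sm := (Sigma_ k p j eta kappa iota ap m).

(** Left translations make the component a product of G with its fibre [U] over 1, and
    [chamber_saturation] applies to [U]. For the converse, the slice component lies in [Om] because
    it is a connected nonsingular set through (1, 0). *)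
Theorem component_slice : Om = L_orbit j Sm.
Proof.
have [jM _ _] := lie_hom_morphism j_hom.
have mv (x : G) X (g : G) (h : K) : Om (x, X) -> Om ((g * x * (j h)^-1)%g, Ad (j h) X).
  exact: (@component_L_act g h (x, X)).
apply/seteqP; split=> [[x X] OmxX|_ [g [h [s [Ss ->]]]]]; last first.
  apply: component_L_act; apply: (@connected_component_max _ _ Sm) => //.
  - exact: connected_component_trans Ss (connected_component_sym Ss).
  - by move=> q /connected_component_sub[].
  - exact: component_connected.
pose U : set V := [set X | Om (1%g, X)].
have tr (g x' : G) X' : Om (x', X') -> Om ((g * x')%g, X').
  by move=> /(mv _ _ g 1%g); rewrite (morph1 jM) invg1 mulg1 Ad1.
have incl : continuous (fun X : V => (1%g, X) : TG G).
  move=> Y; have c1 : (fun _ : V => 1%g : G) @ Y --> (1%g : G) by exact: (@cvg_cst G 1%g V (nbhs Y) (nbhs_filter Y)).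
  have c2 : (fun X : V => X) @ Y --> Y by exact: cvg_id.
  exact: (cvg_pair c1 c2).
have U_open : open U.
  by move/continuousP: incl; exact.
(* By left invariance the fibre over 1 is the whole projection of [Om] to the Lie algebra, a
   continuous image of a connected set. *)
have U_connected : connected U.
  have -> : U = snd @` Om.
    apply/seteqP; split=> [Y UY|_ [[y Y] OmY <-]]; first by exists (1%g, Y).
    by have := tr y^-1%g _ _ OmY; rewrite mulVg.
  apply: connected_continuous_connected; first exact: component_connected.
  by apply: continuous_subspaceT => q; exact: cvg_snd.
have U_inv (h : K) Y : U Y -> U (Ad (j h) Y).
  by move=> /(mv _ _ (j h) h); rewrite mulg1 mulgV.
have UX : U X by have := tr x^-1%g _ _ OmxX; rewrite mulVg.
have [h S] := chamber_saturation K_subgroup U_open U_connected Om0 U_inv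
  kp_cartan a_maximal ap_chamber UX.
(* Undo the rotation by [h]: acting by h^-1 returns Ad(j h) X to X and multiplies the base point by
   j h on the right, which the first factor compensates. *)
exists (x * (j h)^-1)%g, h^-1%g, (1%g, Ad (j h) X); split; last first.
  by rewrite /L_act /= (morphV jM) AdVK invgK mulg1 mulgVK.
set C := connected_component _ _ in S.
apply: (@connected_component_max _ _ ((fun X : V => (1%g, X) : TG G) @` C)).
- by exists 0 => //; exact: connected_component_trans S (connected_component_sym S).
- move=> _ [Y CY <-]; have [UY apY] := connected_component_sub CY.
  by split; [|exact: connected_component_sub UY].
- apply: connected_continuous_connected; first exact: component_connected.
  exact: continuous_subspaceT.
- by exists (Ad (j h) X).
Qed.

End Polar.

Theorem proposition3p2 (R : realType) (m : R)
  (n : nat) (G : lieGroup 'rV[R]_n)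
  (G_connected : connected [set: G]) (G_noncompact : ~ compact [set: G])
  (G_semisimple : semisimple G)
  (k p a : {vspace 'rV[R]_n}) (ap : set 'rV[R]_n)
  (kp_cartan : cartan_decomposition G k p)
  (a_maximal : maximal_abelian G p a) (ap_chamber : closed_weyl_chamber G a ap)
  (l : nat) (K : lieGroup 'rV[R]_l) (j : K -> G)
  (K_subgroup : is_connected_subgroup j k)
  (d : nat) (GC : complexLieGroup R d) (eta : G -> GC)
  (GC_universal : is_universal_complexification eta)
  (e : nat) (KC : complexLieGroup R e) (kappa : K -> KC)
  (KC_universal : is_universal_complexification kappa)
  (iota : KC -> GC) (iota_hom : hol_hom iota)
  (iota_kappa : forall h : K, iota (kappa h) = eta (j h))
  (Omega : set (TG G))
  (Omega_maximal : maximal_adapted_complexification (nabla G k p m) Omega)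
  (Omega_component :
     Omega = connected_component (nonsingular k p j eta kappa iota m) (1%g, 0)) :
  Omega = L_orbit j (Sigma_ k p j eta kappa iota ap m).
Proof.
have [[Om_open _ Om0 _] _] := Omega_maximal.
rewrite Omega_component in Om_open Om0 *.
exact: (component_slice kp_cartan K_subgroup GC_universal.1 KC_universal.1 iota_hom
  iota_kappa G_connected a_maximal ap_chamber Om_open (Om0 1%g)).
Qed.
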